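(* Let $\overline{M}\times_F\widetilde{N}$ be the warped product manifold (of dimension $n=4$) of a $1$-dimensional manifold $(\overline{M},\overline{g})$, $\overline{g}_{11}=\pm1$, and a $3$-dimensional Riemannian manifold $(\widetilde{N},\widetilde{g})$ which is one of the following: a Berger sphere, the Heisenberg group $Nil_3$, $\widetilde{PSL(2,\mathbb R)}$ (the universal covering of the Lie group $PSL(2,\mathbb R)$), the Lie group $Sol_3$, a Riemannian manifold isometric to an open part of the ($3$-dimensional) Cartan hypersurface, or a three-sphere of Kaluza-Klein type whose Ricci tensor has exactly two distinct eigenvalues. Then on $\overline{M}\times_F\widetilde{N}$ there are functions $L$ and $L_C$ such that $$R\cdot R-Q(S,R)=L\,Q(g,C),\qquad C\cdot C=L_C\,Q(g,C),$$ $$C\cdot R+R\cdot C=Q(S,C)+(L+L_C)\,Q(g,C)-\frac1{(n-2)^2}\,Q\Big(g,\frac{n-2}2\,S\wedge S-\kappa\,g\wedge S+g\wedge S^2\Big).$$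
   Context: All manifolds are connected, paracompact and of class $C^\infty$. For a semi-Riemannian manifold $(M,g)$, $n=\dim M$, with Levi-Civita connection $\nabla$: ${\mathcal R}(X,Y)Z=\nabla_X\nabla_YZ-\nabla_Y\nabla_XZ-\nabla_{[X,Y]}Z$, $R(X_1,X_2,X_3,X_4)=g({\mathcal R}(X_1,X_2)X_3,X_4)$, $S(X,Y)=\mathrm{tr}\{Z\mapsto{\mathcal R}(Z,X)Y\}$, $g({\mathcal S}X,Y)=S(X,Y)$, $S^2(X,Y)=S({\mathcal S}X,Y)$, $\kappa=\mathrm{tr}\,{\mathcal S}$. For symmetric $(0,2)$-tensors $E,F$: $(E\wedge F)(X_1,X_2,X_3,X_4)=E(X_1,X_4)F(X_2,X_3)+E(X_2,X_3)F(X_1,X_4)-E(X_1,X_3)F(X_2,X_4)-E(X_2,X_4)F(X_1,X_3)$; $G=\frac12g\wedge g$; $C=R-\frac1{n-2}g\wedge S+\frac\kappa{(n-2)(n-1)}G$ is the Weyl tensor. For $B\in\{R,C\}$ define ${\mathcal B}$ by $g({\mathcal B}(X_1,X_2)X_3,X_4)=B(X_1,X_2,X_3,X_4)$; for a $(0,k)$-tensor $T$, $(B\cdot T)(X_1,\dots,X_k,X,Y)=-\sum_iT(X_1,\dots,{\mathcal B}(X,Y)X_i,\dots,X_k)$. For a symmetric $(0,2)$-tensor $A$, $(X\wedge_AY)Z=A(Y,Z)X-A(X,Z)Y$ and $Q(A,T)(X_1,\dots,X_k,X,Y)=-\sum_iT(X_1,\dots,(X\wedge_AY)X_i,\dots,X_k)$.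 Warped product: $F$ is a positive smooth function on $\overline M$ and $g=\pi_1^*\overline g+(F\circ\pi_1)\,\pi_2^*\widetilde g$ on $\overline M\times\widetilde N$. The listed $3$-manifolds: Berger spheres are $S^3=SU(2)$ with the (non-round) left-invariant metrics obtained from the round metric by rescaling along the Hopf fibres; $Nil_3$, $\widetilde{PSL(2,\mathbb R)}$ and $Sol_3$ carry their standard left-invariant Thurston-geometry metrics (for $Sol_3$: $e^{2z}dx^2+e^{-2z}dy^2+dz^2$); the $3$-dimensional Cartan hypersurface is the minimal isoparametric hypersurface of the unit sphere $S^4$ with principal curvatures $\sqrt3,0,-\sqrt3$; metrics of Kaluza-Klein type on $S^3=SU(2)$ are the left-invariant metrics $\lambda\,\theta^1\otimes\theta^1+\mu\,\theta^2\otimes\theta^2+\nu\,\theta^3\otimes\theta^3$, $\lambda,\mu,\nu>0$, where $\theta^1,\theta^2,\theta^3$ is the standard left-invariant coframe. The Ricci tensor of each listed manifold has exactly two distinct eigenvalues. *)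

(* Defs.v *)
From HB Require Import structures.
From mathcomp Require Import all_boot all_order all_algebra.
From mathcomp Require Import all_classical all_reals.
From mathcomp Require Import topology normedtype derive sequences exp.

Set Implicit Arguments.
Unset Strict Implicit.
Unset Printing Implicit Defensive.

Import Order.TTheory GRing.Theory Num.Theory.
Import numFieldNormedType.Exports.

Local Open Scope classical_set_scope.
Local Open Scope ring_scope.

(* Vectors are row vectors, acted on by matrices from the right; the matrix A
   of a bilinear form is evaluated as u *m A *m v^T. *)

Section Smooth.
Variable R : realType.

Definition partial n (i : 'I_n) (f : 'rV[R]_n -> R) : 'rV[R]_n -> R :=
  fun x => 'D_(delta_mx 0 i) f x.

(* Infinitely (Frechet) differentiable at every point of U; U is open in all
   uses. *)
Definition smooth_on n (U : set 'rV[R]_n) (f : 'rV[R]_n -> R) : Prop :=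
  forall (s : seq 'I_n) (x : 'rV[R]_n),
    U x -> differentiable (foldr (@partial n) f s) x.

Definition smooth_map_on n m (U : set 'rV[R]_n) (f : 'rV[R]_n -> 'rV[R]_m) :
    Prop :=
  forall k : 'I_m, smooth_on U (fun x => f x 0 k).

Definition bilform n (A : 'M[R]_n) (u v : 'rV[R]_n) : R :=
  (u *m A *m v^T) 0 0.

Definition dotv n (u v : 'rV[R]_n) : R := (u *m v^T) 0 0.

End Smooth.

Section TensorAlgebra.
Variables (R : realType) (n : nat).
Local Notation V := 'rV[R]_n.
Definition tensor2 := V -> V -> R.
Definition tensor4 := V -> V -> V -> V -> R.

Definition kulkarni_nomizu (E F : tensor2) : tensor4 := fun X1 X2 X3 X4 =>
  E X1 X4 * F X2 X3 + E X2 X3 * F X1 X4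
  - E X1 X3 * F X2 X4 - E X2 X4 * F X1 X3.

(* The operator calB with g(calB(X1,X2)X3, X4) = B(X1,X2,X3,X4). *)
Definition curv_endo (g : 'M[R]_n) (B : tensor4) (X1 X2 X3 : V) : V :=
  (\row_k B X1 X2 X3 (delta_mx 0 k)) *m invmx g.

Definition wedge_endo (A : tensor2) (X Y Z : V) : V :=
  A Y Z *: X - A X Z *: Y.

Definition endo_act (D : V -> V -> V -> V) (T : tensor4)
    (X1 X2 X3 X4 X Y : V) : R :=
  - (T (D X Y X1) X2 X3 X4 + T X1 (D X Y X2) X3 X4
     + T X1 X2 (D X Y X3) X4 + T X1 X2 X3 (D X Y X4)).

Definition dotT (g : 'M[R]_n) (B T : tensor4) := endo_act (curv_endo g B) T.

Definition tachibana (A : tensor2) (T : tensor4) := endo_act (wedge_endo A) T.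

End TensorAlgebra.

(* Curvature of a semi-Riemannian metric on an open set of R^n, given by its
   component matrices g x = (g_ij(x)). *)
Section Curvature.
Variables (R : realType) (n : nat) (g : 'rV[R]_n -> 'M[R]_n).
Local Notation V := 'rV[R]_n.

Definition christoffel (i j : 'I_n) (x : V) : V :=
  \row_k (2^-1 * \sum_l invmx (g x) k l *
    (partial i (fun y => g y j l) x + partial j (fun y => g y i l) x
     - partial l (fun y => g y i j) x)).

Definition nabla (X Y : V -> V) : V -> V := fun x =>
  'D_(X x) Y x
  + \sum_i \sum_j (X x 0 i * Y x 0 j) *: christoffel i j x.

Definition lie_bracket (X Y : V -> V) : V -> V := fun x =>
  'D_(X x) Y x - 'D_(Y x) X x.

Definition curv_field (X Y Z : V -> V) : V -> V := fun x =>
  nabla X (nabla Y Z) x - nabla Y (nabla X Z) x - nabla (lie_bracket X Y) Z x.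

(* The value of the curvature on tangent vectors at x, computed on the
   extensions of these vectors with constant components. *)
Definition curv (x : V) (u v w : V) : V :=
  curv_field (fun=> u) (fun=> v) (fun=> w) x.

Definition metric (x : V) : tensor2 R n := bilform (g x).

Definition riemann (x : V) : tensor4 R n := fun X1 X2 X3 X4 =>
  metric x (curv x X1 X2 X3) X4.

Definition ricci (x : V) : tensor2 R n := fun X Y =>
  \tr (lin1_mx (fun Z => curv x Z X Y)).

(* X *m ricci_op x is the vector with g(X *m ricci_op x, Y) = S(X, Y). *)
Definition ricci_op (x : V) : 'M[R]_n :=
  (\matrix_(i, j) ricci x (delta_mx 0 i) (delta_mx 0 j)) *m invmx (g x).

Definition ricci2 (x : V) : tensor2 R n := fun X Y =>
  ricci x (X *m ricci_op x) Y.

Definition scalar_curv (x : V) : R := \tr (ricci_op x).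

Definition Gtensor (x : V) : tensor4 R n := fun X1 X2 X3 X4 =>
  2^-1 * kulkarni_nomizu (metric x) (metric x) X1 X2 X3 X4.

Definition weyl (x : V) : tensor4 R n := fun X1 X2 X3 X4 =>
  riemann x X1 X2 X3 X4
  - (n%:R - 2)^-1 * kulkarni_nomizu (metric x) (ricci x) X1 X2 X3 X4
  + scalar_curv x / ((n%:R - 2) * (n%:R - 1)) * Gtensor x X1 X2 X3 X4.

End Curvature.

(* A space with a family of charts and, in every chart, a matrix-valued
   function of the coordinates.  The manifold axioms are in semi_riemannian,
   so that products can be formed on the level of the data. *)
Record metric_atlas (R : realType) (n : nat) := MetricAtlas {
  carrier :> topologicalType;
  chart : Type;
  chart_dom : chart -> set carrier;
  chart_coord : chart -> carrier -> 'rV[R]_n;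
  chart_param : chart -> 'rV[R]_n -> carrier;
  components : chart -> 'rV[R]_n -> 'M[R]_n
}.

Section Manifold.
Variables (R : realType) (n : nat).

Definition paracompact (T : topologicalType) : Prop :=
  forall C : set (set T),
    (forall A, C A -> open A) -> \bigcup_(A in C) A = [set: T] ->
    exists D : set (set T),
      [/\ forall B, D B -> open B,
          \bigcup_(B in D) B = [set: T],
          forall B, D B -> exists2 A, C A & B `<=` A
        & forall p : T, exists2 W, nbhs p W &
            finite_set [set B | D B /\ B `&` W !=set0]].

Definition image_dom (M : metric_atlas R n) (c : chart M) : set 'rV[R]_n :=
  chart_coord c @` chart_dom c.

Definition smooth_atlas (M : metric_atlas R n) : Prop :=
  [/\ forall c : chart M, open (chart_dom c) /\ open (image_dom c),
      forall c : chart M, {within chart_dom c, continuous (chart_coord c)}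
        /\ {within image_dom c, continuous (@chart_param _ _ M c)},
      forall (c : chart M) (p : M), chart_dom c p -> chart_param c (chart_coord c p) = p,
      forall p : M, exists c : chart M, chart_dom c p
    & forall c d : chart M,
        smooth_map_on (chart_coord c @` (chart_dom c `&` chart_dom d)) (chart_coord d \o chart_param c)].

Definition manifold (M : metric_atlas R n) : Prop :=
  [/\ hausdorff_space M, connected [set: M], paracompact M & smooth_atlas M].

Definition semi_riemannian (M : metric_atlas R n) : Prop :=
  [/\ manifold M,
      forall (c : chart M) (i j : 'I_n),
        smooth_on (image_dom c) (fun x => components c x i j),
      forall (c : chart M) x, image_dom c x ->
        (components c x)^T = components c x /\ components c x \in unitmx
    & forall (c d : chart M) x, (chart_coord c @` (chart_dom c `&` chart_dom d)) x ->
        let J := jacobian (chart_coord d \o chart_param c) x in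
        components c x =
          J *m components d (chart_coord d (chart_param c x)) *m J^T].

Definition riemannian (M : metric_atlas R n) : Prop :=
  semi_riemannian M /\
  forall (c : chart M) x, image_dom c x ->
    forall v : 'rV[R]_n, v != 0 -> 0 < bilform (components c x) v v.

Definition smooth_function (M : metric_atlas R n) (f : M -> R) : Prop :=
  forall c : chart M, smooth_on (image_dom c) (f \o chart_param c).

(* M is isometric to the embedded submanifold S of R^m that carries the
   restriction to TS of the field h of bilinear forms: f is a smooth bijection
   of M onto S whose pullback of h is the metric of M.  As that metric is
   nondegenerate, f is an immersion. *)
Definition isometric_to (M : metric_atlas R n) m (S : set 'rV[R]_m)
    (h : 'rV[R]_m -> 'M[R]_m) : Prop :=
  exists f : M -> 'rV[R]_m,
    [/\ forall c : chart M, smooth_map_on (image_dom c) (f \o chart_param c),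
        injective f,
        f @` [set: M] = S
      & forall (c : chart M) x, image_dom c x ->
          let J := jacobian (f \o chart_param c) x in
          components c x = J *m h (f (chart_param c x)) *m J^T].

Definition two_ricci_eigenvalues (M : metric_atlas R n) : Prop :=
  forall (c : chart M) x, image_dom c x ->
    exists a b : R, a <> b /\
      forall r : R, eigenvalue (ricci_op (@components _ _ M c) x) r
        <-> r = a \/ r = b.

End Manifold.

Definition warped_product (R : realType) (m n : nat)
    (M : metric_atlas R m) (N : metric_atlas R n) (F : M -> R) :
    metric_atlas R (m + n) :=
  @MetricAtlas R (m + n) (M * N)%type (chart M * chart N)%type
    (fun c => chart_dom c.1 `*` chart_dom c.2)
    (fun c p => row_mx (chart_coord c.1 p.1) (chart_coord c.2 p.2))
    (fun c x => (chart_param c.1 (lsubmx x), chart_param c.2 (rsubmx x)))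
    (fun c x => block_mx (components c.1 (lsubmx x)) 0
                         0 (F (chart_param c.1 (lsubmx x)) *: components c.2 (rsubmx x))).

Section Models.
Variable R : realType.

Definition row_of_seq n (s : seq R) : 'rV[R]_n := \row_i s`_i.

Definition co n (x : 'rV[R]_n.+1) (k : nat) : R := x 0 (inord k).

Definition sq_form n (theta : 'rV[R]_n) : 'M[R]_n := theta^T *m theta.

Definition unit_sphere n : set 'rV[R]_n := [set q | dotv q q = 1].

(* SU(2) is the group of unit quaternions q = q0 + q1 i + q2 j + q3 k; the
   left-invariant coframe is q^-1 dq = theta1 i + theta2 j + theta3 k, i.e. the
   forms dual to the left-invariant fields q i, q j, q k.  The round metric is
   the case lambda = mu = nu = 1, and the Hopf fibres q e^(it) are tangent to
   q i. *)
Definition su2_metric (lambda mu nu : R) (q : 'rV[R]_4) : 'M[R]_4 :=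
  let q0 := co q 0 in let q1 := co q 1 in
  let q2 := co q 2 in let q3 := co q 3 in
  lambda *: sq_form (row_of_seq 4 [:: - q1; q0; q3; - q2])
  + mu *: sq_form (row_of_seq 4 [:: - q2; - q3; q0; q1])
  + nu *: sq_form (row_of_seq 4 [:: - q3; q2; - q1; q0]).

Definition kaluza_klein_sphere (N : metric_atlas R 3) (lambda mu nu : R) :
    Prop :=
  isometric_to N (@unit_sphere 4) (su2_metric lambda mu nu).

Definition berger_sphere (N : metric_atlas R 3) : Prop :=
  exists t : R, [/\ 0 < t, t <> 1 & kaluza_klein_sphere N t 1 1].

(* dx^2 + dy^2 + (dz - x dy)^2, left-invariant on the group of unipotent upper
   triangular matrices with entries x = a_12, y = a_23, z = a_13. *)
Definition nil_metric (p : 'rV[R]_3) : 'M[R]_3 :=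
  sq_form (row_of_seq 3 [:: 1; 0; 0])
  + sq_form (row_of_seq 3 [:: 0; 1; 0])
  + sq_form (row_of_seq 3 [:: 0; - co p 0; 1]).

Definition is_nil3 (N : metric_atlas R 3) : Prop :=
  isometric_to N [set: 'rV[R]_3] nil_metric.

(* (dx^2 + dy^2) / y^2 + (dt + dx / y)^2 with y > 0: PSL(2,R) is the unit
   tangent bundle of the hyperbolic plane with the metric induced by the
   Levi-Civita connection of the latter; t is the angle between the unit vector
   and d/dx, which runs over R on the universal covering. *)
Definition psl2_metric (p : 'rV[R]_3) : 'M[R]_3 :=
  let y := co p 1 in
  sq_form (row_of_seq 3 [:: y^-1; 0; 0])
  + sq_form (row_of_seq 3 [:: 0; y^-1; 0])
  + sq_form (row_of_seq 3 [:: y^-1; 0; 1]).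

Definition is_psl2_cover (N : metric_atlas R 3) : Prop :=
  isometric_to N [set p : 'rV[R]_3 | 0 < co p 1] psl2_metric.

(* e^(2z) dx^2 + e^(-2z) dy^2 + dz^2 *)
Definition sol_metric (p : 'rV[R]_3) : 'M[R]_3 :=
  let z := co p 2 in
  sq_form (row_of_seq 3 [:: expR z; 0; 0])
  + sq_form (row_of_seq 3 [:: 0; expR (- z); 0])
  + sq_form (row_of_seq 3 [:: 0; 0; 1]).

Definition is_sol3 (N : metric_atlas R 3) : Prop :=
  isometric_to N [set: 'rV[R]_3] sol_metric.

(* Near each of its points, Sigma is a regular level set of a smooth function f
   on S^4, with tangent spaces T_q Sigma = {v | v _|_ q, df_q(v) = 0}, and nu
   is a unit normal field of Sigma in S^4 (extended to the open set U of R^5).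
   For v tangent to Sigma the derivative of nu along v is again tangent to
   Sigma, so the shape operator is v |-> - D_v nu.  As T_q Sigma has dimension
   3, the three eigenvalues sqrt 3, 0, - sqrt 3 are all principal curvatures,
   and Sigma is minimal. *)
Definition cartan_hypersurface (Sigma : set 'rV[R]_5) : Prop :=
  [/\ Sigma !=set0, compact Sigma, connected Sigma &
    forall p, Sigma p ->
      exists (U : set 'rV[R]_5) (f : 'rV[R]_5 -> R)
             (nu : 'rV[R]_5 -> 'rV[R]_5),
      [/\ open U /\ U p, smooth_on U f, smooth_map_on U nu,
          Sigma `&` U = @unit_sphere 5 `&` U `&` [set q | f q = 0]
        & forall q, Sigma q -> U q ->
          let tangent v := dotv v q = 0 /\ 'D_v f q = 0 in
          [/\ exists v, dotv v q = 0 /\ 'D_v f q <> 0,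
              dotv (nu q) (nu q) = 1 /\ dotv (nu q) q = 0,
              forall v, tangent v -> dotv (nu q) v = 0
            & forall k : R, k \in [:: Num.sqrt 3; 0; - Num.sqrt 3] ->
                exists v, [/\ v != 0, tangent v & - 'D_v nu q = k *: v]]]].

Definition open_part_of_cartan (N : metric_atlas R 3) : Prop :=
  exists Sigma W : set 'rV[R]_5,
    [/\ cartan_hypersurface Sigma, open W
      & isometric_to N (Sigma `&` W) (fun=> 1%:M)].

Definition listed_fibre (N : metric_atlas R 3) : Prop :=
  berger_sphere N \/ is_nil3 N \/ is_psl2_cover N \/ is_sol3 N \/
  open_part_of_cartan N \/
  exists lambda mu nu : R,
    [/\ 0 < lambda, 0 < mu, 0 < nu, kaluza_klein_sphere N lambda mu nu
      & two_ricci_eigenvalues N].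

End Models.

(* Main.v *)
(* Each listed fibre has, at every point, a unit vector e such that its curvature
   tensor is alpha/2 h ^ h + beta h ^ w^2, where w = h(., e), ^ is the
   Kulkarni-Nomizu product, and the constants alpha and beta depend only on the
   fibre.  For the homogeneous models this follows from the structure equations
   of an orthonormal coframe, for the Cartan hypersurface from the Gauss equation;
   for the spheres of Kaluza-Klein type the curvature operator is diagonal in the
   left-invariant frame, and two equal Ricci eigenvalues make two of its three
   entries equal.  The curvature tensor of the warped product with fibre metric
   F h is then p/2 H ^ H + q T^2 ^ H + r H ^ w^2 (now with w of unit length for
   F h), where H is the fibre part of g, T is the unit covector of the base,
   r = beta / F and q = - (F''/2 - F'^2 / (4 F)) / F.  Hence the three
   identities become polynomial identities in the values of g, T and w,
   with L = - 2 eps q and L_C = r / 6.  Both functions are independent of the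
   chart, because F' is determined up to sign and F'' uniquely. *)

Require Import Defs.
From mathcomp Require Import all_boot all_order all_algebra.
From mathcomp Require Import all_classical all_reals.
From mathcomp Require Import topology normedtype landau derive sequences exp.
From mathcomp Require Import ring.

Set Implicit Arguments.
Unset Strict Implicit.
Unset Printing Implicit Defensive.

Import Order.TTheory GRing.Theory Num.Theory.
Import numFieldNormedType.Exports.

Local Open Scope classical_set_scope.
Local Open Scope ring_scope.

(** * Algebra of curvature-like tensors *)

(** Curvature is defined here through Christoffel symbols in coordinates, which contain the inverse
    metric. To keep that inverse out of the calculations, connections are handled through the
    numbers g(nabla_u v, w) with constant fields u, v, w, and vectors are recovered from them by
    nondegeneracy. A fibre is compared with its model only by a smooth bijection with prescribed
    pullback metric, so all work takes place in charts of the fibre, with coframes or position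
    vectors pulled back to them. The three identities are algebraic at each point; hence the axis e
    is only required to exist pointwise, and no smooth field of axes has to be constructed. The
    functions have a direct meaning: eps q is the sectional curvature of every plane containing the
    base direction, so L is -2 times this curvature, while the terms with p and q form a conformally
    flat curvature tensor, so that the Weyl tensor is r times a fixed tensor and L_C is linear in
    r. *)

Section BilinearForms.
Variables (R : realType) (n : nat) (A : 'M[R]_n).
Implicit Types u v w : 'rV[R]_n.

Lemma bilformDl u v w : bilform A (u + v) w = bilform A u w + bilform A v w.
Proof. by rewrite /bilform !mulmxDl mxE. Qed.

Lemma bilformDr u v w : bilform A w (u + v) = bilform A w u + bilform A w v.
Proof. by rewrite /bilform linearD mulmxDr mxE. Qed.

Lemma bilformZl c u w : bilform A (c *: u) w = c * bilform A u w.
Proof. by rewrite /bilform -!scalemxAl mxE. Qed.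

Lemma bilformZr c u w : bilform A w (c *: u) = c * bilform A w u.
Proof. by rewrite /bilform linearZ -scalemxAr mxE. Qed.

Lemma bilformNl u w : bilform A (- u) w = - bilform A u w.
Proof. by rewrite -scaleN1r bilformZl mulN1r. Qed.

Lemma bilformNr u w : bilform A w (- u) = - bilform A w u.
Proof. by rewrite -scaleN1r bilformZr mulN1r. Qed.

Lemma bilform0l w : bilform A 0 w = 0.
Proof. by rewrite -(scale0r 0) bilformZl mul0r. Qed.

Lemma bilform0r w : bilform A w 0 = 0.
Proof. by rewrite -(scale0r 0) bilformZr mul0r. Qed.

Lemma bilform_sym u v : A^T = A -> bilform A u v = bilform A v u.
Proof.
move=> As; transitivity ((v *m A *m u^T)^T 0 0); last by rewrite mxE.
by rewrite !trmx_mul trmxK As mulmxA.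
Qed.

Definition bilformE :=
  (bilformDl, bilformDr, bilformNl, bilformNr, bilformZl, bilformZr).

Lemma bilform_row u w : bilform A u w = \sum_k u 0 k * bilform A (delta_mx 0 k) w.
Proof.
rewrite {1}(row_sum_delta u) /bilform !mulmx_suml summxE.
by apply: eq_bigr => k _; rewrite -!scalemxAl mxE.
Qed.

Lemma bilform_inj u v : A \in unitmx ->
  (forall w, bilform A u w = bilform A v w) -> u = v.
Proof.
move=> Au uv; apply: (can_inj (mulmxK Au)); apply/rowP => k.
have := uv (delta_mx 0 k).
by rewrite /bilform trmx_delta -!colE !mxE.
Qed.

Lemma row_bilform u : \row_k bilform A u (delta_mx 0 k) = u *m A.
Proof.
by apply/rowP => k; rewrite mxE /bilform trmx_delta -colE mxE.
Qed.

Lemma tr_lin1_bilform u v : \tr (lin1_mx (fun Z => bilform A Z u *: v)) = bilform A v u.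
Proof.
rewrite [RHS]bilform_row /mxtrace; apply: eq_bigr => k _.
by rewrite !mxE mulrC.
Qed.

End BilinearForms.

Lemma bilformDm (R : realType) n (A B : 'M[R]_n) u v :
  bilform (A + B) u v = bilform A u v + bilform B u v.
Proof. by rewrite /bilform mulmxDr mulmxDl mxE. Qed.

Lemma bilformZm (R : realType) n c (A : 'M[R]_n) u v :
  bilform (c *: A) u v = c * bilform A u v.
Proof. by rewrite /bilform -scalemxAr -scalemxAl mxE. Qed.

Section LinMx.
Variables (R : realType) (n : nat).

Lemma mxtrace_lin1 (f : 'rV[R]_n -> 'rV[R]_n) :
  \tr (lin1_mx f) = \sum_i f (delta_mx 0 i) 0 i.
Proof. by apply: eq_bigr => i _; rewrite mxE. Qed.

Lemma mxtrace_lin1D (f g : 'rV[R]_n -> 'rV[R]_n) :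
  \tr (lin1_mx (fun Z => f Z + g Z)) = \tr (lin1_mx f) + \tr (lin1_mx g).
Proof.
by rewrite !mxtrace_lin1 -big_split; apply: eq_bigr => i _; rewrite mxE.
Qed.

Lemma mxtrace_lin1Z c : \tr (lin1_mx (fun Z : 'rV[R]_n => c *: Z)) = c * n%:R.
Proof.
rewrite mxtrace_lin1 mulr_natr (eq_bigr (fun=> c)).
  by rewrite sumr_const card_ord.
by move=> i _; rewrite !mxE !eqxx mulr1.
Qed.

End LinMx.

Section CurvatureAlgebra.
Variables (R : realType) (n : nat) (A : 'M[R]_n) (xi e : 'rV[R]_n) (eps : R).
Hypotheses (Asym : A^T = A) (Aunit : A \in unitmx).
Hypotheses (xixi : bilform A xi xi = eps) (ee : bilform A e e = 1)
  (xie : bilform A xi e = 0).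
Local Notation V := 'rV[R]_n.
Local Notation g := (bilform A).
Implicit Types X Y Z : V.

Let exi : g e xi = 0. Proof. by rewrite bilform_sym. Qed.

(* All tensors that occur on the warped product are combinations of
   g ^ g / 2, g ^ T^2, g ^ w^2 and T^2 ^ w^2, where ^ is the Kulkarni-Nomizu
   product, T = g(., xi) is dual to the base direction and w = g(., e) to the
   axis of the fibre. *)
Definition tens4 (a b c d : R) : tensor4 R n := fun X1 X2 X3 X4 =>
  a * (g X1 X4 * g X2 X3 - g X1 X3 * g X2 X4)
  + b * kulkarni_nomizu g (fun X Y => g X xi * g Y xi) X1 X2 X3 X4
  + c * kulkarni_nomizu g (fun X Y => g X e * g Y e) X1 X2 X3 X4
  + d * kulkarni_nomizu (fun X Y => g X xi * g Y xi) (fun X Y => g X e * g Y e)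
          X1 X2 X3 X4.

Definition tens2 (a b c : R) : tensor2 R n := fun X Y =>
  a * g X Y + b * (g X xi * g Y xi) + c * (g X e * g Y e).

Definition tens4_vec (a b c d : R) (X Y Z : V) : V :=
  (a * g Y Z + b * (g Y xi * g Z xi) + c * (g Y e * g Z e)) *: X
  - (a * g X Z + b * (g X xi * g Z xi) + c * (g X e * g Z e)) *: Y
  + (b * (g Y Z * g X xi - g X Z * g Y xi)
     + d * (g X xi * g Y e - g Y xi * g X e) * g Z e) *: xi
  + (c * (g Y Z * g X e - g X Z * g Y e)
     + d * (g Y xi * g X e - g X xi * g Y e) * g Z xi) *: e.

Lemma tens4_vecP a b c d X Y Z W :
  g (tens4_vec a b c d X Y Z) W = tens4 a b c d X Y Z W.
Proof.
rewrite /tens4 /kulkarni_nomizu /tens4_vec !bilformE.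
rewrite (bilform_sym xi W Asym) (bilform_sym e W Asym).
ring.
Qed.

Lemma curv_endo_tens4 a b c d X Y Z :
  curv_endo A (tens4 a b c d) X Y Z = tens4_vec a b c d X Y Z.
Proof.
rewrite /curv_endo -[RHS](mulmxK Aunit) -(row_bilform A); congr (_ *m _).
by apply/rowP => k; rewrite !mxE tens4_vecP.
Qed.

Definition sym2 (f h : V -> R) : tensor2 R n := fun X Y => f X * h Y + h X * f Y.

(** An endomorphism that is skew for g annihilates g when acting as a derivation. So the term with
    [a] disappears, and by the Leibniz rule only T^2 and w^2 are differentiated, which keeps the
    later polynomial identities small. *)
Lemma endo_act_tens4 (D : V -> V -> V -> V) a b c d X1 X2 X3 X4 X Y :
  (forall U W, g (D X Y U) W = - g U (D X Y W)) ->
  let T2 := sym2 (fun U => g (D X Y U) xi) (g^~ xi) in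
  let w2 := sym2 (fun U => g (D X Y U) e) (g^~ e) in
  endo_act D (tens4 a b c d) X1 X2 X3 X4 X Y
  = - (b * kulkarni_nomizu g T2 X1 X2 X3 X4
       + c * kulkarni_nomizu g w2 X1 X2 X3 X4
       + d * (kulkarni_nomizu T2 (fun X Y => g X e * g Y e) X1 X2 X3 X4
              + kulkarni_nomizu (fun X Y => g X xi * g Y xi) w2 X1 X2 X3 X4)).
Proof.
move=> skew /=; rewrite /endo_act /tens4 /kulkarni_nomizu /sym2.
rewrite !(skew X1 X2, skew X1 X3, skew X1 X4, skew X2 X3, skew X2 X4).
rewrite !(skew X1, skew X2, skew X3, skew X4).
ring.
Qed.

Lemma curv_endo_tens4_skew a b c d X Y U W :
  g (curv_endo A (tens4 a b c d) X Y U) W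
  = - g U (curv_endo A (tens4 a b c d) X Y W).
Proof.
rewrite (bilform_sym U _ Asym) !curv_endo_tens4 !tens4_vecP /tens4 /kulkarni_nomizu.
ring.
Qed.

Lemma wedge_endoE X Y U W :
  g (wedge_endo g X Y U) W = g Y U * g X W - g X U * g Y W.
Proof. by rewrite /wedge_endo !bilformE. Qed.

Lemma wedge_endo_skew X Y U W :
  g (wedge_endo g X Y U) W = - g U (wedge_endo g X Y W).
Proof.
rewrite (bilform_sym U _ Asym) /wedge_endo !bilformE; ring.
Qed.

Lemma tachibana_tens4 (S : tensor2 R n) a b c d X1 X2 X3 X4 X Y :
  let T := tens4 a b c d in
  tachibana S T X1 X2 X3 X4 X Y
  = - (S Y X1 * T X X2 X3 X4 - S X X1 * T Y X2 X3 X4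
       + (S Y X2 * T X1 X X3 X4 - S X X2 * T X1 Y X3 X4)
       + (S Y X3 * T X1 X2 X X4 - S X X3 * T X1 X2 Y X4)
       + (S Y X4 * T X1 X2 X3 X - S X X4 * T X1 X2 X3 Y)).
Proof.
rewrite /= /tachibana /endo_act /wedge_endo.
congr (- (_ + _ + _ + _)); rewrite /tens4 /kulkarni_nomizu !bilformE; ring.
Qed.

Section Identities.
Variables p q r : R.
Hypothesis eps2 : eps = 1 \/ eps = -1.
(* K = p/2 H ^ H + q T^2 ^ H + r H ^ w^2 with H = g - eps T^2, written in the
   basis of tens4; note that T^2 ^ T^2 = 0. *)
Let K := tens4 p (q - eps * p) r (- eps * r).
Let s0 := 3 * p + (q - eps * p) * eps + r.
Let s1 := 2 * (q - eps * p) - eps * r.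
Let s2 := 2 * r - eps * r * eps.
Let kappa := 4 * s0 + s1 * eps + s2.
Let S := tens2 s0 s1 s2.
Let S2 := tens2 (s0 ^+ 2) (2 * s0 * s1 + eps * s1 ^+ 2) (2 * s0 * s2 + s2 ^+ 2).
Let C := tens4 (p - s0 + kappa / 6) (q - eps * p - s1 / 2) (r - s2 / 2) (- eps * r).
Let L := - 2 * eps * q.
Let LC := r / 6.


(** In an orthonormal frame containing xi and e, with sectional curvatures k_ij, the left side
    reduces up to sign to k_il k_jk - k_jl k_ik with four distinct indices. Each product has exactly
    one factor belonging to a plane through xi. This factor is eps q and can be pulled out; the
    differences of fibre curvatures that remain are multiples of r, as in Q(g, C). *)
Lemma dot_curv_curv X1 X2 X3 X4 X Y :
  dotT A K K X1 X2 X3 X4 X Y - tachibana S K X1 X2 X3 X4 X Y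
  = L * tachibana g C X1 X2 X3 X4 X Y.
Proof.
rewrite /dotT /K /C (endo_act_tens4 _ _ _ _ _ _ _ _ (curv_endo_tens4_skew _ _ _ _ X Y)).
rewrite [tachibana g _ _ _ _ _ _ _](endo_act_tens4 _ _ _ _ _ _ _ _ (wedge_endo_skew X Y)).
rewrite /= /sym2 /kulkarni_nomizu !curv_endo_tens4 !tens4_vecP.
rewrite ?tachibana_tens4 /S /tens2 /tens4 /kulkarni_nomizu !wedge_endoE.
rewrite !(xixi, ee, xie, exi).
have sg := bilform_sym _ _ Asym.
rewrite !(sg X X1, sg X X2, sg X X3, sg X X4, sg Y X1, sg Y X2, sg Y X3, sg Y X4).
(* Inserting the two values of [eps] replaces the side relation eps^2 = 1, which [field] could not
   use. *)
rewrite /L /LC /kappa /s0 /s1 /s2; case: eps2 => ->.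
all: by field.
Qed.

(** The coefficients of [C] simplify to r times (-1/3, eps/2, 1/2, -eps). Since T^2 ^ w^2 = eps/2 P
    ^ P for P = eps T^2 + w^2, the metric of the plane of xi and e, C is built from g and P alone.
    Rotations in this plane and in its orthogonal complement preserve C; on the mixed planes C acts
    as r/6 times the endomorphism of g, which gives [LC]. *)
Lemma dot_weyl_weyl X1 X2 X3 X4 X Y :
  dotT A C C X1 X2 X3 X4 X Y = LC * tachibana g C X1 X2 X3 X4 X Y.
Proof.
rewrite /dotT /C (endo_act_tens4 _ _ _ _ _ _ _ _ (curv_endo_tens4_skew _ _ _ _ X Y)).
rewrite [tachibana g _ _ _ _ _ _ _](endo_act_tens4 _ _ _ _ _ _ _ _ (wedge_endo_skew X Y)).
rewrite /= /sym2 /kulkarni_nomizu !curv_endo_tens4 !tens4_vecP.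
rewrite ?tachibana_tens4 /S /tens2 /tens4 /kulkarni_nomizu !wedge_endoE.
rewrite !(xixi, ee, xie, exi).
have sg := bilform_sym _ _ Asym.
rewrite !(sg X X1, sg X X2, sg X X3, sg X X4, sg Y X1, sg Y X2, sg Y X3, sg Y X4).
rewrite /L /LC /kappa /s0 /s1 /s2; case: eps2 => ->.
all: by field.
Qed.

Let Z : tensor4 R n := fun Y1 Y2 Y3 Y4 =>
  (4 - 2) / 2 * kulkarni_nomizu S S Y1 Y2 Y3 Y4
  - kappa * kulkarni_nomizu g S Y1 Y2 Y3 Y4 + kulkarni_nomizu g S2 Y1 Y2 Y3 Y4.

Lemma dot_weyl_curv X1 X2 X3 X4 X Y :
  dotT A C K X1 X2 X3 X4 X Y + dotT A K C X1 X2 X3 X4 X Y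
  = tachibana S C X1 X2 X3 X4 X Y + (L + LC) * tachibana g C X1 X2 X3 X4 X Y
    - ((4 - 2) ^+ 2)^-1 * tachibana g Z X1 X2 X3 X4 X Y.
Proof.
(* The products S ^ S and g ^ S^2 stay among the [tens4], because T^2 ^ T^2 and w^2 ^ w^2 vanish. *)
have -> : Z = tens4 (s0 ^+ 2 * 2 - 2 * kappa * s0 + 2 * s0 ^+ 2)
   (2 * s0 * s1 - kappa * s1 + (2 * s0 * s1 + eps * s1 ^+ 2))
   (2 * s0 * s2 - kappa * s2 + (2 * s0 * s2 + s2 ^+ 2))
   (2 * s1 * s2).
  apply/funext => Y1; apply/funext => Y2; apply/funext => Y3; apply/funext => Y4.
  rewrite /Z /S /S2 /tens4 /kulkarni_nomizu /tens2; by field.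
rewrite /dotT /K /C.
rewrite [endo_act (curv_endo A (tens4 p _ _ _)) _ _ _ _ _ _ _](endo_act_tens4 _ _ _ _ _
  _ _ _ (curv_endo_tens4_skew _ _ _ _ X Y)).
rewrite [endo_act (curv_endo A _) _ _ _ _ _ _ _](endo_act_tens4 _ _ _ _ _ _ _ _
  (curv_endo_tens4_skew _ _ _ _ X Y)).
rewrite ![tachibana g _ _ _ _ _ _ _](endo_act_tens4 _ _ _ _ _ _ _ _ (wedge_endo_skew X
  Y)).
rewrite /= /sym2 /kulkarni_nomizu !curv_endo_tens4 !tens4_vecP.
rewrite ?tachibana_tens4 /S /tens2 /tens4 /kulkarni_nomizu !wedge_endoE.
rewrite !(xixi, ee, xie, exi).
have sg := bilform_sym _ _ Asym.
rewrite !(sg X X1, sg X X2, sg X X3, sg X X4, sg Y X1, sg Y X2, sg Y X3, sg Y X4).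
rewrite /L /LC /kappa /s0 /s1 /s2; case: eps2 => ->.
all: by field.
Qed.

End Identities.

End CurvatureAlgebra.

Lemma bilform_matrix (R : realType) n (B : 'rV[R]_n -> 'rV[R]_n -> R) X Y :
  (forall c u v w, B (c *: u + v) w = c * B u w + B v w) ->
  (forall c u v w, B w (c *: u + v) = c * B w u + B w v) ->
  bilform (\matrix_(i, j) B (delta_mx 0 i) (delta_mx 0 j)) X Y = B X Y.
Proof.
move=> Bl Br.
have B0l w : B 0 w = 0.
  by have := Bl 1 0 0 w; rewrite scale1r addr0 mul1r => /eqP; rewrite addrC -subr_eq
    subrr eq_sym => /eqP.
have B0r w : B w 0 = 0.
  by have := Br 1 0 0 w; rewrite scale1r addr0 mul1r => /eqP; rewrite addrC -subr_eq
    subrr eq_sym => /eqP.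
have suml (s : seq 'I_n) w : B (\sum_(i <- s) X 0 i *: delta_mx 0 i) w
    = \sum_(i <- s) X 0 i * B (delta_mx 0 i) w.
  by elim: s => [|i s IH]; rewrite ?big_nil ?B0l// !big_cons Bl IH.
have sumr (s : seq 'I_n) w : B w (\sum_(i <- s) Y 0 i *: delta_mx 0 i)
    = \sum_(i <- s) Y 0 i * B w (delta_mx 0 i).
  by elim: s => [|i s IH]; rewrite ?big_nil ?B0r// !big_cons Br IH.
rewrite {2}(row_sum_delta X) suml [LHS]bilform_row; apply: eq_bigr => i _.
congr (_ * _); rewrite {2}(row_sum_delta Y) sumr /bilform.
rewrite -rowE mxE; apply: eq_bigr => j _.
by rewrite !mxE mulrC.
Qed.

(** * Ricci tensor, scalar curvature and Weyl tensor belonging to a curvature tensor [tens4] *)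

Section RicciAlgebra.
Variables (R : realType) (n : nat) (gc : 'rV[R]_n -> 'M[R]_n) (x : 'rV[R]_n).
Variables (xi e : 'rV[R]_n) (eps a b c d : R).
Let A := gc x.
Hypotheses (Asym : A^T = A) (Aunit : A \in unitmx).
Hypotheses (xixi : bilform A xi xi = eps) (ee : bilform A e e = 1)
  (xie : bilform A xi e = 0).
Hypothesis curvE : riemann gc x = tens4 A xi e a b c d.
Local Notation g := (bilform A).

Let exi : g e xi = 0. Proof. by rewrite bilform_sym. Qed.

Let s0 := (n%:R - 1) * a + b * eps + c.
Let s1 := (n%:R - 2) * b + d.
Let s2 := (n%:R - 2) * c + d * eps.

Lemma ricci_tens2 : ricci gc x = tens2 A xi e s0 s1 s2.
Proof.
apply/funext => X; apply/funext => Y; rewrite /ricci.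
(* The map Z -> R(Z, X)Y is k times the identity plus three maps of rank one, Z -> g(Z, u0) X and so
   on, whose traces are values of g. *)
pose k := a * g X Y + b * (g X xi * g Y xi) + c * (g X e * g Y e).
pose u0 := - a *: Y - (b * g Y xi) *: xi - (c * g Y e) *: e.
pose u1 := (b * g X Y + d * g X e * g Y e) *: xi - (b * g X xi) *: Y
           - (d * g X xi * g Y e) *: e.
pose u2 := (c * g X Y + d * g X xi * g Y xi) *: e - (c * g X e) *: Y
           - (d * g X e * g Y xi) *: xi.
have -> : (fun Z => curv gc x Z X Y) =
  (fun Z => k *: Z + g Z u0 *: X + g Z u1 *: xi + g Z u2 *: e).
  apply/funext => Z; apply: (bilform_inj Aunit) => W.
  transitivity (tens4 A xi e a b c d Z X Y W); first by rewrite -curvE.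
  rewrite -tens4_vecP // /tens4_vec /k /u0 /u1 /u2 !bilformE.
  ring.
rewrite !mxtrace_lin1D mxtrace_lin1Z !tr_lin1_bilform /k /u0 /u1 /u2 !bilformE.
rewrite xixi ee xie exi /tens2 /s0 /s1 /s2 (bilform_sym xi Y Asym) (bilform_sym e Y Asym).
ring.
Qed.

Lemma mul_ricci_op X :
  X *m ricci_op gc x = s0 *: X + (s1 * g X xi) *: xi + (s2 * g X e) *: e.
Proof.
apply: (bilform_inj Aunit) => W.
transitivity (ricci gc x X W).
  rewrite /ricci_op mulmxA {1}/bilform mulmxKV //.
  rewrite ricci_tens2 -/(bilform _ X W).
  rewrite bilform_matrix // => *; rewrite /tens2 !bilformE; ring.
rewrite ricci_tens2 /tens2 !bilformE (bilform_sym xi W Asym) (bilform_sym e W Asym); ring.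
Qed.

Lemma scalar_curv_tens : scalar_curv gc x = n%:R * s0 + s1 * eps + s2.
Proof.
transitivity (\tr (lin1_mx (fun Z => s0 *: Z + g Z (s1 *: xi) *: xi + g Z (s2 *: e) *:
  e))).
  rewrite mxtrace_lin1 /scalar_curv /mxtrace; apply: eq_bigr => i _.
  by rewrite !bilformE -mul_ricci_op -rowE [RHS]mxE.
by rewrite !mxtrace_lin1D mxtrace_lin1Z !tr_lin1_bilform !bilformE xixi ee mulr1 mulrC.
Qed.

Lemma ricci2_tens2 : ricci2 gc x =
  tens2 A xi e (s0 ^+ 2) (2 * s0 * s1 + eps * s1 ^+ 2) (2 * s0 * s2 + s2 ^+ 2).
Proof.
apply/funext => X; apply/funext => Y; rewrite /ricci2 mul_ricci_op ricci_tens2.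
rewrite /tens2 !bilformE xixi ee xie exi (bilform_sym xi Y Asym) (bilform_sym e Y Asym).
ring.
Qed.

Lemma weyl_tens4 : weyl gc x = tens4 A xi e
  (a - 2 * (n%:R - 2)^-1 * s0
   + scalar_curv gc x / ((n%:R - 2) * (n%:R - 1)))
  (b - (n%:R - 2)^-1 * s1) (c - (n%:R - 2)^-1 * s2) d.
Proof.
apply/funext => X1; apply/funext => X2; apply/funext => X3; apply/funext => X4.
rewrite /weyl /Gtensor curvE ricci_tens2 -[metric gc x]/(bilform A).
move: (_ / _) (_^-1) => k l.
rewrite /kulkarni_nomizu /tens4 /tens2 /kulkarni_nomizu; by field.
Qed.

End RicciAlgebra.

Lemma pseudosymmetric_identities (R : realType) (gc : 'rV[R]_4 -> 'M[R]_4)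
    (x xi e : 'rV[R]_4) (eps p q r : R) :
  let A := gc x in
  A^T = A -> A \in unitmx -> eps = 1 \/ eps = -1 ->
  bilform A xi xi = eps -> bilform A e e = 1 -> bilform A xi e = 0 ->
  riemann gc x = tens4 A xi e p (q - eps * p) r (- eps * r) ->
  let n : R := 4%:R in
  let g := metric gc x in
  let Rm := riemann gc x in
  let S := ricci gc x in
  let S2 := ricci2 gc x in
  let kappa := scalar_curv gc x in
  let C := weyl gc x in
  let L := - 2 * eps * q in
  let LC := r / 6 in
  forall X1 X2 X3 X4 X Y,
  [/\ dotT A Rm Rm X1 X2 X3 X4 X Y - tachibana S Rm X1 X2 X3 X4 X Y
        = L * tachibana g C X1 X2 X3 X4 X Y,
      dotT A C C X1 X2 X3 X4 X Y = LC * tachibana g C X1 X2 X3 X4 X Y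
    & dotT A C Rm X1 X2 X3 X4 X Y + dotT A Rm C X1 X2 X3 X4 X Y
        = tachibana S C X1 X2 X3 X4 X Y
          + (L + LC) * tachibana g C X1 X2 X3 X4 X Y
          - ((n - 2) ^+ 2)^-1 *
            tachibana g (fun Y1 Y2 Y3 Y4 =>
              (n - 2) / 2 * kulkarni_nomizu S S Y1 Y2 Y3 Y4
              - kappa * kulkarni_nomizu g S Y1 Y2 Y3 Y4
              + kulkarni_nomizu g S2 Y1 Y2 Y3 Y4) X1 X2 X3 X4 X Y].
Proof.
move=> A As Au eps1 xixi ee xie cE n g Rm S S2 kappa C L LC X1 X2 X3 X4 X Y.
have e0 : (4%:R - 1 : R) = 3 by ring.
have e1 : (4%:R - 2 : R) = 2 by ring.
pose s0 := 3 * p + (q - eps * p) * eps + r.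
pose s1 := 2 * (q - eps * p) - eps * r.
pose s2 := 2 * r - eps * r * eps.
have ES : S = tens2 A xi e s0 s1 s2.
  rewrite /S (ricci_tens2 As Au xixi ee xie cE).
  by congr (tens2 _ _ _ _ _ _); rewrite ?e0 ?e1 /s0 /s1 /s2; ring.
have Ek : kappa = 4 * s0 + s1 * eps + s2.
  rewrite /kappa (scalar_curv_tens As Au xixi ee xie cE) e0 e1 /s0 /s1 /s2; ring.
have ES2 : S2 = tens2 A xi e (s0 ^+ 2) (2 * s0 * s1 + eps * s1 ^+ 2) (2 * s0 * s2 + s2
  ^+ 2).
  rewrite /S2 (ricci2_tens2 As Au xixi ee xie cE).
  by congr (tens2 _ _ _ _ _ _); rewrite ?e0 ?e1 /s0 /s1 /s2; ring.
have EC : C = tens4 A xi e (p - s0 + (4 * s0 + s1 * eps + s2) / 6) (q - eps * p - s1 /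
  2) (r - s2 / 2)
     (- eps * r).
  rewrite /C (weyl_tens4 As Au xixi ee xie cE) -/kappa Ek e0 e1.
  by congr (tens4 _ _ _ _ _ _ _); rewrite /s0 /s1 /s2; by field.
rewrite ES ES2 EC Ek /Rm cE; split.
- by have := dot_curv_curv As Au xixi ee xie p q r eps1 X1 X2 X3 X4 X Y.
- by have := dot_weyl_weyl As Au xixi ee xie p q r eps1 X1 X2 X3 X4 X Y.
- by have := dot_weyl_curv As Au xixi ee xie p q r eps1 X1 X2 X3 X4 X Y.
Qed.

(** * Directional derivatives of smooth functions *)

Section NearDifferentiable.
Variables (R : realType) (V W : normedModType R).

Lemma near_eq_differentiable (f g : V -> W) (x : V) :
  {near x, f =1 g} -> differentiable f x -> differentiable g x.
Proof.
move=> fg df.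
have fg0 : \forall y \near (0 : V), f (y + x) = g (y + x).
  have := fg; rewrite /prop_near1 -[nbhs x _]/(\forall z \near x, f z = g z) (near_shift
    0).
  by apply: filterS => y /=; rewrite subr0.
have gE : g \o shift x = cst (g x) + 'd f x +o_ 0 id.
  apply/eqaddoP => eps eps0.
  have /eqaddoP/(_ _ eps0) fE := diff_locally df.
  near=> y; rewrite -(nbhs_singleton fg).
  have -> : (g \o shift x - (cst (f x) + 'd f x)) y
      = (f \o shift x - (cst (f x) + 'd f x)) y.
    by congr (_ + _); apply/esym; near: y.
  by near: y.
have dfc : continuous ('d f x) by exact: diff_continuous.
by apply/diff_locallyP; rewrite (diff_unique dfc gE).
Unshelve. all: by end_near. Qed.

End NearDifferentiable.

Section SameGrowth.
Variables (R : realType) (V V' W : normedModType R).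
Variables (f : V -> W) (g : V' -> W) (x v : V) (y w : V').
Hypothesis fg : forall h, f (h *: v + x) = g (h *: w + y).

Let fgE : (fun h => h^-1 *: ((f \o shift x) (h *: v) - f x))
  = (fun h => h^-1 *: ((g \o shift y) (h *: w) - g y)).
Proof.
apply/funext => h; congr (_ *: (_ - _)); first exact: fg.
by have := fg 0; rewrite !scale0r !add0r.
Qed.

(** Both sides are limits of the same difference quotient. This covers translations, restrictions to
    a line and composition with linear maps without any differentiability assumption. *)
Lemma same_growth_derive : 'D_v f x = 'D_w g y.
Proof. by rewrite /derive fgE. Qed.

Lemma same_growth_derivable : derivable f x v <-> derivable g y w.
Proof. by rewrite /derivable fgE. Qed.

End SameGrowth.

Section Directional.
Variables (R : realType) (n : nat).
Local Notation V := 'rV[R]_n.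

Lemma derive_sum_partial (f : V -> R) (x v : V) : differentiable f x ->
  'D_v f x = \sum_i v 0 i * partial i f x.
Proof.
move=> df; rewrite deriveE // {1}(row_sum_delta v) linear_sum.
by apply: eq_bigr => i _; rewrite linearZ /partial deriveE.
Qed.

Lemma is_derive_line (W : normedModType R) (f : V -> W) (y u : V) (s : R) :
  derivable f (y + s *: u) u ->
  is_derive s 1 (fun t => f (y + t *: u)) ('D_u f (y + s *: u)).
Proof.
have E h : f (y + (h *: 1 + s) *: u) = f (h *: u + (y + s *: u)).
  by rewrite [h *: 1]mulr1 scalerDl addrCA.
move=> df; apply: DeriveDef; last exact: same_growth_derive.
by apply/(same_growth_derivable E).
Qed.

Lemma derive_comp_linear m (W : normedModType R) (f : V -> W)
    (l : {linear 'rV[R]_m -> V}) v x :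
  'D_v (f \o l) x = 'D_(l v) f (l x).
Proof. by apply: same_growth_derive => h /=; rewrite linearD linearZ. Qed.

End Directional.

Section Schwarz.
Variables (R : realType) (n : nat).
Local Notation V := 'rV[R]_n.

Let mvt_line (f : V -> R) (y u : V) (h : R) : 0 <= h ->
  (forall s, 0 <= s <= h -> differentiable f (y + s *: u)) ->
  exists2 s, 0 <= s <= h & f (y + h *: u) - f y = 'D_u f (y + s *: u) * h.
Proof.
move=> h0 df.
have der s : 0 <= s <= h -> is_derive s 1 (fun t => f (y + t *: u)) ('D_u f (y + s *: u)).
  by move=> sh; apply: (@is_derive_line _ _ _ f); apply: diff_derivable; exact: df.
have [||s] := @MVT_segment R (fun t => f (y + t *: u)) (fun s => 'D_u f (y + s *: u)) 0
  h h0.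
- by move=> s; rewrite in_itv /= => /andP[s0 sh]; apply: der; rewrite !ltW.
- apply: derivable_within_continuous => s; rewrite in_itv /= => sh.
  by have := der s sh => -[].
- by rewrite in_itv /= scale0r addr0 subr0; exists s.
Qed.

(* The mean value theorem, applied in both orders to the second difference over
   the parallelogram spanned by h u and h v, yields points near x at which the
   two mixed derivatives agree. *)
Lemma schwarz (U : set V) (f : V -> R) (u v x : V) : open U -> U x ->
  (forall y, U y -> differentiable f y) ->
  (forall y, U y -> differentiable ('D_u f) y) ->
  (forall y, U y -> differentiable ('D_v f) y) ->
  {for x, continuous ('D_u ('D_v f))} ->
  {for x, continuous ('D_v ('D_u f))} ->
  'D_u ('D_v f) x = 'D_v ('D_u f) x.
Proof.
move=> Uo Ux df du dv cuv cvu; apply/eqP; rewrite -subr_eq0 -normr_le0.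
apply/ler_addgt0Pr => e e0; rewrite add0r.
have e2 : 0 < e / 2 by rewrite divr_gt0.
have near_ok : \forall y \near x, [/\ U y,
    `|'D_u ('D_v f) x - 'D_u ('D_v f) y| < e / 2 &
    `|'D_v ('D_u f) x - 'D_v ('D_u f) y| < e / 2].
  have n1 : nbhs x U by exact: open_nbhs_nbhs.
  have /cvgrPdist_lt/(_ _ e2) n2 := cuv.
  have /cvgrPdist_lt/(_ _ e2) n3 := cvu.
  apply: filterS (filterI n1 (filterI n2 n3)) => y [Uy [Ay By]].
  split; [exact: Uy|exact: Ay|exact: By].
have /nbhs_ballP[d /= d0 dP] := near_ok.
(* The summand 1 keeps [c] positive even for u = v = 0; the side h = d / (2 c) then keeps the
   parallelogram inside the ball of radius [d]. *)
pose c := `|u| + `|v| + 1.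
have c0 : 0 < c by rewrite ltr_wpDl // addr_ge0.
pose h := d / 2 / c.
have h0 : 0 < h by rewrite !divr_gt0.
have inb s t : 0 <= s <= h -> 0 <= t <= h -> ball x d (x + s *: u + t *: v).
  move=> /andP[s0 sh] /andP[t0 th]; rewrite -ball_normE /= -addrA opprD addrA subrr
    add0r normrN.
  rewrite (le_lt_trans (ler_normD _ _)) // !normrZ !ger0_norm //.
  apply: (@le_lt_trans _ _ (h * c)).
    rewrite /c !mulrDr mulr1 -addrA lerD ?ler_wpM2r//.
    by rewrite (le_trans (ler_wpM2r _ th)) // lerDl ltW.
  by rewrite /h divfK ?gt_eqF// ltr_pdivrMr// ltr_pMr// ltr1n.
clearbody h.
have hh : 0 <= h <= h by rewrite lexx ltW.
have h00 : 0 <= (0:R) <= h by rewrite lexx ltW.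
have key (a b : V) : (forall s t, 0 <= s <= h -> 0 <= t <= h -> ball x d (x + s *: a + t
  *: b)) ->
   (forall y, U y -> differentiable ('D_a f) y) ->
   exists s t, [/\ 0 <= s <= h, 0 <= t <= h &
     f (x + h *: a + h *: b) - f (x + h *: a) - (f (x + h *: b) - f x)
      = 'D_b ('D_a f) (x + s *: a + t *: b) * h * h].
  move=> inab dab.
  have UU s t : 0 <= s <= h -> 0 <= t <= h -> U (x + s *: a + t *: b).
    by move=> s1 t1; have [] := dP _ (inab s t s1 t1).
  have Ua s : 0 <= s <= h -> U (x + s *: a).
    by move=> s1; have := UU s 0 s1 h00; rewrite scale0r addr0.
  pose k y := f (y + h *: b) - f y.
  have tr y : U (y + h *: b) -> differentiable (fun y => f (y + h *: b)) y.
    move=> Uy; apply: (@differentiable_comp _ _ _ _ (fun y => y + h *: b) f); last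
      exact: df.
    by apply: differentiableD.
  have trD y w : U (y + h *: b) -> 'D_w (fun y => f (y + h *: b)) y = 'D_w f (y + h *: b).
    move=> Uy; by apply: same_growth_derive => z; rewrite addrA.
  have [|s sh ks] := @mvt_line k x a h (ltW h0).
    move=> s sh; apply: differentiableB; [apply: tr|apply: df; exact: Ua].
    exact: UU.
  have [|t th kt] := @mvt_line ('D_a f) (x + s *: a) b h (ltW h0).
    by move=> t th; apply: dab; exact: UU.
  exists s, t; split => //; rewrite -kt -[LHS]/(k (x + h *: a) - k x) ks; congr (_ * _).
  rewrite /k deriveB; first by rewrite trD //; exact: UU.
  - by apply/diff_derivable/tr; exact: UU.
  - by apply/diff_derivable/df; exact: Ua.
have [s1 [t1 [s1h t1h E1]]] := key u v inb du.
have [|s2 [t2 [s2h t2h E2]]] := key v u _ dv.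
  by move=> s t sh th; rewrite addrAC; exact: inb.
have E : 'D_v ('D_u f) (x + s1 *: u + t1 *: v) = 'D_u ('D_v f) (x + s2 *: v + t2 *: u).
  have hn : h * h != 0 by rewrite mulf_neq0 // gt_eqF.
  have cancel2 (a b : R) : a * h * h = b * h * h -> a = b.
    by rewrite -!mulrA => E; exact: (mulIf hn E).
  apply: cancel2; apply: etrans (esym E1) _; apply: etrans E2.
  rewrite [x + h *: v + h *: u]addrAC.
  by move: (f _) (f (x + h *: u)) (f (x + h *: v)) (f x) => a b c' d'; ring.
have [_ _ A1] := dP _ (inb _ _ s1h t1h).
have [_ A2 _] := dP _ (inb _ _ t2h s2h).
rewrite addrAC -E in A2.
move: A1 A2; move: ('D_u ('D_v f) x) ('D_v ('D_u f) x)
  ('D_v ('D_u f) (x + s1 *: u + t1 *: v)) => p q w A1 A2.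
have -> : p - q = (p - w) - (q - w) by ring.
apply: le_trans (ler_normB _ _) _.
rewrite [leRHS]splitr; apply: lerD; apply: ltW; [exact: A2|exact: A1].
Qed.

End Schwarz.

(** * A calculus of directional derivatives, and the class of functions to which it is applied *)

Section HasDerivative.
Variables (R : realType) (V : normedModType R).
Implicit Types (f g : V -> R) (x v : V).

(** Differentiability and value are bundled so that the rules below compose like terms and the
    derivative of a composite expression is read off from its proof. *)
Definition has_derivative f x v (d : R) := differentiable f x /\ 'D_v f x = d.

Lemma has_derivative_self f x v :
  differentiable f x -> has_derivative f x v ('D_v f x).
Proof. by []. Qed.

Lemma has_derivative_eq f x v d d' :
  has_derivative f x v d -> d = d' -> has_derivative f x v d'.
Proof. by move=> ? <-. Qed.

Lemma has_derivative_cst c x v : has_derivative (fun=> c) x v 0.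
Proof. by split; [exact: differentiable_cst|exact: derive_cst]. Qed.

Lemma has_derivativeD f g x v a b :
  has_derivative f x v a -> has_derivative g x v b ->
  has_derivative (fun y => f y + g y) x v (a + b).
Proof.
move=> [df <-] [dg <-]; split; first exact: differentiableD.
by rewrite -deriveD //; exact: diff_derivable.
Qed.

Lemma has_derivativeM f g x v a b :
  has_derivative f x v a -> has_derivative g x v b ->
  has_derivative (fun y => f y * g y) x v (a * g x + f x * b).
Proof.
move=> [df <-] [dg <-]; split; first exact: differentiableM.
rewrite (_ : (fun y => _) = (f * g)%R) //.
rewrite deriveM; [|exact: diff_derivable|exact: diff_derivable].
by rewrite addrC [g x *: _]mulrC.
Qed.

Lemma has_derivativeZ f c x v a :
  has_derivative f x v a -> has_derivative (fun y => c * f y) x v (c * a).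
Proof.
move=> df; apply: has_derivative_eq (has_derivativeM (has_derivative_cst c x v) df) _.
by rewrite mul0r add0r.
Qed.

Lemma has_derivativeN f x v a :
  has_derivative f x v a -> has_derivative (fun y => - f y) x v (- a).
Proof.
move=> [df <-]; split; first exact: differentiableN.
by rewrite -deriveN //; exact: diff_derivable.
Qed.

Lemma has_derivativeB f g x v a b :
  has_derivative f x v a -> has_derivative g x v b ->
  has_derivative (fun y => f y - g y) x v (a - b).
Proof. by move=> df dg; apply: has_derivativeD => //; apply: has_derivativeN. Qed.

Lemma has_derivative_sum I (s : seq I) (F : I -> V -> R) x v (d : I -> R) :
  (forall i, has_derivative (F i) x v (d i)) ->
  has_derivative (fun y => \sum_(i <- s) F i y) x v (\sum_(i <- s) d i).
Proof.
move=> Fd; elim: s => [|i s IH].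
  rewrite big_nil (_ : (fun y => _) = fun=> 0); first exact: has_derivative_cst.
  by apply/funext => y; rewrite big_nil.
rewrite big_cons (_ : (fun y => _) = fun y => F i y + \sum_(i <- s) F i y).
  exact: has_derivativeD.
by apply/funext => y; rewrite big_cons.
Qed.

Lemma has_derivative_comp1 f (h : R -> R) x v a b : has_derivative f x v a ->
  is_derive (f x) 1 h b -> has_derivative (fun y => h (f y)) x v (b * a).
Proof.
move=> [df <-] [dh hb].
have dh' : differentiable h (f x) by exact/derivable1_diffP.
split; first exact: differentiable_comp.
rewrite deriveE; last exact: differentiable_comp.
have E w : 'd h (f x) w = w * b.
  by rewrite -[w in LHS]mulr1 -[w * 1]/(w *: 1) linearZ -deriveE // hb.
rewrite -[fun y => _]/(h \o f) diff_comp // -[LHS]/('d h (f x) ('d f x v)) E.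
by rewrite deriveE // mulrC.
Qed.

Lemma has_derivativeV f x v a : f x != 0 ->
  has_derivative f x v a ->
  has_derivative (fun y => (f y)^-1) x v (- (f x) ^- 2 * a).
Proof.
move=> fx0 [df <-]; split; first exact: differentiableV.
by rewrite deriveV //; exact: diff_derivable.
Qed.

Lemma has_derivative_expR f x v a : has_derivative f x v a ->
  has_derivative (fun y => expR (f y)) x v (expR (f x) * a).
Proof. by move=> df; apply: has_derivative_comp1 df _. Qed.

Lemma has_derivative_ext f g x v a : f =1 g ->
  has_derivative f x v a -> has_derivative g x v a.
Proof. by move/funext => ->. Qed.

Lemma has_derivative_near f g x v a : {near x, f =1 g} ->
  has_derivative f x v a -> has_derivative g x v a.
Proof.
move=> fg [df <-]; split; first exact: near_eq_differentiable df.
by apply/esym; exact: near_eq_derive.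
Qed.

End HasDerivative.

Section SmoothFun.
Variables (R : realType) (n : nat).
Local Notation V := 'rV[R]_n.
Implicit Types (f g : V -> R) (U : set V).

(* Closing smooth_on under the operations below makes stability under
   derivatives an induction; a direct proof that products are smooth_on would
   need the Leibniz rule for iterated partial derivatives. *)
Inductive smooth_fun U : (V -> R) -> Prop :=
| SmoothOn f : smooth_on U f -> smooth_fun U f
| SmoothCst c : smooth_fun U (fun=> c)
| SmoothAdd f g : smooth_fun U f -> smooth_fun U g -> smooth_fun U (fun x => f x + g x)
| SmoothMul f g : smooth_fun U f -> smooth_fun U g -> smooth_fun U (fun x => f x * g x)
| SmoothInv f : smooth_fun U f -> (forall x, U x -> f x != 0) ->
    smooth_fun U (fun x => (f x)^-1)
| SmoothExp f : smooth_fun U f -> smooth_fun U (fun x => expR (f x))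
| SmoothExt f g : smooth_fun U f -> (forall x, U x -> f x = g x) -> smooth_fun U g.

Lemma near_open U x (P : V -> Prop) : open U -> U x -> (forall y, U y -> P y) ->
  \forall y \near x, P y.
Proof. by move=> Uo Ux UP; apply: filterS UP _; apply: open_nbhs_nbhs. Qed.

Lemma smooth_fun_differentiable U f : open U -> smooth_fun U f ->
  forall x, U x -> differentiable f x.
Proof.
move=> Uo; elim => {f}.
- by move=> f sf x Ux; have := sf [::] x Ux.
- by move=> c x _; exact: differentiable_cst.
- by move=> f g _ df _ dg x Ux; apply: differentiableD; [exact: df|exact: dg].
- by move=> f g _ df _ dg x Ux; apply: differentiableM; [exact: df|exact: dg].
- by move=> f _ df f0 x Ux; apply: differentiableV; [exact: df|exact: f0].
- move=> f _ df x Ux.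
  by have [] := has_derivative_expR (has_derivative_self 0 (df x Ux)).
- move=> f g _ df fg x Ux; apply: near_eq_differentiable (df x Ux).
  exact: near_open fg.
Qed.

Lemma smooth_fun_deriv U f v : open U -> smooth_fun U f -> smooth_fun U ('D_v f).
Proof.
move=> Uo; elim => {f}.
- move=> f sf.
  (* [smooth_on] only speaks of coordinate directions; the derivative along [v] is a combination of
     partial derivatives with constant coefficients. *)
  have sp : smooth_fun U (fun x => \sum_i v 0 i * partial i f x).
    elim: (index_enum _) => [|i s IH].
      apply: SmoothExt (SmoothCst _ 0) _ => x _; by rewrite big_nil.
    have : smooth_fun U (fun x => v 0 i * partial i f x + \sum_(j <- s) v 0 j * partial
      j f x).
      apply: SmoothAdd IH; apply: SmoothMul (SmoothCst _ _) _.
      (* The derivative already taken is the innermost one, so its index goes to the end of the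
         list. *)
      apply: SmoothOn => t x Ux; rewrite -foldr_rcons.
      exact: sf.
    by move/SmoothExt; apply => x _; rewrite big_cons.
  apply: SmoothExt sp _ => x Ux; rewrite derive_sum_partial //; exact: (sf [::]).
- move=> c; apply: SmoothExt (SmoothCst _ 0) _ => x _; by rewrite derive_cst.
- move=> f g sf sdf sg sdg; apply: SmoothExt (SmoothAdd sdf sdg) _ => x Ux.
  have dx := smooth_fun_differentiable Uo.
  by have [_ ->] := has_derivativeD (has_derivative_self v (dx _ sf x Ux))
    (has_derivative_self v (dx _ sg x Ux)).
- move=> f g sf sdf sg sdg.
  apply: SmoothExt (SmoothAdd (SmoothMul sdf sg) (SmoothMul sf sdg)) _ => x Ux.
  have dx := smooth_fun_differentiable Uo.
  by have [_ ->] := has_derivativeM (has_derivative_self v (dx _ sf x Ux))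
    (has_derivative_self v (dx _ sg x Ux)).
- move=> f sf sdf f0.
  apply: SmoothExt (SmoothMul (SmoothMul (SmoothCst _ (-1)) (SmoothMul (SmoothInv sf f0)
    (SmoothInv sf f0))) sdf) _ => x Ux.
  have dx := smooth_fun_differentiable Uo.
  have [_ ->] := has_derivativeV (f0 x Ux) (has_derivative_self v (dx _ sf x Ux)).
  by rewrite mulN1r -invfM.
- move=> f sf sdf; apply: SmoothExt (SmoothMul (SmoothExp sf) sdf) _ => x Ux.
  have dx := smooth_fun_differentiable Uo.
  by have [_ ->] := has_derivative_expR (has_derivative_self v (dx _ sf x Ux)).
- move=> f g sf sdf fg; apply: SmoothExt sdf _ => x Ux.
  by apply: near_eq_derive; exact: near_open fg.
Qed.

Lemma smooth_fun_schwarz U f u v x : open U -> smooth_fun U f -> U x ->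
  'D_u ('D_v f) x = 'D_v ('D_u f) x.
Proof.
move=> Uo sf Ux.
have dx := smooth_fun_differentiable Uo.
have sd w h : smooth_fun U h -> smooth_fun U ('D_w h) by exact: smooth_fun_deriv.
apply: (schwarz Uo Ux); first exact: dx.
- by apply: dx; exact: sd.
- by apply: dx; exact: sd.
- by apply: differentiable_continuous; apply: dx => //; apply: (sd); apply: (sd).
- by apply: differentiable_continuous; apply: dx => //; apply: (sd); apply: (sd).
Qed.

Lemma smooth_funN U f : smooth_fun U f -> smooth_fun U (fun x => - f x).
Proof.
by move=> sf; apply: SmoothExt (SmoothMul (SmoothCst _ (-1)) sf) _ => x _; rewrite mulN1r.
Qed.

Lemma smooth_fun_sum U I (s : seq I) (F : I -> V -> R) :
  (forall i, smooth_fun U (F i)) -> smooth_fun U (fun x => \sum_(i <- s) F i x).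
Proof.
move=> sF; elim: s => [|i s IH].
  by apply: SmoothExt (SmoothCst _ 0) _ => x _; rewrite big_nil.
by apply: SmoothExt (SmoothAdd (sF i) IH) _ => x _; rewrite big_cons.
Qed.

Lemma smooth_fun_prod U I (s : seq I) (F : I -> V -> R) :
  (forall i, smooth_fun U (F i)) -> smooth_fun U (fun x => \prod_(i <- s) F i x).
Proof.
move=> sF; elim: s => [|i s IH].
  by apply: SmoothExt (SmoothCst _ 1) _ => x _; rewrite big_nil.
by apply: SmoothExt (SmoothMul (sF i) IH) _ => x _; rewrite big_cons.
Qed.

Lemma smooth_fun_det U m (A : V -> 'M[R]_m) :
  (forall i j, smooth_fun U (fun x => A x i j)) -> smooth_fun U (fun x => \det (A x)).
Proof.
move=> sA; apply: smooth_fun_sum => s; apply: SmoothMul (SmoothCst _ _) _.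
exact: smooth_fun_prod.
Qed.

Lemma smooth_fun_invmx U m (A : V -> 'M[R]_m) i j :
  (forall i j, smooth_fun U (fun x => A x i j)) ->
  (forall x, U x -> A x \in unitmx) -> smooth_fun U (fun x => invmx (A x) i j).
Proof.
move=> sA uA.
have sd : smooth_fun U (fun x => (\det (A x))^-1).
  apply: SmoothInv; first exact: smooth_fun_det.
  by move=> x /uA; rewrite unitmxE unitfE.
have sc : smooth_fun U (fun x => cofactor (A x) j i).
  apply: SmoothMul (SmoothCst _ _) _; apply: smooth_fun_det => k l.
  by apply: SmoothExt (sA (lift j k) (lift i l)) _ => x _; rewrite !mxE.
apply: SmoothExt (SmoothMul sd sc) _ => x Ux.
by rewrite /invmx uA // !mxE.
Qed.

End SmoothFun.

(** * Curvature in terms of Christoffel symbols of the first kind *)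

Section LeviCivita.
Variables (R : realType) (n : nat) (g : 'rV[R]_n -> 'M[R]_n).
Variable U : set 'rV[R]_n.
Local Notation V := 'rV[R]_n.
Hypothesis Uo : open U.
Hypothesis gs : forall i j, smooth_fun U (fun x => g x i j).
Hypothesis gsym : forall x, U x -> (g x)^T = g x.
Hypothesis gu : forall x, U x -> g x \in unitmx.
Implicit Types u v w x y z : V.

(** The Koszul formula for constant fields, whose Lie brackets vanish: the value is g(nabla_u v, w),
    and no inverse of g occurs in it. *)
Definition christoffel1 u v w x : R :=
  2^-1 * ('D_u (fun y => bilform (g y) v w) x + 'D_v (fun y => bilform (g y) u w) x
          - 'D_w (fun y => bilform (g y) u v) x).

Definition christoffel2 u v x : V :=
  \sum_i \sum_j (u 0 i * v 0 j) *: christoffel g i j x.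

Lemma bilform_sum (A : 'M[R]_n) u v :
  bilform A u v = \sum_i u 0 i * \sum_j v 0 j * A i j.
Proof.
rewrite bilform_row; apply: eq_bigr => i _; congr (_ * _).
rewrite /bilform -rowE mxE; apply: eq_bigr => j _.
by rewrite !mxE mulrC.
Qed.

Lemma smooth_fun_bilform u v : smooth_fun U (fun x => bilform (g x) u v).
Proof.
have sf : smooth_fun U (fun x => \sum_i u 0 i * \sum_j v 0 j * g x i j).
  apply: smooth_fun_sum => i; apply: SmoothMul (SmoothCst _ _) _.
  by apply: smooth_fun_sum => j; apply: SmoothMul (SmoothCst _ _) _.
by apply: SmoothExt sf _ => x _; rewrite bilform_sum.
Qed.

Lemma smooth_fun_christoffel1 u v w : smooth_fun U (christoffel1 u v w).
Proof.
apply: SmoothMul (SmoothCst _ _) _; apply: SmoothAdd; last apply: smooth_funN.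
  by apply: SmoothAdd; apply: smooth_fun_deriv => //; apply: smooth_fun_bilform.
by apply: smooth_fun_deriv => //; apply: smooth_fun_bilform.
Qed.

Lemma derive_bilform u v w x : U x ->
  'D_w (fun y => bilform (g y) u v) x
  = \sum_k w 0 k * \sum_i u 0 i * \sum_j v 0 j * partial k (fun y => g y i j) x.
Proof.
move=> Ux; have dg i j k : has_derivative (fun y => g y i j) x k ('D_k (fun y => g y i
  j) x).
  by apply: has_derivative_self; exact: (smooth_fun_differentiable Uo (gs i j) Ux).
have E k : has_derivative (fun y => bilform (g y) u v) x k
    (\sum_i u 0 i * \sum_j v 0 j * 'D_k (fun y => g y i j) x).
  rewrite (_ : (fun y => _) = fun y => \sum_i u 0 i * \sum_j v 0 j * g y i j); last first.
    by apply/funext => y; rewrite bilform_sum.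
  apply: has_derivative_sum => i.
  apply: has_derivative_eq (has_derivativeM (has_derivative_cst _ _ _) _) _.
    apply: has_derivative_sum => j.
    exact: has_derivativeM (has_derivative_cst _ _ _) (dg i j k).
  rewrite mul0r add0r; congr (_ * _); apply: eq_bigr => j _.
  by rewrite mul0r add0r.
rewrite derive_sum_partial; last by case: (E 0).
apply: eq_bigr => k _; congr (_ * _).
by rewrite /partial; case: (E (delta_mx 0 k)).
Qed.

Let c i j l x := partial i (fun y => g y j l) x + partial j (fun y => g y i l) x
     - partial l (fun y => g y i j) x.

Lemma bilform_christoffel i j w x : U x ->
  bilform (g x) (christoffel g i j x) w = \sum_l w 0 l * (2^-1 * c i j l x).
Proof.
move=> Ux; have -> : christoffel g i j x = (\row_l (2^-1 * c i j l x)) *m invmx (g x).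
  have gi : (invmx (g x))^T = invmx (g x) by rewrite trmx_inv gsym.
  apply/rowP => k; rewrite !mxE big_distrr; apply: eq_bigr => l _ /=.
  rewrite mxE -{1}gi mxE /c; ring.
rewrite /bilform mulmxKV ?gu // mxE; apply: eq_bigr => l _.
by rewrite !mxE mulrC.
Qed.

Lemma christoffel2P u v w x : U x ->
  bilform (g x) (christoffel2 u v x) w = christoffel1 u v w x.
Proof.
move=> Ux.
have -> : bilform (g x) (christoffel2 u v x) w
   = \sum_i \sum_j u 0 i * v 0 j * bilform (g x) (christoffel g i j x) w.
  rewrite /christoffel2 /bilform !mulmx_suml summxE; apply: eq_bigr => i _.
  rewrite !mulmx_suml summxE; apply: eq_bigr => j _.
  by rewrite -!scalemxAl mxE.
under eq_bigr do under eq_bigr do rewrite bilform_christoffel //.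
rewrite /christoffel1 !derive_bilform //.
transitivity (2^-1 * \sum_i \sum_j \sum_l u 0 i * v 0 j * w 0 l * c i j l x).
  rewrite mulr_sumr; apply: eq_bigr => i _.
  rewrite mulr_sumr; apply: eq_bigr => j _.
  rewrite !mulr_sumr; apply: eq_bigr => l _; ring.
congr (_ * _).
have -> : \sum_i \sum_j \sum_l u 0 i * v 0 j * w 0 l * c i j l x
  = \sum_i \sum_j \sum_l u 0 i * v 0 j * w 0 l * partial i (fun y => g y j l) x
   + \sum_i \sum_j \sum_l u 0 i * v 0 j * w 0 l * partial j (fun y => g y i l) x
   - \sum_i \sum_j \sum_l u 0 i * v 0 j * w 0 l * partial l (fun y => g y i j) x.
  rewrite -sumrN -!big_split; apply: eq_bigr => i _ /=.
  rewrite -sumrN -!big_split; apply: eq_bigr => j _ /=.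
  rewrite -sumrN -!big_split; apply: eq_bigr => l _ /=.
  rewrite /c; ring.
congr (_ + _ - _).
- apply: eq_bigr => i _; rewrite mulr_sumr; apply: eq_bigr => j _.
  rewrite !mulr_sumr; apply: eq_bigr => l _; ring.
- rewrite exchange_big; apply: eq_bigr => j _; rewrite mulr_sumr; apply: eq_bigr => i _.
  rewrite !mulr_sumr; apply: eq_bigr => l _; ring.
- under eq_bigr do rewrite exchange_big /=.
  rewrite exchange_big; apply: eq_bigr => l _; rewrite mulr_sumr; apply: eq_bigr => i _.
  rewrite !mulr_sumr; apply: eq_bigr => j _; ring.
Qed.

Lemma christoffel2_unique u v y x : U x ->
  (forall w, bilform (g x) y w = christoffel1 u v w x) -> christoffel2 u v x = y.
Proof.
by move=> Ux yE; apply: (bilform_inj (gu Ux)) => w; rewrite christoffel2P.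
Qed.

Lemma smooth_fun_christoffel2 u v k : smooth_fun U (fun x => christoffel2 u v x 0 k).
Proof.
have sc i j : smooth_fun U (fun x => christoffel g i j x 0 k).
  have sp i' f : smooth_fun U f -> smooth_fun U (partial i' f) by exact: smooth_fun_deriv.
  have : smooth_fun U (fun x => 2^-1 * \sum_l invmx (g x) k l * c i j l x).
    apply: SmoothMul (SmoothCst _ _) _; apply: smooth_fun_sum => l.
    apply: SmoothMul; first exact: smooth_fun_invmx.
    apply: SmoothAdd; first by apply: SmoothAdd; apply: sp.
    by apply: smooth_funN; apply: sp.
  by move/SmoothExt; apply => x _; rewrite mxE.
have : smooth_fun U (fun x => \sum_i \sum_j (u 0 i * v 0 j) * christoffel g i j x 0 k).
  apply: smooth_fun_sum => i; apply: smooth_fun_sum => j.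
  exact: SmoothMul (SmoothCst _ _) _.
move/SmoothExt; apply => x _; rewrite summxE; apply: eq_bigr => i _.
by rewrite summxE; apply: eq_bigr => j _; rewrite [RHS]mxE.
Qed.

Lemma nabla_cst u v : nabla g (fun=> u) (fun=> v) = christoffel2 u v.
Proof. by apply/funext => x; rewrite /nabla derive_cst add0r. Qed.

Lemma derivable_christoffel2 u v w x : U x -> derivable (christoffel2 u v) x w.
Proof.
move=> Ux; apply/derivable_mxP => i k; rewrite (ord1 i).
by apply: diff_derivable; apply: (smooth_fun_differentiable Uo (smooth_fun_christoffel2
  u v k)).
Qed.

(* g(nabla_u (nabla_v w), z) = u (g(nabla_v w, z)) - g(nabla_v w, nabla_u z) *)
Lemma bilform_nabla_christoffel2 u v w z x : U x ->
  bilform (g x) (nabla g (fun=> u) (christoffel2 v w) x) z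
  = 'D_u (christoffel1 v w z) x - christoffel1 u z (christoffel2 v w x) x.
Proof.
move=> Ux; set y := christoffel2 v w x.
rewrite /nabla -/(christoffel2 u y x) bilformDl christoffel2P //.
have Dy k : has_derivative (fun p => christoffel2 v w p 0 k) x u
    (('D_u (christoffel2 v w) x) 0 k).
  split; first exact: (smooth_fun_differentiable Uo (smooth_fun_christoffel2 v w k)).
  by rewrite derive_mx ?mxE //; exact: derivable_christoffel2.
have Dg k : has_derivative (fun p => bilform (g p) (delta_mx 0 k) z) x u
    ('D_u (fun p => bilform (g p) (delta_mx 0 k) z) x).
  apply: has_derivative_self.
  exact: (smooth_fun_differentiable Uo (smooth_fun_bilform _ _)).
(* The vector [y], the value of nabla_v w at [x], is frozen in the second summand, where only the
   metric is differentiated. *)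
have D1 : has_derivative (fun p => bilform (g p) (christoffel2 v w p) z) x u
    (bilform (g x) ('D_u (christoffel2 v w) x) z + 'D_u (fun p => bilform (g p) y z) x).
  apply: (@has_derivative_ext _ _
    (fun p => \sum_k christoffel2 v w p 0 k * bilform (g p) (delta_mx 0 k) z)).
    by move=> p; rewrite -bilform_row.
  apply: has_derivative_eq (has_derivative_sum _ (fun k => has_derivativeM (Dy k) (Dg
    k))) _.
  rewrite big_split /= -bilform_row; congr (_ + _).
  have : has_derivative (fun p => bilform (g p) y z) x u
      (\sum_k y 0 k * 'D_u (fun p => bilform (g p) (delta_mx 0 k) z) x).
    apply: (@has_derivative_ext _ _ (fun p => \sum_k y 0 k * bilform (g p) (delta_mx 0
      k) z)).
      by move=> p; rewrite -bilform_row.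
    by apply: has_derivative_sum => k; exact: has_derivativeZ (Dg k).
  by case.
have D2 : 'D_u (christoffel1 v w z) x
    = bilform (g x) ('D_u (christoffel2 v w) x) z + 'D_u (fun p => bilform (g p) y z) x.
  case: D1 => _ <-; apply: near_eq_derive.
  by apply: near_open Uo Ux _ => p Up; rewrite christoffel2P.
have gs2 a b : 'D_u (fun p => bilform (g p) a b) x = 'D_u (fun p => bilform (g p) b a) x.
  by apply: near_eq_derive; apply: near_open Uo Ux _ => p Up; rewrite bilform_sym // gsym.
have gs3 : 'D_y (fun p => bilform (g p) u z) x = 'D_y (fun p => bilform (g p) z u) x.
  by apply: near_eq_derive; apply: near_open Uo Ux _ => p Up; rewrite bilform_sym // gsym.
have gs4 : 'D_z (fun p => bilform (g p) u y) x = 'D_z (fun p => bilform (g p) y u) x.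
  by apply: near_eq_derive; apply: near_open Uo Ux _ => p Up; rewrite bilform_sym // gsym.
rewrite D2 /christoffel1 -[RHS]addrA; congr (_ + _).
rewrite (gs2 z y) gs4.
move: ('D_u _ x) ('D_y _ x) ('D_z _ x) => a b d; by field.
Qed.

(** For constant fields the bracket term vanishes, and metric compatibility moves the outer
    derivative onto g(nabla_v w, z). The resulting formula contains no derivative of the inverse
    metric. *)
Lemma riemann_christoffel u v w z x : U x ->
  riemann g x u v w z
  = 'D_u (christoffel1 v w z) x - christoffel1 u z (christoffel2 v w x) x
    - ('D_v (christoffel1 u w z) x - christoffel1 v z (christoffel2 u w x) x).
Proof.
move=> Ux; rewrite /riemann /metric /curv /curv_field !nabla_cst.
have -> : nabla g (lie_bracket (fun=> u) (fun=> v)) (fun=> w) x = 0.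
  rewrite /nabla /lie_bracket !derive_cst subrr add0r big1 // => i _.
  by rewrite big1 // => j _; rewrite mxE mul0r scale0r.
by rewrite subr0 bilformDl bilformNl !bilform_nabla_christoffel2.
Qed.

End LeviCivita.

(** * Warped products over a one-dimensional base *)

Section Submatrices.
Variables (R : realType) (m n : nat).

Lemma has_derivative_lsubmx (f : 'rV[R]_m -> R) (x v : 'rV[R]_(m + n)) a :
  has_derivative f (lsubmx x) (lsubmx v) a ->
  has_derivative (fun y => f (lsubmx y)) x v a.
Proof.
move=> [df <-]; split; last exact: (derive_comp_linear f lsubmx).
by apply: (@differentiable_comp _ _ _ _ lsubmx f) => //; exact: differentiable_lsubmx.
Qed.

Lemma has_derivative_rsubmx (f : 'rV[R]_n -> R) (x v : 'rV[R]_(m + n)) a :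
  has_derivative f (rsubmx x) (rsubmx v) a ->
  has_derivative (fun y => f (rsubmx y)) x v a.
Proof.
move=> [df <-]; split; last exact: (derive_comp_linear f rsubmx).
by apply: (@differentiable_comp _ _ _ _ rsubmx f) => //; exact: differentiable_rsubmx.
Qed.

(** An iterated partial derivative of a function pulled back along a projection is zero as soon as
    one index belongs to the other factor, and otherwise the pullback of an iterated partial
    derivative. *)
Lemma smooth_on_lsubmx (U : set 'rV[R]_m) (U' : set 'rV[R]_(m + n)) f :
  (forall x, U' x -> U (lsubmx x)) -> smooth_on U f ->
  smooth_on U' (fun x => f (lsubmx x)).
Proof.
move=> UU sf s x Ux.
suff [E|[t E]] : foldr (@partial R (m + n)) (fun x => f (lsubmx x)) s = (fun=> 0) \/
    exists t, foldr (@partial R (m + n)) (fun x => f (lsubmx x)) s =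
      (fun x => foldr (@partial R m) f t (lsubmx x)).
- by rewrite E; exact: differentiable_cst.
- rewrite E; apply: (@differentiable_comp _ _ _ _ lsubmx).
    exact: differentiable_lsubmx.
  by apply: sf; apply: UU.
elim: s => [|i s [E|[t E]]] /=; first by right; exists [::].
  by left; rewrite E; apply/funext => y; exact: derive_cst.
rewrite E; case: (split_ordP i) => j ->.
  right; exists (j :: t); apply/funext => y.
  rewrite /partial (derive_comp_linear _ lsubmx) /=.
  suff -> : lsubmx (delta_mx 0 (lshift n j)) = delta_mx 0 j :> 'rV[R]_m by [].
  by apply/rowP => k; rewrite !mxE eqxx /= eq_lshift.
left; apply/funext => y.
rewrite /partial (derive_comp_linear _ lsubmx) /=.
suff -> : lsubmx (delta_mx 0 (rshift m j)) = 0 :> 'rV[R]_m by exact: derive0.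
by apply/rowP => k; rewrite !mxE eqxx /= eq_lrshift.
Qed.

Lemma smooth_on_rsubmx (U : set 'rV[R]_n) (U' : set 'rV[R]_(m + n)) f :
  (forall x, U' x -> U (rsubmx x)) -> smooth_on U f ->
  smooth_on U' (fun x => f (rsubmx x)).
Proof.
move=> UU sf s x Ux.
suff [E|[t E]] : foldr (@partial R (m + n)) (fun x => f (rsubmx x)) s = (fun=> 0) \/
    exists t, foldr (@partial R (m + n)) (fun x => f (rsubmx x)) s =
      (fun x => foldr (@partial R n) f t (rsubmx x)).
- by rewrite E; exact: differentiable_cst.
- rewrite E; apply: (@differentiable_comp _ _ _ _ rsubmx).
    exact: differentiable_rsubmx.
  by apply: sf; apply: UU.
elim: s => [|i s [E|[t E]]] /=; first by right; exists [::].
  by left; rewrite E; apply/funext => y; exact: derive_cst.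
rewrite E; case: (split_ordP i) => j ->; last first.
  right; exists (j :: t); apply/funext => y.
  rewrite /partial (derive_comp_linear _ rsubmx) /=.
  suff -> : rsubmx (delta_mx 0 (rshift m j)) = delta_mx 0 j :> 'rV[R]_n by [].
  by apply/rowP => k; rewrite !mxE eqxx /= eq_rshift.
left; apply/funext => y.
rewrite /partial (derive_comp_linear _ rsubmx) /=.
suff -> : rsubmx (delta_mx 0 (lshift n j)) = 0 :> 'rV[R]_n by exact: derive0.
by apply/rowP => k; rewrite !mxE eqxx /= eq_rlshift.
Qed.

End Submatrices.

Section WarpedCurvature.
Variables (R : realType) (m : nat).
Variables (a : 'rV[R]_1 -> 'M[R]_1) (f : 'rV[R]_1 -> R) (h : 'rV[R]_m -> 'M[R]_m).
Variables (U1 : set 'rV[R]_1) (U2 : set 'rV[R]_m) (eps : R).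
Hypotheses (U1o : open U1) (U2o : open U2) (eps1 : eps = 1 \/ eps = -1).
Hypothesis aE : forall t, U1 t -> a t 0 0 = eps.
Hypothesis fs : smooth_on U1 f.
Hypothesis f0 : forall t, U1 t -> 0 < f t.
Hypothesis hs : forall i j, smooth_on U2 (fun y => h y i j).
Hypothesis hsym : forall y, U2 y -> (h y)^T = h y.
Hypothesis hu : forall y, U2 y -> h y \in unitmx.

(** By conversion these are the components of a warped product in a product chart, if [f] is the
    warping function read in the chart of the base. *)
Definition warped_metric (x : 'rV[R]_(1 + m)) : 'M[R]_(1 + m) :=
  block_mx (a (lsubmx x)) 0 0 (f (lsubmx x) *: h (rsubmx x)).
Local Notation g := warped_metric.
Definition warped_dom : set 'rV[R]_(1 + m) :=
  [set x | U1 (lsubmx x) /\ U2 (rsubmx x)].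
Local Notation U := warped_dom.

Lemma open_warped_dom : open U.
Proof.
apply: openI; apply: open_comp => // x _.
- exact: continuous_lsubmx.
- exact: continuous_rsubmx.
Qed.

Let Uo := open_warped_dom.

Lemma bilform_block k l (A : 'M[R]_k) (B : 'M[R]_l) u v :
  bilform (block_mx A 0 0 B) u v
  = bilform A (lsubmx u) (lsubmx v) + bilform B (rsubmx u) (rsubmx v).
Proof.
rewrite -{1}(hsubmxK u) -{1}(hsubmxK v) /bilform mul_row_block !mulmx0 addr0 add0r.
by rewrite tr_row_mx mul_row_col mxE.
Qed.

Lemma bilform11 (A : 'M[R]_1) u v : bilform A u v = A 0 0 * (u 0 0 * v 0 0).
Proof. by rewrite /bilform !mxE !big_ord1 !mxE big_ord1 mulrAC mulrC. Qed.

Lemma bilform_warped x u v : U x ->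
  bilform (g x) u v = eps * (u 0 0 * v 0 0)
    + f (lsubmx x) * bilform (h (rsubmx x)) (rsubmx u) (rsubmx v).
Proof.
case=> Ux _; rewrite /g bilform_block bilform11 bilformZm aE //.
by rewrite !mxE; congr (_ * (u _ _ * v _ _) + _); apply: val_inj.
Qed.

Lemma warped_sym x : U x -> (g x)^T = g x.
Proof.
case=> Ux Ux2; rewrite /g tr_block_mx !trmx0 linearZ /= hsym //; congr block_mx.
by apply/matrixP => i j; rewrite mxE !ord1.
Qed.

Let eps0 : eps != 0. Proof. by case: eps1 => ->; rewrite ?oppr_eq0 oner_eq0. Qed.

Lemma warped_unit x : U x -> g x \in unitmx.
Proof.
case=> Ux Ux2; rewrite unitmxE unitfE det_ublock detZ det_mx11 aE //.
rewrite !mulf_neq0 // ?expf_neq0 //; first by rewrite gt_eqF // f0.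
by rewrite -unitfE -unitmxE hu.
Qed.

Lemma smooth_warped i j : smooth_fun U (fun x => g x i j).
Proof.
case: (split_ordP i) => i' ->; case: (split_ordP j) => j' ->.
- apply: SmoothExt (SmoothCst _ eps) _ => x [Ux _].
  by rewrite block_mxEul !ord1 aE.
- by apply: SmoothExt (SmoothCst _ 0) _ => x _; rewrite block_mxEur mxE.
- by apply: SmoothExt (SmoothCst _ 0) _ => x _; rewrite block_mxEdl mxE.
have sl : smooth_fun U (fun x => f (lsubmx x)).
  by apply: SmoothOn; apply: smooth_on_lsubmx fs => x [].
have sr : smooth_fun U (fun x => h (rsubmx x) i' j').
  by apply: SmoothOn; apply: smooth_on_rsubmx (hs i' j') => x [].
by apply: SmoothExt (SmoothMul sl sr) _ => x _; rewrite block_mxEdr mxE.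
Qed.

Let hs' i j : smooth_fun U2 (fun y => h y i j).
Proof. exact/SmoothOn/hs. Qed.

Local Notation one := (delta_mx 0 0 : 'rV[R]_1).
Local Notation f1 := ('D_one f).
Local Notation f2 := ('D_one ('D_one f)).
Local Notation hb y u v := (bilform (h y) (rsubmx u) (rsubmx v)).
Local Notation c1 u v w y := (christoffel1 h (rsubmx u) (rsubmx v) (rsubmx w) y).
Local Notation c2 u v y := (christoffel2 h (rsubmx u) (rsubmx v) y).

Lemma has_derivative_row1 (k : 'rV[R]_1 -> R) (x v : 'rV[R]_(1 + m)) :
  smooth_fun U1 k -> U x ->
  has_derivative (fun y => k (lsubmx y)) x v (v 0 0 * 'D_one k (lsubmx x)).
Proof.
move=> sk [Ux _]; apply: has_derivative_lsubmx.
have dk := smooth_fun_differentiable U1o sk Ux.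
split=> //; rewrite derive_sum_partial // big_ord1 mxE; congr (v _ _ * _).
exact: val_inj.
Qed.

Lemma has_derivative_row2 (k : 'rV[R]_m -> R) (x v : 'rV[R]_(1 + m)) :
  smooth_fun U2 k -> U x ->
  has_derivative (fun y => k (rsubmx y)) x v ('D_(rsubmx v) k (rsubmx x)).
Proof.
move=> sk [_ Ux]; apply: has_derivative_rsubmx; apply: has_derivative_self.
exact: (smooth_fun_differentiable U2o sk Ux).
Qed.

Let sf : smooth_fun U1 f. Proof. exact: SmoothOn. Qed.
Let sf1 : smooth_fun U1 f1. Proof. exact: smooth_fun_deriv. Qed.
Let sb u v : smooth_fun U2 (fun y => bilform (h y) u v).
Proof. exact: smooth_fun_bilform. Qed.
Let sc u v w : smooth_fun U2 (christoffel1 h u v w).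
Proof. exact: smooth_fun_christoffel1. Qed.

Lemma christoffel1_sym12 u v w y : U2 y -> christoffel1 h u v w y = christoffel1 h v u w
  y.
Proof.
move=> Uy; rewrite /christoffel1 (_ : 'D_w (fun z => bilform (h z) v u) y
  = 'D_w (fun z => bilform (h z) u v) y); first by congr (_ * (_ - _)); rewrite addrC.
by apply: near_eq_derive; apply: near_open U2o Uy _ => z Uz; rewrite bilform_sym // hsym.
Qed.

Lemma christoffel1_compat u v w y : U2 y ->
  'D_u (fun z => bilform (h z) v w) y = christoffel1 h u v w y + christoffel1 h u w v y.
Proof.
move=> Uy; rewrite /christoffel1 (_ : 'D_u (fun z => bilform (h z) w v) y
  = 'D_u (fun z => bilform (h z) v w) y).
  move: ('D_u _ y) ('D_v _ y) ('D_w _ y) => p q r; by field.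
by apply: near_eq_derive; apply: near_open U2o Uy _ => z Uz; rewrite bilform_sym // hsym.
Qed.

Lemma derive_warped x u v w : U x ->
  let t := lsubmx x in let y := rsubmx x in
  'D_u (fun z => bilform (g z) v w) x
  = u 0 0 * f1 t * hb y v w + f t * (c1 u v w y + c1 u w v y).
Proof.
move=> Ux t y.
have D := has_derivativeD (has_derivative_cst (eps * (v 0 0 * w 0 0)) x u)
  (has_derivativeM (has_derivative_row1 u sf Ux)
    (has_derivative_row2 u (sb (rsubmx v) (rsubmx w)) Ux)).
transitivity ('D_u (fun z => eps * (v 0 0 * w 0 0) + f (lsubmx z) * hb (rsubmx z) v w) x).
  by apply: near_eq_derive; apply: near_open Uo Ux _ => z Uz; rewrite bilform_warped.
by case: D => _ ->; rewrite add0r christoffel1_compat //; case: Ux.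
Qed.

Lemma christoffel1_warped x u v w : U x ->
  let t := lsubmx x in let y := rsubmx x in
  christoffel1 g u v w x = f t * c1 u v w y
    + 2^-1 * f1 t * (u 0 0 * hb y v w + v 0 0 * hb y u w - w 0 0 * hb y u v).
Proof.
move=> Ux t y; have Uy : U2 y by case: Ux.
rewrite {1}/christoffel1 !derive_warped // -/t -/y.
rewrite (christoffel1_sym12 (rsubmx v) (rsubmx u)) // (christoffel1_sym12 (rsubmx w)
  (rsubmx u)) //.
rewrite (christoffel1_sym12 (rsubmx w) (rsubmx v)) //.
move: (f t) (f1 t) (hb _ _ _) (hb _ _ _) (hb _ _ _) (c1 _ _ _ _) (c1 _ _ _ _) (c1 _ _ _
  _).
by move=> *; field.
Qed.

(** The covariant derivative nabla_u v of constant fields. The base has no Christoffel symbols of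
    its own because its metric component is constant, and the factor [eps] stands for the inverse of
    that component. *)
Definition warped_vec (u v x : 'rV[R]_(1 + m)) : 'rV[R]_(1 + m) :=
  row_mx ((- 2^-1 * eps * f1 (lsubmx x) * hb (rsubmx x) u v)%:M)
    (c2 u v (rsubmx x) + (2^-1 * f1 (lsubmx x) / f (lsubmx x)) *:
       (u 0 0 *: rsubmx v + v 0 0 *: rsubmx u)).

Lemma christoffel2_warped x u v : U x -> christoffel2 g u v x = warped_vec u v x.
Proof.
move=> Ux; apply: (christoffel2_unique Uo smooth_warped warped_sym warped_unit Ux) => w.
have [Ut Uy] := Ux.
have ft0 : f (lsubmx x) != 0 by rewrite gt_eqF // f0.
rewrite bilform_warped // christoffel1_warped // /warped_vec row_mxKr.
have -> : (row_mx (- 2^-1 * eps * f1 (lsubmx x) * hb (rsubmx x) u v)%:M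
    (c2 u v (rsubmx x) + (2^-1 * f1 (lsubmx x) / f (lsubmx x)) *: (u 0 0 *: rsubmx v + v
      0 0 *: rsubmx u)) : 'rV_(1 + m)) 0 0
   = - 2^-1 * eps * f1 (lsubmx x) * hb (rsubmx x) u v.
  by rewrite mxE; case: split_ordP => // j _; rewrite mxE (ord1 j) mulr1n.
rewrite !bilformE (christoffel2P U2o hs' hsym hu) //.
move: (hb _ u v) (hb _ u w) (hb _ v w) (c1 _ _ _ _) (f1 _) (f _) ft0 => *.
case: eps1 => ->; by field.
Qed.

(** The slices over points of the base are totally umbilic, and the Gauss equation turns this into
    the term with eps f'^2 / 4. The coefficient of the mixed planes, f''/2 - f'^2 / (4 f), is s s''
    for s the square root of f. *)
Lemma riemann_warped x u v w z : U x ->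
  let t := lsubmx x in let y := rsubmx x in
  riemann g x u v w z
  = f t * riemann h y (rsubmx u) (rsubmx v) (rsubmx w) (rsubmx z)
    - eps * f1 t ^+ 2 / 4 * (hb y v w * hb y u z - hb y u w * hb y v z)
    - (f2 t / 2 - f1 t ^+ 2 / (4 * f t)) *
      kulkarni_nomizu (fun p q : 'rV[R]_(1 + m) => p 0 0 * q 0 0) (fun p q : 'rV[R]_(1 +
        m) => hb y p q) u v w z.
Proof.
move=> Ux t y; have [Ut Uy] := Ux.
have ft0 : f t != 0 by rewrite gt_eqF // f0.
have dK p q r s : 'D_p (christoffel1 g q r s) x
  = p 0 0 * f1 t * c1 q r s y + f t * 'D_(rsubmx p) (christoffel1 h (rsubmx q) (rsubmx
    r) (rsubmx s)) y
    + (2^-1 * (p 0 0 * f2 t) * (q 0 0 * hb y r s + r 0 0 * hb y q s - s 0 0 * hb y q r)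
       + 2^-1 * f1 t * (q 0 0 * (c1 p r s y + c1 p s r y) + r 0 0 * (c1 p q s y + c1 p s
         q y)
                        - s 0 0 * (c1 p q r y + c1 p r q y))).
  pose K z := f (lsubmx z) * c1 q r s (rsubmx z)
    + 2^-1 * f1 (lsubmx z) * (q 0 0 * hb (rsubmx z) r s + r 0 0 * hb (rsubmx z) q s
                               - s 0 0 * hb (rsubmx z) q r).
  have Db (k : R) (u1 v1 : 'rV[R]_(1 + m)) := has_derivativeZ k
    (has_derivative_row2 p (sb (rsubmx u1) (rsubmx v1)) Ux).
  have := has_derivativeD (has_derivativeM (has_derivative_row1 p sf Ux)
      (has_derivative_row2 p (sc (rsubmx q) (rsubmx r) (rsubmx s)) Ux))
    (has_derivativeM (has_derivativeZ 2^-1 (has_derivative_row1 p sf1 Ux))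
       (has_derivativeB (has_derivativeD (Db (q 0 0) r s) (Db (r 0 0) q s)) (Db (s 0 0)
         q r))).
  case=> _ dKx.
  rewrite (_ : 'D_p (christoffel1 g q r s) x = 'D_p K x); last first.
    by apply: near_eq_derive; apply: near_open Uo Ux _ => z0 Uz; rewrite
      christoffel1_warped.
  rewrite dKx; have cc (i j : 'rV[R]_(1 + m)) := christoffel1_compat (rsubmx p) (rsubmx
    i) (rsubmx j) Uy.
  by rewrite (cc r s) (cc q s) (cc q r).
have lv p q : (warped_vec p q x) 0 0 = - 2^-1 * eps * f1 t * hb y p q.
  by rewrite mxE; case: split_ordP => // j _; rewrite mxE (ord1 j) mulr1n.
have rv p q : rsubmx (warped_vec p q x) = c2 p q y + (2^-1 * f1 t / f t) *:
       (p 0 0 *: rsubmx q + q 0 0 *: rsubmx p) by rewrite row_mxKr.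
rewrite (riemann_christoffel Uo smooth_warped warped_sym warped_unit) //.
rewrite (riemann_christoffel U2o hs' hsym hu) //.
rewrite !dK !christoffel2_warped // !christoffel1_warped // !lv !rv.
(* A Christoffel symbol with a sum as last argument is turned back into a bilinear form in order to
   be expanded. Symbols whose last argument is itself a covariant derivative become h(nabla_u z,
   nabla_v w) and h(nabla_v z, nabla_u w), which are then abstracted as [b1] and [b2]. *)
rewrite -!(christoffel2P U2o hs' hsym hu _ _ (_ + _)) // !bilformE -/t -/y.
rewrite /kulkarni_nomizu.
rewrite -!(christoffel2P U2o hs' hsym hu _ _ (christoffel2 _ _ _ _)) //.
have hS p q := @bilform_sym _ _ (h y) p q (hsym Uy).
rewrite !(hS (rsubmx _) (christoffel2 _ _ _ _)).
move: (bilform (h y) (c2 u z y) (c2 v w y)) (bilform (h y) (c2 v z y) (c2 u w y)) => b1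
  b2.
rewrite !(christoffel2P U2o hs' hsym hu) // !(christoffel1_sym12 (rsubmx v) (rsubmx u) _
  Uy).
rewrite (hS (rsubmx z) (rsubmx w)) (hS (rsubmx z) (rsubmx v)) (hS (rsubmx z) (rsubmx u)).
rewrite (hS (rsubmx v) (rsubmx u)).
move: ('D_(rsubmx u) _ _) ('D_(rsubmx v) _ _) (f t) (f1 t) (f2 t) ft0 => d1 d2 ft ft1
  ft2 ft0.
move: (hb y u v) (hb y u w) (hb y u z) (hb y v w) (hb y v z) (hb y w z).
move: (c1 u v w y) (c1 u v z y) (c1 u w v y) (c1 u w z y) (c1 u z v y) (c1 u z w y).
move: (c1 v w u y) (c1 v w z y) (c1 v z u y) (c1 v z w y).
move: (u 0 0) (v 0 0) (w 0 0) (z 0 0) => *.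
by field.
Qed.

End WarpedCurvature.

(** * Three-dimensional metrics with a coframe of constant structure *)

Section CurvatureTypes.
Variables (R : realType) (n : nat) (h : 'rV[R]_n -> 'M[R]_n).

(* The planes orthogonal to e have sectional curvature alpha, those containing
   e have alpha + beta; equivalently, the Ricci tensor has at most two
   eigenvalues, the one on the orthogonal complement of e being double. *)
Definition axial_curvature (alpha beta : R) (x : 'rV[R]_n) : Prop :=
  exists e : 'rV[R]_n, bilform (h x) e e = 1 /\ forall u v w z, riemann h x u v w z =
  alpha * (bilform (h x) u z * bilform (h x) v w - bilform (h x) u w * bilform (h x) v z)
  + beta * kulkarni_nomizu (bilform (h x))
             (fun p q => bilform (h x) p e * bilform (h x) q e) u v w z.

(* With respect to an orthonormal frame E0, E1, E2 the curvature operator on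
   bivectors is diagonal; - p0 is the sectional curvature of the plane spanned
   by E1 and E2, etc. *)
Definition diagonal_curvature (p0 p1 p2 : R) (x : 'rV[R]_n) : Prop :=
  exists E0 E1 E2 : 'rV[R]_n,
  let t0 u := bilform (h x) u E0 in
  let t1 u := bilform (h x) u E1 in
  let t2 u := bilform (h x) u E2 in
  [/\ [/\ t0 E0 = 1, t1 E1 = 1 & t2 E2 = 1],
      [/\ t1 E0 = 0, t2 E0 = 0 & t2 E1 = 0],
      forall u v, bilform (h x) u v = t0 u * t0 v + t1 u * t1 v + t2 u * t2 v
    & forall u v w z, riemann h x u v w z =
        p0 * (t1 u * t2 v - t2 u * t1 v) * (t1 w * t2 z - t2 w * t1 z)
        + p1 * (t2 u * t0 v - t0 u * t2 v) * (t2 w * t0 z - t0 w * t2 z)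
        + p2 * (t0 u * t1 v - t1 u * t0 v) * (t0 w * t1 z - t1 w * t0 z)].

End CurvatureTypes.

Section Frame.
Variables (R : realType) (h : 'rV[R]_3 -> 'M[R]_3) (U : set 'rV[R]_3).
Local Notation V := 'rV[R]_3.
Variables (t0 t1 t2 : V -> V -> R).
Variables (n00 n01 n02 n10 n11 n12 n20 n21 n22 : R).
Hypothesis Uo : open U.
Hypothesis hs : forall i j, smooth_fun U (fun x => h x i j).
Hypothesis hsym : forall x, U x -> (h x)^T = h x.
Hypothesis hu : forall x, U x -> h x \in unitmx.
Hypotheses (t0s : forall v, smooth_fun U (t0 v)) (t1s : forall v, smooth_fun U (t1 v))
  (t2s : forall v, smooth_fun U (t2 v)).
Hypotheses (t0l : forall v x, U x -> t0 v x = \sum_i v 0 i * t0 (delta_mx 0 i) x)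
  (t1l : forall v x, U x -> t1 v x = \sum_i v 0 i * t1 (delta_mx 0 i) x)
  (t2l : forall v x, U x -> t2 v x = \sum_i v 0 i * t2 (delta_mx 0 i) x).
Hypothesis ht : forall u v x, U x ->
  bilform (h x) u v = t0 u x * t0 v x + t1 u x * t1 v x + t2 u x * t2 v x.

(** Here [t0 v x] is the coframe form theta_0 at x applied to v, and so on, and [w0], [w1], [w2] are
    theta_1 ^ theta_2, theta_2 ^ theta_0, theta_0 ^ theta_1. As u and v are constant fields, the
    left sides of [dt0], [dt1], [dt2] are the values of the exterior derivatives on u, v, so these
    hypotheses are structure equations with constant coefficients. *)
Let w0 u v x := t1 u x * t2 v x - t2 u x * t1 v x.
Let w1 u v x := t2 u x * t0 v x - t0 u x * t2 v x.
Let w2 u v x := t0 u x * t1 v x - t1 u x * t0 v x.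

Hypothesis dt0 : forall u v x, U x ->
  'D_u (t0 v) x - 'D_v (t0 u) x = n00 * w0 u v x + n01 * w1 u v x + n02 * w2 u v x.
Hypothesis dt1 : forall u v x, U x ->
  'D_u (t1 v) x - 'D_v (t1 u) x = n10 * w0 u v x + n11 * w1 u v x + n12 * w2 u v x.
Hypothesis dt2 : forall u v x, U x ->
  'D_u (t2 v) x - 'D_v (t2 u) x = n20 * w0 u v x + n21 * w1 u v x + n22 * w2 u v x.

(** The matrix T of the coframe satisfies T T^T = h, hence is invertible; the dual frame consists of
    the rows of its inverse. *)
Lemma dual_frame x : U x -> exists E0 E1 E2 : V,
  [/\ [/\ t0 E0 x = 1, t1 E0 x = 0 & t2 E0 x = 0],
      [/\ t0 E1 x = 0, t1 E1 x = 1 & t2 E1 x = 0]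
    & [/\ t0 E2 x = 0, t1 E2 x = 0 & t2 E2 x = 1]].
Proof.
move=> Ux.
pose T := \matrix_(i < 3, a < 3)
  [:: t0 (delta_mx 0 i) x; t1 (delta_mx 0 i) x; t2 (delta_mx 0 i) x]`_a.
have TT : T *m T^T = h x.
  apply/matrixP => i j; rewrite !mxE !big_ord_recl big_ord0 !mxE /= addr0.
  transitivity (bilform (h x) (delta_mx 0 i) (delta_mx 0 j)).
    by rewrite ht // addrA.
  by rewrite /bilform trmx_delta -rowE -colE !mxE.
have Tu : T \in unitmx.
  have := hu Ux; rewrite -TT !unitmxE det_mulmx det_tr !unitfE mulf_eq0 negb_or.
  by case/andP.
have c0 v : t0 v x = (v *m T) 0 (@Ordinal 3 0 isT).
  by rewrite t0l // mxE; apply: eq_bigr => i _; rewrite mxE.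
have c1 v : t1 v x = (v *m T) 0 (@Ordinal 3 1 isT).
  by rewrite t1l // mxE; apply: eq_bigr => i _; rewrite mxE.
have c2 v : t2 v x = (v *m T) 0 (@Ordinal 3 2 isT).
  by rewrite t2l // mxE; apply: eq_bigr => i _; rewrite mxE.
exists (delta_mx 0 (@Ordinal 3 0 isT) *m invmx T),
  (delta_mx 0 (@Ordinal 3 1 isT) *m invmx T), (delta_mx 0 (@Ordinal 3 2 isT) *m invmx T).
by rewrite !c0 !c1 !c2 !mulmxKV // !mxE.
Qed.

(* With d theta_a = sum_b N_ab *theta_b, the connection acts on coframe
   components by the cross product with omega = M theta, M = N^T - tr N / 2: the
   torsion vanishes because M a x b + a x M b = (tr M - M^T) (a x b). *)
Let tr := (n00 + n11 + n22) / 2.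
Let o0 u x := (n00 - tr) * t0 u x + n10 * t1 u x + n20 * t2 u x.
Let o1 u x := n01 * t0 u x + (n11 - tr) * t1 u x + n21 * t2 u x.
Let o2 u x := n02 * t0 u x + n12 * t1 u x + (n22 - tr) * t2 u x.
Let b0 u v x := 'D_u (t0 v) x + (o1 u x * t2 v x - o2 u x * t1 v x).
Let b1 u v x := 'D_u (t1 v) x + (o2 u x * t0 v x - o0 u x * t2 v x).
Let b2 u v x := 'D_u (t2 v) x + (o0 u x * t1 v x - o1 u x * t0 v x).

Let d0 u v x : U x -> has_derivative (t0 v) x u ('D_u (t0 v) x).
Proof. by move=> Ux; apply: has_derivative_self; exact: smooth_fun_differentiable (t0s
  v) _ Ux. Qed.
Let d1 u v x : U x -> has_derivative (t1 v) x u ('D_u (t1 v) x).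
Proof. by move=> Ux; apply: has_derivative_self; exact: smooth_fun_differentiable (t1s
  v) _ Ux. Qed.
Let d2 u v x : U x -> has_derivative (t2 v) x u ('D_u (t2 v) x).
Proof. by move=> Ux; apply: has_derivative_self; exact: smooth_fun_differentiable (t2s
  v) _ Ux. Qed.

Let dh u v w x : U x -> 'D_u (fun y => bilform (h y) v w) x
  = 'D_u (t0 v) x * t0 w x + t0 v x * 'D_u (t0 w) x
    + ('D_u (t1 v) x * t1 w x + t1 v x * 'D_u (t1 w) x)
    + ('D_u (t2 v) x * t2 w x + t2 v x * 'D_u (t2 w) x).
Proof.
move=> Ux.
have [_ <-] := has_derivativeD (has_derivativeD
  (has_derivativeM (d0 u v Ux) (d0 u w Ux)) (has_derivativeM (d1 u v Ux) (d1 u w Ux)))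
  (has_derivativeM (d2 u v Ux) (d2 u w Ux)).
by apply: near_eq_derive; apply: near_open Uo Ux _ => y Uy; rewrite ht.
Qed.

Let sol_dt (a b c : R) : a - b = c -> b = a - c.
Proof. by move=> <-; rewrite opprB addrC subrK. Qed.

Lemma christoffel1_frame u v w x : U x ->
  christoffel1 h u v w x = b0 u v x * t0 w x + b1 u v x * t1 w x + b2 u v x * t2 w x.
Proof.
move=> Ux; rewrite /christoffel1 !dh //.
(* The structure equations express each derivative of a coframe form by the one with its two
   arguments exchanged. What is left are independent variables, and the identity becomes
   polynomial. *)
rewrite (sol_dt (dt0 u v Ux)) (sol_dt (dt0 u w Ux)) (sol_dt (dt0 v w Ux)).
rewrite (sol_dt (dt1 u v Ux)) (sol_dt (dt1 u w Ux)) (sol_dt (dt1 v w Ux)).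
rewrite (sol_dt (dt2 u v Ux)) (sol_dt (dt2 u w Ux)) (sol_dt (dt2 v w Ux)).
rewrite /b0 /b1 /b2 /o0 /o1 /o2 /w0 /w1 /w2 /tr.
move: ('D_u (t0 v) x) ('D_u (t1 v) x) ('D_u (t2 v) x) => a0 a1 a2.
move: ('D_u (t0 w) x) ('D_u (t1 w) x) ('D_u (t2 w) x) => e0 e1 e2.
move: ('D_v (t0 w) x) ('D_v (t1 w) x) ('D_v (t2 w) x) => f0 f1 f2.
move: (t0 u x) (t1 u x) (t2 u x) (t0 v x) (t1 v x) (t2 v x) (t0 w x) (t1 w x) (t2 w x)
  => *.
by field.
Qed.

Lemma frame_christoffel2 u v x : U x ->
  [/\ t0 (christoffel2 h u v x) x = b0 u v x, t1 (christoffel2 h u v x) x = b1 u v x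
    & t2 (christoffel2 h u v x) x = b2 u v x].
Proof.
move=> Ux; have [E0 [E1 [E2 [[a0 a1 a2] [e0 e1 e2] [f0 f1 f2]]]]] := dual_frame Ux.
have E w : bilform (h x) (christoffel2 h u v x) w = christoffel1 h u v w x.
  by rewrite (christoffel2P Uo hs hsym hu).
split.
- have := E E0; rewrite ht // christoffel1_frame // a0 a1 a2; by rewrite !mulr0 !addr0
  !mulr1.
- have := E E1; rewrite ht // christoffel1_frame // e0 e1 e2; by rewrite !mulr0 !addr0
  !add0r !mulr1.
- have := E E2; rewrite ht // christoffel1_frame // f0 f1 f2; by rewrite !mulr0 !add0r
  !mulr1.
Qed.

Let m00 := n00 - tr.
Let m11 := n11 - tr.
Let m22 := n22 - tr.
(* The matrix P = M N + cof M gives the curvature form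
   d omega + omega x omega = P *theta. *)
Definition frame_P00 := m00 * n00 + n10 * n10 + n20 * n20 + (m11 * m22 - n21 * n12).
Definition frame_P01 := m00 * n01 + n10 * n11 + n20 * n21 - (n01 * m22 - n21 * n02).
Definition frame_P02 := m00 * n02 + n10 * n12 + n20 * n22 + (n01 * n12 - m11 * n02).
Definition frame_P10 := n01 * n00 + m11 * n10 + n21 * n20 - (n10 * m22 - n20 * n12).
Definition frame_P11 := n01 * n01 + m11 * n11 + n21 * n21 + (m00 * m22 - n20 * n02).
Definition frame_P12 := n01 * n02 + m11 * n12 + n21 * n22 - (m00 * n12 - n10 * n02).
Definition frame_P20 := n02 * n00 + n12 * n10 + m22 * n20 + (n10 * n21 - n20 * m11).
Definition frame_P21 := n02 * n01 + n12 * n11 + m22 * n21 - (m00 * n21 - n20 * n01).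
Definition frame_P22 := n02 * n02 + n12 * n12 + m22 * n22 + (m00 * m11 - n10 * n01).

Lemma riemann_frame u v w z x : U x ->
  riemann h x u v w z
  = (frame_P00 * w0 u v x + frame_P01 * w1 u v x + frame_P02 * w2 u v x) * w0 w z x
  + (frame_P10 * w0 u v x + frame_P11 * w1 u v x + frame_P12 * w2 u v x) * w1 w z x
  + (frame_P20 * w0 u v x + frame_P21 * w1 u v x + frame_P22 * w2 u v x) * w2 w z x.
Proof.
move=> Ux; rewrite (riemann_christoffel Uo hs hsym hu) //.
rewrite !(christoffel1_frame _ _ (christoffel2 _ _ _ _)) //.
have [-> -> ->] := frame_christoffel2 v w Ux; have [-> -> ->] := frame_christoffel2 u w
  Ux.
have dd0 p q r : has_derivative ('D_p (t0 q)) x r ('D_r ('D_p (t0 q)) x).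
  by apply: has_derivative_self; exact: smooth_fun_differentiable (smooth_fun_deriv p Uo
    (t0s q)) _ Ux.
have dd1 p q r : has_derivative ('D_p (t1 q)) x r ('D_r ('D_p (t1 q)) x).
  by apply: has_derivative_self; exact: smooth_fun_differentiable (smooth_fun_deriv p Uo
    (t1s q)) _ Ux.
have dd2 p q r : has_derivative ('D_p (t2 q)) x r ('D_r ('D_p (t2 q)) x).
  by apply: has_derivative_self; exact: smooth_fun_differentiable (smooth_fun_deriv p Uo
    (t2s q)) _ Ux.
have dc (a b c : R) p r : has_derivative (fun y => a * t0 p y + b * t1 p y + c * t2 p y)
  x r
    (a * 'D_r (t0 p) x + b * 'D_r (t1 p) x + c * 'D_r (t2 p) x).
  apply: has_derivative_eq (has_derivativeD (has_derivativeD
    (has_derivativeM (has_derivative_cst a x r) (d0 r p Ux))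
    (has_derivativeM (has_derivative_cst b x r) (d1 r p Ux)))
    (has_derivativeM (has_derivative_cst c x r) (d2 r p Ux))) _.
  by rewrite !mul0r !add0r.
pose oo0 r p := (n00 - tr) * 'D_r (t0 p) x + n10 * 'D_r (t1 p) x + n20 * 'D_r (t2 p) x.
pose oo1 r p := n01 * 'D_r (t0 p) x + (n11 - tr) * 'D_r (t1 p) x + n21 * 'D_r (t2 p) x.
pose oo2 r p := n02 * 'D_r (t0 p) x + n12 * 'D_r (t1 p) x + (n22 - tr) * 'D_r (t2 p) x.
have do0 p r : has_derivative (o0 p) x r (oo0 r p) by exact: dc.
have do1 p r : has_derivative (o1 p) x r (oo1 r p) by exact: dc.
have do2 p r : has_derivative (o2 p) x r (oo2 r p) by exact: dc.
pose e0 r p q := 'D_r ('D_p (t0 q)) x + (oo1 r p * t2 q x + o1 p x * 'D_r (t2 q) x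
   - (oo2 r p * t1 q x + o2 p x * 'D_r (t1 q) x)).
pose e1 r p q := 'D_r ('D_p (t1 q)) x + (oo2 r p * t0 q x + o2 p x * 'D_r (t0 q) x
   - (oo0 r p * t2 q x + o0 p x * 'D_r (t2 q) x)).
pose e2 r p q := 'D_r ('D_p (t2 q)) x + (oo0 r p * t1 q x + o0 p x * 'D_r (t1 q) x
   - (oo1 r p * t0 q x + o1 p x * 'D_r (t0 q) x)).
have de0 p q r : has_derivative (b0 p q) x r (e0 r p q).
  exact: has_derivativeD (dd0 p q r) (has_derivativeB
    (has_derivativeM (do1 p r) (d2 r q Ux)) (has_derivativeM (do2 p r) (d1 r q Ux))).
have de1 p q r : has_derivative (b1 p q) x r (e1 r p q).
  exact: has_derivativeD (dd1 p q r) (has_derivativeB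
    (has_derivativeM (do2 p r) (d0 r q Ux)) (has_derivativeM (do0 p r) (d2 r q Ux))).
have de2 p q r : has_derivative (b2 p q) x r (e2 r p q).
  exact: has_derivativeD (dd2 p q r) (has_derivativeB
    (has_derivativeM (do0 p r) (d1 r q Ux)) (has_derivativeM (do1 p r) (d0 r q Ux))).
have dk p q r s : 'D_r (christoffel1 h p q s) x
   = e0 r p q * t0 s x + b0 p q x * 'D_r (t0 s) x
     + (e1 r p q * t1 s x + b1 p q x * 'D_r (t1 s) x)
     + (e2 r p q * t2 s x + b2 p q x * 'D_r (t2 s) x).
  have [_ <-] := has_derivativeD (has_derivativeD
    (has_derivativeM (de0 p q r) (d0 r s Ux)) (has_derivativeM (de1 p q r) (d1 r s Ux)))
    (has_derivativeM (de2 p q r) (d2 r s Ux)).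
  by apply: near_eq_derive; apply: near_open Uo Ux _ => y Uy; rewrite christoffel1_frame.
rewrite !dk /e0 /e1 /e2 /oo0 /oo1 /oo2.
(* The second derivatives of the coframe cancel once their order is exchanged; after the structure
   equations for u and v, the derivatives that remain cancel as well, since the curvature is a
   tensor. *)
rewrite (smooth_fun_schwarz v u Uo (t0s w) Ux) (smooth_fun_schwarz v u Uo (t1s w) Ux)
  (smooth_fun_schwarz v u Uo (t2s w) Ux).
rewrite /b0 /b1 /b2.
rewrite (sol_dt (dt0 u v Ux)) (sol_dt (dt1 u v Ux)) (sol_dt (dt2 u v Ux)).
rewrite /frame_P00 /frame_P01 /frame_P02 /frame_P10 /frame_P11 /frame_P12.
rewrite /frame_P20 /frame_P21 /frame_P22 /m00 /m11 /m22 /o0 /o1 /o2 /w0 /w1 /w2 /tr.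
move: ('D_u ('D_v (t0 w)) x) ('D_u ('D_v (t1 w)) x) ('D_u ('D_v (t2 w)) x) => *.
move: ('D_u (t0 v) x) ('D_u (t1 v) x) ('D_u (t2 v) x) => *.
move: ('D_u (t0 w) x) ('D_u (t1 w) x) ('D_u (t2 w) x) => *.
move: ('D_v (t0 w) x) ('D_v (t1 w) x) ('D_v (t2 w) x) => *.
move: ('D_u (t0 z) x) ('D_u (t1 z) x) ('D_u (t2 z) x) => *.
move: ('D_v (t0 z) x) ('D_v (t1 z) x) ('D_v (t2 z) x) => *.
move: (t0 u x) (t1 u x) (t2 u x) (t0 v x) (t1 v x) (t2 v x) (t0 w x) (t1 w x) (t2 w x)
  => *.
move: (t0 z x) (t1 z x) (t2 z x) => *.
by field.
Qed.

Lemma frame_diagonal_curvature p0 p1 p2 x : U x ->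
  [/\ frame_P00 = p0, frame_P11 = p1 & frame_P22 = p2] ->
  [/\ frame_P01 = 0, frame_P02 = 0 & frame_P12 = 0] ->
  [/\ frame_P10 = 0, frame_P20 = 0 & frame_P21 = 0] ->
  diagonal_curvature h p0 p1 p2 x.
Proof.
move=> Ux [P00 P11 P22] [P01 P02 P12] [P10 P20 P21].
have [E0 [E1 [E2 [[a0 a1 a2] [e0 e1 e2] [f0 f1 f2]]]]] := dual_frame Ux.
have h0 u : bilform (h x) u E0 = t0 u x.
  by rewrite ht // a0 a1 a2 mulr1 !mulr0 !addr0.
have h1 u : bilform (h x) u E1 = t1 u x.
  by rewrite ht // e0 e1 e2 mulr1 !mulr0 addr0 add0r.
have h2 u : bilform (h x) u E2 = t2 u x.
  by rewrite ht // f0 f1 f2 mulr1 !mulr0 !add0r.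
exists E0, E1, E2; split; rewrite ?h0 ?h1 ?h2 //.
  by move=> u v; rewrite !h0 !h1 !h2 ht.
move=> u v w z; rewrite riemann_frame // !(h0, h1, h2).
rewrite P00 P01 P02 P10 P11 P12 P20 P21 P22 /w0 /w1 /w2; ring.
Qed.

End Frame.

(** The axis is the frame vector common to the two planes of equal curvature, and alpha is the
    curvature of the third plane. Both constants are fixed before the metric and the point, so they
    serve for all charts at once. *)
Lemma axial_of_diagonal (R : realType) (p0 p1 p2 : R) :
  p0 = p1 \/ p1 = p2 \/ p2 = p0 ->
  exists alpha beta, forall (h : 'rV[R]_3 -> 'M[R]_3) x, (h x)^T = h x ->
    diagonal_curvature h p0 p1 p2 x -> axial_curvature h alpha beta x.
Proof.
case=> [->|[->|->]]; [exists (- p2), (p2 - p1)|exists (- p0), (p0 - p2)|exists (- p1),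
  (p1 - p0)];
  move=> h x hs [E0 [E1 [E2 [[e0 e1 e2] _ hE cE]]]]; [exists E2|exists E0|exists E1];
  split=> // u v w z; rewrite cE /kulkarni_nomizu (hE u z) (hE v w) (hE u w) (hE v z);
    ring.
Qed.

(** * Ricci eigenvalues of a diagonal curvature operator *)

Section DiagonalRicci.
Variables (R : realType) (h : 'rV[R]_3 -> 'M[R]_3) (x : 'rV[R]_3) (p0 p1 p2 : R).
Hypotheses (hs : (h x)^T = h x) (hu : h x \in unitmx).

Lemma ricci_eigenvalue (E : 'rV[R]_3) (r : R) :
  (forall c u v w, ricci h x (c *: u + v) w = c * ricci h x u w + ricci h x v w) ->
  (forall c u v w, ricci h x w (c *: u + v) = c * ricci h x w u + ricci h x w v) ->
  bilform (h x) E E = 1 ->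
  (forall w, ricci h x E w = r * bilform (h x) E w) ->
  eigenvalue (ricci_op h x) r.
Proof.
move=> rl rr EE rE; apply/eigenvalueP; exists E; last first.
  apply: contra_eq_neq EE => ->; by rewrite bilform0l eq_sym oner_neq0.
apply: (bilform_inj hu) => w; rewrite bilformZl -rE.
rewrite /ricci_op mulmxA {1}/bilform mulmxKV // -/(bilform _ E w).
exact: bilform_matrix.
Qed.

Lemma diagonal_ricci_eigenvalues : diagonal_curvature h p0 p1 p2 x ->
  [/\ eigenvalue (ricci_op h x) (- (p1 + p2)), eigenvalue (ricci_op h x) (- (p2 + p0))
    & eigenvalue (ricci_op h x) (- (p0 + p1))].
Proof.
move=> [E0 [E1 [E2 [[e0 e1 e2] [e01 e02 e12] hE cE]]]].
pose t0 u := bilform (h x) u E0; pose t1 u := bilform (h x) u E1.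
pose t2 u := bilform (h x) u E2.
have hS p q := @bilform_sym _ _ (h x) p q hs.
have e10 : bilform (h x) E1 E0 = 0 by rewrite hS.
have e20 : bilform (h x) E2 E0 = 0 by rewrite hS.
have e21 : bilform (h x) E2 E1 = 0 by rewrite hS.
have ricE u v : ricci h x u v = - (p1 + p2) * (t0 u * t0 v) - (p2 + p0) * (t1 u * t1 v)
    - (p0 + p1) * (t2 u * t2 v).
  rewrite /ricci.
  (* The term with p_a in R(Z, u)v is the rank-one map Z -> g(Z, F_a) G_a, where F_a and G_a are, up
     to sign and the factor p_a, the cross products of E_a with u and v. Its trace is g(G_a,
     F_a). *)
  pose F0 := t2 u *: E1 - t1 u *: E2; pose F1 := t0 u *: E2 - t2 u *: E0.
  pose F2 := t1 u *: E0 - t0 u *: E1.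
  pose G0 := p0 *: (t1 v *: E2 - t2 v *: E1); pose G1 := p1 *: (t2 v *: E0 - t0 v *: E2).
  pose G2 := p2 *: (t0 v *: E1 - t1 v *: E0).
  have -> : (fun Z => curv h x Z u v) = (fun Z => bilform (h x) Z F0 *: G0
     + bilform (h x) Z F1 *: G1 + bilform (h x) Z F2 *: G2).
    apply/funext => Z; apply: (bilform_inj hu) => w.
    transitivity (riemann h x Z u v w); first by [].
    rewrite cE /F0 /F1 /F2 /G0 /G1 /G2 !bilformE /t0 /t1 /t2.
    by rewrite (hS E0 w) (hS E1 w) (hS E2 w); ring.
  rewrite !mxtrace_lin1D !tr_lin1_bilform /F0 /F1 /F2 /G0 /G1 /G2 !bilformE.
  rewrite !(e0, e1, e2, e01, e02, e12, e10, e20, e21); ring.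
have rl c u v w : ricci h x (c *: u + v) w = c * ricci h x u w + ricci h x v w.
  rewrite !ricE /t0 /t1 /t2 !bilformE; ring.
have rr c u v w : ricci h x w (c *: u + v) = c * ricci h x w u + ricci h x w v.
  rewrite !ricE /t0 /t1 /t2 !bilformE; ring.
split.
- apply: (ricci_eigenvalue rl rr e0) => w.
  rewrite ricE (hE E0 w) /t0 /t1 /t2 e0 e01 e02; ring.
- apply: (ricci_eigenvalue rl rr e1) => w.
  rewrite ricE (hE E1 w) /t0 /t1 /t2 e1 e10 e12; ring.
- apply: (ricci_eigenvalue rl rr e2) => w.
  rewrite ricE (hE E2 w) /t0 /t1 /t2 e2 e20 e21; ring.
Qed.

End DiagonalRicci.

(** * The model geometries *)

Section RowValued.
Variables (R : realType) (n m : nat) (phi : 'rV[R]_n -> 'rV[R]_m) (x : 'rV[R]_n).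
Hypothesis dphi : forall k, differentiable (fun y => phi y 0 k) x.

Lemma differentiable_row : differentiable phi x.
Proof.
rewrite (_ : phi = \sum_(k < m) (fun y => phi y 0 k *: (delta_mx 0 k : 'rV[R]_m))).
  by apply: differentiable_sum => k; apply: differentiableZl.
by apply/funext => y; rewrite fct_sumE -row_sum_delta.
Qed.

Lemma derive_row u k : ('D_u phi x) 0 k = 'D_u (fun y => phi y 0 k) x.
Proof. by rewrite derive_mx ?mxE //; exact/diff_derivable/differentiable_row. Qed.

Lemma bilform_jacobian (H : 'M[R]_m) u v :
  bilform (jacobian phi x *m H *m (jacobian phi x)^T) u v
  = bilform H ('D_u phi x) ('D_v phi x).
Proof.
rewrite !(deriveEjacobian _ differentiable_row) /bilform trmx_mul.
by rewrite !mulmxA.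
Qed.

End RowValued.

Section LinForm.
Variables (R : realType) (n : nat).
Local Notation V := 'rV[R]_n.

Definition lin_form (T : V -> R) := forall v, T v = \sum_i v 0 i * T (delta_mx 0 i).

Lemma lin_formD S T : lin_form S -> lin_form T -> lin_form (fun v => S v + T v).
Proof.
move=> lS lT v; rewrite lS lT -big_split; apply: eq_bigr => i _.
by rewrite mulrDr.
Qed.

Lemma lin_formZ c T : lin_form T -> lin_form (fun v => c * T v).
Proof.
move=> lT v; rewrite lT mulr_sumr; apply: eq_bigr => i _; exact: mulrCA.
Qed.

Lemma lin_formN T : lin_form T -> lin_form (fun v => - T v).
Proof.
by move=> lT v; rewrite lT -sumrN; apply: eq_bigr => i _; rewrite mulrN.
Qed.

Lemma lin_form_derive (f : V -> R) x : differentiable f x -> lin_form (fun v => 'D_v f x).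
Proof. by move=> df v; rewrite derive_sum_partial. Qed.

End LinForm.

Section ConcreteRows.
Variable R : realType.

Lemma dotv_row4 (a b c d : R) (p : 'rV[R]_4) :
  dotv (row_of_seq 4 [:: a; b; c; d]) p = a * co p 0 + b * co p 1 + c * co p 2 + d * co
    p 3.
Proof.
rewrite /dotv mxE !big_ord_recl big_ord0 !mxE /= addr0 !addrA /co.
by congr (_ * p _ _ + _ * p _ _ + _ * p _ _ + _ * p _ _);
  apply: val_inj; rewrite /= inordK.
Qed.

Lemma dotv4 (p q : 'rV[R]_4) :
  dotv p q = co p 0 * co q 0 + co p 1 * co q 1 + co p 2 * co q 2 + co p 3 * co q 3.
Proof.
rewrite -dotv_row4; congr (dotv _ _); apply/rowP => k; rewrite mxE /co.
case: k => [[|[|[|[|k]]]] hk] //=; congr (p _ _); apply: val_inj; by rewrite /= inordK.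
Qed.

Lemma bilform_sq_form n (th : 'rV[R]_n) p q :
  bilform (sq_form th) p q = dotv th p * dotv th q.
Proof.
have dotC : dotv th p = (p *m th^T) 0 0.
  by rewrite /dotv -[in RHS](trmxK p) -trmx_mul [RHS]mxE.
by rewrite /bilform /sq_form -!mulmxA mulmxA mxE big_ord1 dotC /dotv.
Qed.

End ConcreteRows.

(* For c = q s and d = q t with a unit quaternion q and imaginary s, t, this is
   the structure equation Im(conj c d - conj d c) = - [s, t] of SU(2). *)
Lemma quaternion_coframe (R : realType) (q0 q1 q2 q3 c0 c1 c2 c3 d0 d1 d2 d3 : R) :
  q0 * q0 + q1 * q1 + q2 * q2 + q3 * q3 = 1 ->
  q0 * c0 + q1 * c1 + q2 * c2 + q3 * c3 = 0 ->
  q0 * d0 + q1 * d1 + q2 * d2 + q3 * d3 = 0 ->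
  let s0 := - q1 * c0 + q0 * c1 + q3 * c2 - q2 * c3 in
  let s1 := - q2 * c0 - q3 * c1 + q0 * c2 + q1 * c3 in
  let s2 := - q3 * c0 + q2 * c1 - q1 * c2 + q0 * c3 in
  let t0 := - q1 * d0 + q0 * d1 + q3 * d2 - q2 * d3 in
  let t1 := - q2 * d0 - q3 * d1 + q0 * d2 + q1 * d3 in
  let t2 := - q3 * d0 + q2 * d1 - q1 * d2 + q0 * d3 in
  [/\ c0 * d1 - c1 * d0 + (c3 * d2 - c2 * d3) = - (s1 * t2 - s2 * t1),
      c0 * d2 - c2 * d0 + (c1 * d3 - c3 * d1) = - (s2 * t0 - s0 * t2)
    & c0 * d3 - c3 * d0 + (c2 * d1 - c1 * d2) = - (s0 * t1 - s1 * t0)].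
Proof.
move=> q1E cE dE s0 s1 s2 t0 t1 t2.
(* As q is a unit quaternion, c = q s with s = conj(q) c, whose real part vanishes by hypothesis.
   [step] inserts the squared norm of q and subtracts a multiple of that real part, so that each
   component of c = q s is left to [ring]. *)
have step (a : R) (e0 e1 e2 e3 k : R) : q0 * e0 + q1 * e1 + q2 * e2 + q3 * e3 = 0 ->
    a * (q0 * q0 + q1 * q1 + q2 * q2 + q3 * q3) - k * (q0 * e0 + q1 * e1 + q2 * e2 + q3
      * e3) = a.
  by move=> ->; rewrite q1E mulr1 mulr0 subr0.
have Ec0 : c0 = - q1 * s0 - q2 * s1 - q3 * s2 by rewrite -[LHS](step _ _ _ _ _ q0 cE);
  rewrite /s0 /s1 /s2; ring.
have Ec1 : c1 = q0 * s0 + q2 * s2 - q3 * s1 by rewrite -[LHS](step _ _ _ _ _ q1 cE);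
  rewrite /s0 /s1 /s2; ring.
have Ec2 : c2 = q0 * s1 + q3 * s0 - q1 * s2 by rewrite -[LHS](step _ _ _ _ _ q2 cE);
  rewrite /s0 /s1 /s2; ring.
have Ec3 : c3 = q0 * s2 + q1 * s1 - q2 * s0 by rewrite -[LHS](step _ _ _ _ _ q3 cE);
  rewrite /s0 /s1 /s2; ring.
have Ed0 : d0 = - q1 * t0 - q2 * t1 - q3 * t2 by rewrite -[LHS](step _ _ _ _ _ q0 dE);
  rewrite /t0 /t1 /t2; ring.
have Ed1 : d1 = q0 * t0 + q2 * t2 - q3 * t1 by rewrite -[LHS](step _ _ _ _ _ q1 dE);
  rewrite /t0 /t1 /t2; ring.
have Ed2 : d2 = q0 * t1 + q3 * t0 - q1 * t2 by rewrite -[LHS](step _ _ _ _ _ q2 dE);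
  rewrite /t0 /t1 /t2; ring.
have Ed3 : d3 = q0 * t2 + q1 * t1 - q2 * t0 by rewrite -[LHS](step _ _ _ _ _ q3 dE);
  rewrite /t0 /t1 /t2; ring.
clearbody s0 s1 s2 t0 t1 t2; rewrite Ec0 Ec1 Ec2 Ec3 Ed0 Ed1 Ed2 Ed3.
split.
(* The left side is now quadratic in q, so the right side is multiplied by the squared norm of q. *)
- rewrite -[RHS]mulr1 -q1E; ring.
- rewrite -[RHS]mulr1 -q1E; ring.
- rewrite -[RHS]mulr1 -q1E; ring.
Qed.

(** * Coordinates and coframes of the models pulled back to a chart *)

Section Pullback.
Variables (R : realType) (m : nat) (phi : 'rV[R]_3 -> 'rV[R]_m.+1).
Variables (h : 'rV[R]_3 -> 'M[R]_3) (U : set 'rV[R]_3) (H : 'rV[R]_m.+1 -> 'M[R]_m.+1).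
Local Notation V := 'rV[R]_3.
Hypothesis Uo : open U.
Hypothesis phis : smooth_map_on U phi.
Hypothesis hE : forall x, U x ->
  h x = jacobian phi x *m H (phi x) *m (jacobian phi x)^T.

Definition component (k : nat) (x : V) : R := co (phi x) k.

Lemma smooth_coord k : smooth_fun U (component k).
Proof. exact/SmoothOn/phis. Qed.

Lemma smooth_deriv_coord v k : smooth_fun U ('D_v (component k)).
Proof. exact/smooth_fun_deriv/smooth_coord. Qed.

Lemma bilform_pullback u v x : U x ->
  bilform (h x) u v = bilform (H (phi x)) ('D_u phi x) ('D_v phi x).
Proof. by move=> Ux; rewrite hE // bilform_jacobian // => k; exact: (phis k [::]). Qed.

Lemma co_deriv u k x : U x -> co ('D_u phi x) k = 'D_u (component k) x.
Proof. by move=> Ux; rewrite /co derive_row // => j; exact: (phis j [::]). Qed.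

Lemma dotv_deriv u s x : U x ->
  dotv (row_of_seq m.+1 s) ('D_u phi x) = \sum_(k < m.+1) s`_k * 'D_u (component k) x.
Proof.
move=> Ux; rewrite /dotv mxE; apply: eq_bigr => k _; rewrite !mxE; congr (_ * _).
by rewrite -co_deriv // /co inord_val.
Qed.

Lemma has_derivative_coord u k x : U x -> has_derivative (component k) x u ('D_u
  (component k) x).
Proof. by move=> Ux; apply: has_derivative_self; exact: smooth_fun_differentiable
  (smooth_coord k) _ Ux. Qed.

Lemma has_derivative_deriv_coord u v k x : U x ->
  has_derivative ('D_v (component k)) x u ('D_u ('D_v (component k)) x).
Proof.
by move=> Ux; apply: has_derivative_self; exact: smooth_fun_differentiable
  (smooth_deriv_coord v k) _ Ux.
Qed.

Lemma lin_form_coord k x : U x -> lin_form (fun v => 'D_v (component k) x).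
Proof. by move=> Ux; apply: lin_form_derive; exact: smooth_fun_differentiable
  (smooth_coord k) _ Ux. Qed.

Lemma coord_schwarz u v k x : U x -> 'D_u ('D_v (component k)) x = 'D_v ('D_u (component
  k)) x.
Proof. exact: smooth_fun_schwarz (smooth_coord k). Qed.

End Pullback.

Section PullbackCoframe.
Variables (R : realType) (U : set 'rV[R]_3).
Local Notation V := 'rV[R]_3.

Lemma dotv_deriv3 (phi : V -> 'rV[R]_3) u a b c x : smooth_map_on U phi -> U x ->
  dotv (row_of_seq 3 [:: a; b; c]) ('D_u phi x)
  = a * 'D_u (component phi 0) x + b * 'D_u (component phi 1) x + c * 'D_u (component
    phi 2) x.
Proof.
by move=> phis Ux; rewrite (dotv_deriv phis) // !big_ord_recl big_ord0 /= addr0 addrA.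
Qed.

Lemma dotv_deriv4 (phi : V -> 'rV[R]_4) u a b c d x : smooth_map_on U phi -> U x ->
  dotv (row_of_seq 4 [:: a; b; c; d]) ('D_u phi x)
  = a * 'D_u (component phi 0) x + b * 'D_u (component phi 1) x
    + c * 'D_u (component phi 2) x + d * 'D_u (component phi 3) x.
Proof.
by move=> phis Ux; rewrite (dotv_deriv phis) // !big_ord_recl big_ord0 /= addr0 !addrA.
Qed.

End PullbackCoframe.

(* Keeps ring and field from comparing derivatives up to conversion. *)
Ltac generalize_derivatives := repeat match goal with
  | |- context [@derive ?A ?B ?C ?f ?x ?v] => let d := fresh in move: (@derive A B C f x
    v) => d
  | |- context [component ?phi ?k ?y] => let d := fresh in move: (component phi k y) => d
  | |- context [expR ?y] => generalize (expR y); intro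
  end.

Section ModelGeometries.
Variables (R : realType) (h : 'rV[R]_3 -> 'M[R]_3) (U : set 'rV[R]_3).
Local Notation V := 'rV[R]_3.
Hypothesis Uo : open U.
Hypothesis hs : forall i j, smooth_fun U (fun x => h x i j).
Hypothesis hsym : forall x, U x -> (h x)^T = h x.
Hypothesis hu : forall x, U x -> h x \in unitmx.

Section ThreeDimensionalModels.
Variable phi : V -> 'rV[R]_3.
Hypothesis phis : smooth_map_on U phi.
Local Notation p := (component phi).
Let sD u k : smooth_fun U ('D_u (p k)) := smooth_deriv_coord Uo phis u k.
Let sp k : smooth_fun U (p k) := smooth_coord phis k.
Let dD u v k x Ux := @has_derivative_deriv_coord _ _ phi U Uo phis u v k x Ux.
Let dp u k x Ux := @has_derivative_coord _ _ phi U Uo phis u k x Ux.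
Let lD k x Ux := @lin_form_coord _ _ phi U Uo phis k x Ux.

Lemma nil_curvature x : (forall y, U y ->
    h y = jacobian phi y *m nil_metric (phi y) *m (jacobian phi y)^T) ->
  U x -> diagonal_curvature h (- 4^-1) (- 4^-1) (3 / 4) x.
Proof.
move=> hE Ux.
pose t2 v y := - p 0 y * 'D_v (p 1) y + 'D_v (p 2) y.
(* The only nonzero structure constant comes from d(dz - x dy) = - dx ^ dy. *)
apply: (@frame_diagonal_curvature R h U (fun v => 'D_v (p 0)) (fun v => 'D_v (p 1)) t2
   0 0 0 0 0 0 0 0 (-1)) => //; rewrite ?/frame_P00 ?/frame_P11 ?/frame_P22.
- by move=> v; apply: SmoothAdd => //; apply: SmoothMul => //; apply: smooth_funN.
- by move=> v y Uy; apply: lD Uy _.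
- by move=> v y Uy; apply: lD Uy _.
- move=> v y Uy; apply: (lin_formD (lin_formZ (- p 0 y) (lD 1 Uy)) (lD 2 Uy)).
- move=> u v y Uy; rewrite (bilform_pullback phis hE u v Uy) /nil_metric !bilformDm
  !bilform_sq_form !(dotv_deriv3 _ _ _ _ phis Uy).
  rewrite /t2 -!/(component phi _ _); generalize_derivatives; ring.
- move=> u v y Uy; rewrite [RHS](_ : _ = 0); last by rewrite !mul0r !addr0.
  by apply/eqP; rewrite subr_eq0; apply/eqP; exact: (coord_schwarz Uo phis).
- move=> u v y Uy; rewrite [RHS](_ : _ = 0); last by rewrite !mul0r !addr0.
  by apply/eqP; rewrite subr_eq0; apply/eqP; exact: (coord_schwarz Uo phis).
- move=> u v y Uy.
  have dt a b : 'D_a (t2 b) y = - 'D_a (p 0) y * 'D_b (p 1) y + - p 0 y * 'D_a ('D_b (p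
    1)) y
      + 'D_a ('D_b (p 2)) y.
    by have [_ <-] := has_derivativeD (has_derivativeM (has_derivativeN (dp a 0 Uy)) (dD
      a b 1 Uy)) (dD a b 2 Uy).
  rewrite !dt (coord_schwarz Uo phis u v 1) // (coord_schwarz Uo phis u v 2) //;
    generalize_derivatives; ring.
- by split; field.
- by rewrite /frame_P01 /frame_P02 /frame_P12; split; field.
- by rewrite /frame_P10 /frame_P20 /frame_P21; split; field.
Qed.

Lemma psl2_curvature x : (forall y, U y -> 0 < p 1 y) -> (forall y, U y ->
    h y = jacobian phi y *m psl2_metric (phi y) *m (jacobian phi y)^T) ->
  U x -> diagonal_curvature h (- 4^-1) (- 4^-1) (7 / 4) x.
Proof.
move=> p1 hE Ux.
have p10 y : U y -> p 1 y != 0 by move=> Uy; rewrite gt_eqF // p1.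
pose t0 v y := (p 1 y)^-1 * 'D_v (p 0) y.
pose t1 v y := (p 1 y)^-1 * 'D_v (p 1) y.
pose t2 v y := (p 1 y)^-1 * 'D_v (p 0) y + 'D_v (p 2) y.
have st k v : smooth_fun U (fun y => (p 1 y)^-1 * 'D_v (p k) y).
  by apply: SmoothMul => //; exact: SmoothInv.
have dt k a b y (Uy : U y) := has_derivativeM (has_derivativeV (p10 y Uy) (dp a 1 Uy))
  (dD a b k Uy).
(* Both dx / y and dt + dx / y have exterior derivative (dx / y) ^ (dy / y), while dy / y is
   closed. *)
apply: (@frame_diagonal_curvature R h U t0 t1 t2 0 0 1 0 0 0 0 0 1) => //;
  rewrite ?/frame_P00 ?/frame_P11 ?/frame_P22.
- by move=> v; exact: st.
- by move=> v; exact: st.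
- by move=> v; apply: SmoothAdd => //; exact: st.
- move=> v y Uy; exact: (lin_formZ _ (lD 0 Uy)).
- move=> v y Uy; exact: (lin_formZ _ (lD 1 Uy)).
- move=> v y Uy; exact: (lin_formD (lin_formZ _ (lD 0 Uy)) (lD 2 Uy)).
- move=> u v y Uy; rewrite (bilform_pullback phis hE u v Uy) /psl2_metric !bilformDm
  !bilform_sq_form !(dotv_deriv3 _ _ _ _ phis Uy).
  rewrite /t0 /t1 /t2 -!/(component phi _ _); generalize_derivatives; ring.
- move=> u v y Uy; have [_ E] := dt 0 u v y Uy; have [_ E'] := dt 0 v u y Uy.
  rewrite /t0 E E' (coord_schwarz Uo phis u v 0) //.
  rewrite /t1; have := p10 y Uy; move: (p 1 y) => q q0; generalize_derivatives; by field.
- move=> u v y Uy; have [_ E] := dt 1 u v y Uy; have [_ E'] := dt 1 v u y Uy.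
  rewrite /t1 E E' (coord_schwarz Uo phis u v 1) //; generalize_derivatives; ring.
- move=> u v y Uy; have [_ E] := has_derivativeD (dt 0 u v y Uy) (dD u v 2 Uy).
  have [_ E'] := has_derivativeD (dt 0 v u y Uy) (dD v u 2 Uy).
  rewrite /t2 E E' (coord_schwarz Uo phis u v 0) // (coord_schwarz Uo phis u v 2) //.
  rewrite /t0 /t1; have := p10 y Uy; move: (p 1 y) => q q0; generalize_derivatives; by
    field.
- by split; field.
- by rewrite /frame_P01 /frame_P02 /frame_P12; split; field.
- by rewrite /frame_P10 /frame_P20 /frame_P21; split; field.
Qed.

Lemma sol_curvature x : (forall y, U y ->
    h y = jacobian phi y *m sol_metric (phi y) *m (jacobian phi y)^T) ->
  U x -> diagonal_curvature h 1 1 (-1) x.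
Proof.
move=> hE Ux.
pose t0 v y := expR (p 2 y) * 'D_v (p 0) y.
pose t1 v y := expR (- p 2 y) * 'D_v (p 1) y.
have dt0 a b y (Uy : U y) := has_derivativeM (has_derivative_expR (dp a 2 Uy)) (dD a b 0
  Uy).
have dt1 a b y (Uy : U y) := has_derivativeM
  (has_derivative_expR (has_derivativeN (dp a 2 Uy))) (dD a b 1 Uy).
(* The derivative of e^z dx is dz ^ (e^z dx), the second of the dual 2-forms; that of e^(-z) dy is
   (e^(-z) dy) ^ dz, the first one. *)
apply: (@frame_diagonal_curvature R h U t0 t1 (fun v => 'D_v (p 2)) 0 1 0 1 0 0 0 0 0)
  => //;
  rewrite ?/frame_P00 ?/frame_P11 ?/frame_P22.
- by move=> v; apply: SmoothMul => //; exact: SmoothExp.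
- by move=> v; apply: SmoothMul => //; apply: SmoothExp; exact: smooth_funN.
- move=> v y Uy; exact: (lin_formZ _ (lD 0 Uy)).
- move=> v y Uy; exact: (lin_formZ _ (lD 1 Uy)).
- by move=> v y Uy; apply: lD Uy _.
- move=> u v y Uy; rewrite (bilform_pullback phis hE u v Uy) /sol_metric !bilformDm
  !bilform_sq_form !(dotv_deriv3 _ _ _ _ phis Uy).
  rewrite /t0 /t1 -!/(component phi _ _); generalize_derivatives; ring.
- move=> u v y Uy; have [_ E] := dt0 u v y Uy; have [_ E'] := dt0 v u y Uy.
  rewrite /t0 E E' (coord_schwarz Uo phis u v 0) //; generalize_derivatives; ring.
- move=> u v y Uy; have [_ E] := dt1 u v y Uy; have [_ E'] := dt1 v u y Uy.
  rewrite /t1 E E' (coord_schwarz Uo phis u v 1) //; generalize_derivatives; ring.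
- move=> u v y Uy; rewrite [RHS](_ : _ = 0); last by rewrite !mul0r !addr0.
  by apply/eqP; rewrite subr_eq0; apply/eqP; exact: (coord_schwarz Uo phis).
- by split; field.
- by rewrite /frame_P01 /frame_P02 /frame_P12; split; field.
- by rewrite /frame_P10 /frame_P20 /frame_P21; split; field.
Qed.

End ThreeDimensionalModels.

Section Spheres.
Variable phi : V -> 'rV[R]_4.
Hypothesis phis : smooth_map_on U phi.
Hypothesis phi1 : forall y, U y -> unit_sphere (phi y).
Variables lambda mu nu : R.
Hypotheses (l0 : 0 < lambda) (m0 : 0 < mu) (v0 : 0 < nu).
Local Notation p := (component phi).
Let sD u k : smooth_fun U ('D_u (p k)) := smooth_deriv_coord Uo phis u k.
Let sp k : smooth_fun U (p k) := smooth_coord phis k.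
Let dD u v k x Ux := @has_derivative_deriv_coord _ _ phi U Uo phis u v k x Ux.
Let dp u k x Ux := @has_derivative_coord _ _ phi U Uo phis u k x Ux.
Let lD k x Ux := @lin_form_coord _ _ phi U Uo phis k x Ux.
Let a := Num.sqrt lambda.
Let b := Num.sqrt mu.
Let c := Num.sqrt nu.
(** The left-invariant coframe s0, s1, s2 satisfies ds0 = -2 s1 ^ s2 and its cyclic analogues. For
    the orthonormal coframe a s0, b s1, c s2 the constants become these. *)
Let n0 := - 2 * a / (b * c).
Let n1 := - 2 * b / (c * a).
Let n2 := - 2 * c / (a * b).

(* The diagonal entries of the matrix P of a frame with N = diag(x0, x1, x2). *)
Definition su2_P (x0 x1 x2 : R) :=
  (x0 - (x0 + x1 + x2) / 2) * x0 + (x1 - (x0 + x1 + x2) / 2) * (x2 - (x0 + x1 + x2) / 2).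

Lemma su2_curvature x : (forall y, U y ->
    h y = jacobian phi y *m su2_metric lambda mu nu (phi y) *m (jacobian phi y)^T) ->
  U x -> diagonal_curvature h (su2_P n0 n1 n2) (su2_P n1 n2 n0) (su2_P n2 n0 n1) x.
Proof.
move=> hE Ux.
have sq0 k : 0 < k -> Num.sqrt k != 0 :> R by move=> k0; rewrite gt_eqF // sqrtr_gt0.
have a0 : a != 0 by exact: sq0.
have b0 : b != 0 by exact: sq0.
have c0 : c != 0 by exact: sq0.
pose s0 v y := - p 1 y * 'D_v (p 0) y + p 0 y * 'D_v (p 1) y + p 3 y * 'D_v (p 2) y - p
  2 y * 'D_v (p 3) y.
pose s1 v y := - p 2 y * 'D_v (p 0) y - p 3 y * 'D_v (p 1) y + p 0 y * 'D_v (p 2) y + p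
  1 y * 'D_v (p 3) y.
pose s2 v y := - p 3 y * 'D_v (p 0) y + p 2 y * 'D_v (p 1) y - p 1 y * 'D_v (p 2) y + p
  0 y * 'D_v (p 3) y.
have S1 y : U y -> p 0 y * p 0 y + p 1 y * p 1 y + p 2 y * p 2 y + p 3 y * p 3 y = 1.
  by move=> Uy; have := phi1 Uy; rewrite /unit_sphere /= dotv4.
have S0 v y : U y -> p 0 y * 'D_v (p 0) y + p 1 y * 'D_v (p 1) y + p 2 y * 'D_v (p 2) y
  + p 3 y * 'D_v (p 3) y = 0.
  move=> Uy; have dd k := has_derivativeM (dp v k Uy) (dp v k Uy).
  have [_ E] := has_derivativeD (has_derivativeD (has_derivativeD (dd 0) (dd 1)) (dd 2))
    (dd 3).
  have : 'D_v (fun z => p 0 z * p 0 z + p 1 z * p 1 z + p 2 z * p 2 z + p 3 z * p 3 z) y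
    = 0.
    rewrite -(derive_cst (1:R) y v); apply: near_eq_derive.
    by apply: near_open Uo Uy _ => z Uz; exact: S1.
  rewrite E => E2; rewrite -[RHS](mulr0 2^-1) -E2.
  by generalize_derivatives; field.
have ss0 v : smooth_fun U (s0 v).
  apply: SmoothAdd; last by apply: smooth_funN; exact: SmoothMul.
  by do 2 (apply: SmoothAdd; last exact: SmoothMul); apply: SmoothMul => //; exact:
    smooth_funN.
have ss1 v : smooth_fun U (s1 v).
  do 2 (apply: SmoothAdd; last exact: SmoothMul); apply: SmoothAdd; last by apply:
    smooth_funN; exact: SmoothMul.
  by apply: SmoothMul => //; exact: smooth_funN.
have ss2 v : smooth_fun U (s2 v).
  apply: SmoothAdd; last exact: SmoothMul; apply: SmoothAdd; last by apply: smooth_funN;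
    exact: SmoothMul.
  by apply: SmoothAdd; last exact: SmoothMul; apply: SmoothMul => //; exact: smooth_funN.
have ls0 y : U y -> lin_form (s0^~ y).
  move=> Uy; exact: (lin_formD (lin_formD (lin_formD (lin_formZ _ (lD 0 Uy)) (lin_formZ
    _ (lD 1 Uy)))
    (lin_formZ _ (lD 2 Uy))) (lin_formN (lin_formZ _ (lD 3 Uy)))).
have ls1 y : U y -> lin_form (s1^~ y).
  move=> Uy; exact: (lin_formD (lin_formD (lin_formD (lin_formZ _ (lD 0 Uy)) (lin_formN
    (lin_formZ _ (lD 1 Uy))))
    (lin_formZ _ (lD 2 Uy))) (lin_formZ _ (lD 3 Uy))).
have ls2 y : U y -> lin_form (s2^~ y).
  move=> Uy; exact: (lin_formD (lin_formD (lin_formD (lin_formZ _ (lD 0 Uy)) (lin_formZ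
    _ (lD 1 Uy)))
    (lin_formN (lin_formZ _ (lD 2 Uy)))) (lin_formZ _ (lD 3 Uy))).
have ds0 u v y : U y -> 'D_u (s0 v) y - 'D_v (s0 u) y = -2 * (s1 u y * s2 v y - s2 u y *
  s1 v y).
  move=> Uy; have dm w w' i j := has_derivativeM (dp w i Uy) (dD w w' j Uy).
  have dn w w' i j := has_derivativeM (has_derivativeN (dp w i Uy)) (dD w w' j Uy).
  have D w w' := has_derivativeB (has_derivativeD (has_derivativeD (dn w w' 1 0) (dm w
    w' 0 1)) (dm w w' 3 2)) (dm w w' 2 3).
  have [_ E] := D u v; have [_ E'] := D v u; rewrite /s0 E E'.
  rewrite (coord_schwarz Uo phis u v 0 Uy) (coord_schwarz Uo phis u v 1 Uy).
  rewrite (coord_schwarz Uo phis u v 2 Uy) (coord_schwarz Uo phis u v 3 Uy).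
  have [Q _ _] := quaternion_coframe (S1 y Uy) (S0 u y Uy) (S0 v y Uy).
  by rewrite mulNr -mulrN /s1 /s2 -Q; generalize_derivatives; ring.
have ds1 u v y : U y -> 'D_u (s1 v) y - 'D_v (s1 u) y = -2 * (s2 u y * s0 v y - s0 u y *
  s2 v y).
  move=> Uy; have dm w w' i j := has_derivativeM (dp w i Uy) (dD w w' j Uy).
  have dn w w' i j := has_derivativeM (has_derivativeN (dp w i Uy)) (dD w w' j Uy).
  have D w w' := has_derivativeD (has_derivativeD (has_derivativeB (dn w w' 2 0) (dm w
    w' 3 1)) (dm w w' 0 2)) (dm w w' 1 3).
  have [_ E] := D u v; have [_ E'] := D v u; rewrite /s1 E E'.
  rewrite (coord_schwarz Uo phis u v 0 Uy) (coord_schwarz Uo phis u v 1 Uy).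
  rewrite (coord_schwarz Uo phis u v 2 Uy) (coord_schwarz Uo phis u v 3 Uy).
  have [_ Q _] := quaternion_coframe (S1 y Uy) (S0 u y Uy) (S0 v y Uy).
  by rewrite mulNr -mulrN /s0 /s2 -Q; generalize_derivatives; ring.
have ds2 u v y : U y -> 'D_u (s2 v) y - 'D_v (s2 u) y = -2 * (s0 u y * s1 v y - s1 u y *
  s0 v y).
  move=> Uy; have dm w w' i j := has_derivativeM (dp w i Uy) (dD w w' j Uy).
  have dn w w' i j := has_derivativeM (has_derivativeN (dp w i Uy)) (dD w w' j Uy).
  have D w w' := has_derivativeD (has_derivativeB (has_derivativeD (dn w w' 3 0) (dm w
    w' 2 1)) (dm w w' 1 2)) (dm w w' 0 3).
  have [_ E] := D u v; have [_ E'] := D v u; rewrite /s2 E E'.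
  rewrite (coord_schwarz Uo phis u v 0 Uy) (coord_schwarz Uo phis u v 1 Uy).
  rewrite (coord_schwarz Uo phis u v 2 Uy) (coord_schwarz Uo phis u v 3 Uy).
  have [_ _ Q] := quaternion_coframe (S1 y Uy) (S0 u y Uy) (S0 v y Uy).
  by rewrite mulNr -mulrN /s0 /s1 -Q; generalize_derivatives; ring.
have dZ k (s : V -> V -> R) u v y : U y -> (forall v, smooth_fun U (s v)) ->
    'D_u (fun z => k * s v z) y = k * 'D_u (s v) y.
  move=> Uy sms; have ds := smooth_fun_differentiable Uo (sms v) Uy.
  by have [_ ->] := has_derivativeZ k (has_derivative_self u ds).
apply: (@frame_diagonal_curvature R h U (fun v y => a * s0 v y) (fun v y => b * s1 v y)
   (fun v y => c * s2 v y) n0 0 0 0 n1 0 0 0 n2) => //;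
  rewrite ?/frame_P00 ?/frame_P11 ?/frame_P22.
- by move=> v; apply: SmoothMul => //; exact: SmoothCst.
- by move=> v; apply: SmoothMul => //; exact: SmoothCst.
- by move=> v; apply: SmoothMul => //; exact: SmoothCst.
- move=> v y Uy; exact: (lin_formZ a (ls0 y Uy)).
- move=> v y Uy; exact: (lin_formZ b (ls1 y Uy)).
- move=> v y Uy; exact: (lin_formZ c (ls2 y Uy)).
- move=> u v y Uy; rewrite (bilform_pullback phis hE u v Uy) /su2_metric !bilformDm
  !bilformZm !bilform_sq_form !(dotv_deriv4 _ _ _ _ _ phis Uy).
  rewrite -!/(component phi _ _).
  have -> : lambda = a * a by rewrite -expr2 sqr_sqrtr // ltW.
  have -> : mu = b * b by rewrite -expr2 sqr_sqrtr // ltW.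
  have -> : nu = c * c by rewrite -expr2 sqr_sqrtr // ltW.
  rewrite /s0 /s1 /s2; generalize_derivatives; ring.
- move=> u v y Uy; rewrite (dZ a s0 u v y Uy ss0) (dZ a s0 v u y Uy ss0) -mulrBr.
  rewrite (ds0 u v y Uy) /n0; clearbody s0 s1 s2 a b c.
  by move: (s0 u y) (s0 v y) (s1 u y) (s1 v y) (s2 u y) (s2 v y) => *; field; rewrite c0
    b0.
- move=> u v y Uy; rewrite (dZ b s1 u v y Uy ss1) (dZ b s1 v u y Uy ss1) -mulrBr.
  rewrite (ds1 u v y Uy) /n1; clearbody s0 s1 s2 a b c.
  by move: (s0 u y) (s0 v y) (s1 u y) (s1 v y) (s2 u y) (s2 v y) => *; field; rewrite a0
    c0.
- move=> u v y Uy; rewrite (dZ c s2 u v y Uy ss2) (dZ c s2 v u y Uy ss2) -mulrBr.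
  rewrite (ds2 u v y Uy) /n2; clearbody s0 s1 s2 a b c.
  by move: (s0 u y) (s0 v y) (s1 u y) (s1 v y) (s2 u y) (s2 v y) => *; field; rewrite a0
    b0.
- by rewrite /su2_P; split; field.
- by rewrite /frame_P01 /frame_P02 /frame_P12; split; field.
- by rewrite /frame_P10 /frame_P20 /frame_P21; split; field.
Qed.

End Spheres.
End ModelGeometries.

(** * Submanifolds of Euclidean space and the Cartan hypersurface *)

(** For the matrix M with rows s_i the hypothesis reads M H M^T = 1, and a one-sided inverse of a
    square matrix is two-sided; inserting H M^T M = 1 gives the expansion. *)
Lemma orthonormal_expansion (R : realType) n (H : 'M[R]_n) (s : seq 'rV[R]_n) u v :
  H^T = H -> (forall i j : 'I_n, bilform H s`_i s`_j = (i == j)%:R) ->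
  bilform H u v = \sum_(i < n) bilform H u s`_i * bilform H v s`_i.
Proof.
move=> Hs sP; pose M := \matrix_(i < n) s`_i.
have rM i : row i M = s`_i by rewrite rowK.
have MHM : M *m (H *m M^T) = 1%:M.
  apply/matrixP => i j; rewrite [RHS]mxE -sP -!rM /bilform.
  by rewrite mulmxA -row_mul mxE [RHS]mxE; apply: eq_bigr => k _; rewrite !mxE.
have HMM : H *m M^T *m M = 1%:M by exact: mulmx1C.
have -> : bilform H u v = ((u *m H *m M^T) *m (M *m H *m v^T)) 0 0.
  have -> : u *m H *m M^T *m (M *m H *m v^T) = u *m (H *m M^T *m M) *m H *m v^T.
    by rewrite !mulmxA.
  by rewrite HMM mulmx1.
rewrite mxE; apply: eq_bigr => i _; congr (_ * _).
  by rewrite /bilform -rM mxE [RHS]mxE; apply: eq_bigr => k _; rewrite !mxE.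
by rewrite [RHS]bilform_sym // /bilform -rM -!row_mul [RHS]mxE.
Qed.

Section Gauss.
Variables (R : realType) (n m : nat) (phi : 'rV[R]_n -> 'rV[R]_m).
Variables (h : 'rV[R]_n -> 'M[R]_n) (U : set 'rV[R]_n).
Local Notation V := 'rV[R]_n.
Hypothesis Uo : open U.
Hypothesis phis : smooth_map_on U phi.
Hypothesis hE : forall x, U x -> h x = jacobian phi x *m 1%:M *m (jacobian phi x)^T.
Hypothesis hs : forall i j, smooth_fun U (fun x => h x i j).
Hypothesis hsym : forall x, U x -> (h x)^T = h x.
Hypothesis hu : forall x, U x -> h x \in unitmx.

Definition second_derive (u v x : V) : 'rV[R]_m :=
  \row_k 'D_u ('D_v (fun y => phi y 0 k)) x.

Lemma dotvE k (a b : 'rV[R]_k) : dotv a b = \sum_i a 0 i * b 0 i.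
Proof. by rewrite /dotv mxE; apply: eq_bigr => i _; rewrite mxE. Qed.

Let pk k : smooth_fun U (fun y => phi y 0 k). Proof. exact/SmoothOn/phis. Qed.
Let dpk u k : smooth_fun U ('D_u (fun y => phi y 0 k)). Proof. exact: smooth_fun_deriv.
  Qed.
Let ddpk u v k : smooth_fun U ('D_u ('D_v (fun y => phi y 0 k))).
Proof. exact: smooth_fun_deriv. Qed.
Let dif f x u : smooth_fun U f -> U x -> has_derivative f x u ('D_u f x).
Proof. by move=> sf Ux; apply: has_derivative_self; exact: smooth_fun_differentiable sf
  _ Ux. Qed.

Lemma derive_map u k x : U x -> ('D_u phi x) 0 k = 'D_u (fun y => phi y 0 k) x.
Proof. by move=> Ux; rewrite derive_row // => j; exact: (phis j [::]). Qed.

Lemma differentiable_map x : U x -> differentiable phi x.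
Proof. by move=> Ux; apply: differentiable_row => j; exact: (phis j [::]). Qed.

Lemma induced_metric u v x : U x -> bilform (h x) u v = dotv ('D_u phi x) ('D_v phi x).
Proof.
move=> Ux; rewrite hE // bilform_jacobian; last by move=> k; exact: (phis k [::]).
by rewrite /bilform mulmx1.
Qed.

Lemma has_derivative_dotv_map (f : V -> 'rV[R]_m) (df : 'rV[R]_m) u v x : U x ->
  (forall k, has_derivative (fun y => f y 0 k) x u (df 0 k)) ->
  has_derivative (fun y => dotv (f y) ('D_v phi y)) x u
    (dotv df ('D_v phi x) + dotv (f x) (second_derive u v x)).
Proof.
move=> Ux fd.
have D : has_derivative (fun y => \sum_k f y 0 k * 'D_v (fun z => phi z 0 k) y) x u
    (\sum_k (df 0 k * 'D_v (fun z => phi z 0 k) x + f x 0 k * 'D_u ('D_v (fun z => phi z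
      0 k)) x)).
  by apply: has_derivative_sum => k; apply: has_derivativeM => //; exact: dif.
apply: has_derivative_near (has_derivative_eq D _).
  apply: near_open Uo Ux _ => y Uy; rewrite dotvE; apply: eq_bigr => k _.
  by rewrite derive_map.
rewrite !dotvE -big_split; apply: eq_bigr => k _ /=.
by rewrite derive_map // mxE.
Qed.

Lemma second_derive_sym u v x : U x -> second_derive u v x = second_derive v u x.
Proof.
move=> Ux; apply/rowP => k; rewrite [LHS]mxE [RHS]mxE; exact: (smooth_fun_schwarz u v Uo
  (pk k) Ux).
Qed.

Lemma dotvC k (a b : 'rV[R]_k) : dotv a b = dotv b a.
Proof. by rewrite !dotvE; apply: eq_bigr => i _; rewrite mulrC. Qed.

Lemma dotvBl k (a b c : 'rV[R]_k) : dotv (a - b) c = dotv a c - dotv b c.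
Proof. by rewrite !dotvE -sumrB; apply: eq_bigr => i _; rewrite !mxE mulrBl. Qed.

Lemma derive_induced_metric u v w x : U x ->
  'D_w (fun y => bilform (h y) u v) x
  = dotv (second_derive w u x) ('D_v phi x) + dotv ('D_u phi x) (second_derive w v x).
Proof.
move=> Ux.
have fd k : has_derivative (fun y => ('D_u phi y) 0 k) x w (second_derive w u x 0 k).
  apply: has_derivative_eq (has_derivative_near _ (dif w (dpk u k) Ux)) _.
    by apply: near_open Uo Ux _ => y Uy; rewrite derive_map.
  by rewrite [RHS]mxE.
have [_ <-] := has_derivative_dotv_map v Ux fd.
by apply: near_eq_derive; apply: near_open Uo Ux _ => y Uy; rewrite induced_metric.
Qed.

Lemma christoffel1_induced u v w x : U x ->
  christoffel1 h u v w x = dotv (second_derive u v x) ('D_w phi x).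
Proof.
move=> Ux; rewrite /christoffel1 !derive_induced_metric //.
rewrite (second_derive_sym w u Ux) (second_derive_sym w v Ux) (second_derive_sym v u Ux).
rewrite (dotvC ('D_v phi x) (second_derive u w x)) (dotvC ('D_u phi x) (second_derive v
  w x)).
move: (second_derive u v x) (second_derive u w x) (second_derive v w x) => a b c.
move: (dotv a _) (dotv b _) (dotv c _) => d e f; by field.
Qed.

(** The second fundamental form of the immersion, with values in the normal space of R^m. *)
Definition normal_part (v w x : V) : 'rV[R]_m :=
  second_derive v w x - 'D_(christoffel2 h v w x) phi x.

Lemma normal_part_tangent v w z x : U x -> dotv (normal_part v w x) ('D_z phi x) = 0.
Proof.
move=> Ux; rewrite /normal_part dotvBl -induced_metric // (christoffel2P Uo hs hsym hu)
  //.
by rewrite christoffel1_induced // subrr.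
Qed.

(** The third derivatives cancel by symmetry. The second factors may be full second derivatives,
    since their tangential part is orthogonal to [normal_part]. *)
Lemma gauss_equation u v w z x : U x ->
  riemann h x u v w z
  = dotv (normal_part v w x) (second_derive u z x)
    - dotv (normal_part u w x) (second_derive v z x).
Proof.
move=> Ux.
have np a b c : dotv (normal_part a b x) c
    = dotv (second_derive a b x) c - dotv ('D_(christoffel2 h a b x) phi x) c.
  exact: dotvBl.
pose third a b c : 'rV[R]_m := \row_k 'D_a ('D_b ('D_c (fun y => phi y 0 k))) x.
have dc a b c d : 'D_a (christoffel1 h b c d) x
   = dotv (third a b c) ('D_d phi x) + dotv (second_derive b c x) (second_derive a d x).
  have fd k : has_derivative (fun y => second_derive b c y 0 k) x a (third a b c 0 k).
    apply: has_derivative_eq (has_derivative_near _ (dif a (ddpk b c k) Ux)) _.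
      by apply: near_open Uo Ux _ => y Uy; rewrite [RHS]mxE.
    by rewrite [RHS]mxE.
  have [_ <-] := has_derivative_dotv_map d Ux fd.
  by apply: near_eq_derive; apply: near_open Uo Ux _ => y Uy; rewrite
    christoffel1_induced.
have third_sym : third u v w = third v u w.
  by apply/rowP => k; rewrite [LHS]mxE [RHS]mxE; exact: (smooth_fun_schwarz u v Uo (dpk
    w k) Ux).
have alg (r A B C D a b b' n1 n2 : R) : r = A - B - (C - D) -> A = a + b ->
    C = a + b' -> n1 = b - B -> n2 = b' - D -> r = n1 - n2.
  by move=> -> -> -> -> ->; ring.
have c1 a b c : christoffel1 h a b c x = dotv ('D_c phi x) (second_derive a b x).
  exact: etrans (christoffel1_induced a b c Ux) (dotvC _ _).
have E1 := riemann_christoffel Uo hs hsym hu u v w z Ux.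
have E2 := dc u v w z.
have E3 : 'D_v (christoffel1 h u w z) x
   = dotv (third u v w) ('D_z phi x) + dotv (second_derive u w x) (second_derive v z x).
  by have := dc v u w z; rewrite -third_sym.
have E4 a b c d : dotv (normal_part a b x) (second_derive c d x)
    = dotv (second_derive a b x) (second_derive c d x)
      - christoffel1 h c d (christoffel2 h a b x) x.
  by have := np a b (second_derive c d x); rewrite -c1.
exact: (alg _ _ _ _ _ _ _ _ _ _ E1 E2 E3 (E4 v w u z) (E4 u w v z)).
Qed.

Lemma chain_rule_map (W : normedModType R) (f : 'rV[R]_m -> W) u x : U x ->
  differentiable f (phi x) -> 'D_u (f \o phi) x = 'D_('D_u phi x) f (phi x).
Proof.
move=> Ux df; have dphi := differentiable_map Ux.
by rewrite !deriveE //; [rewrite diff_comp|exact: differentiable_comp].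
Qed.

End Gauss.

Section DotProduct.
Variables (R : realType) (n : nat).
Implicit Types u v w : 'rV[R]_n.

Lemma dotv_bilform u v : dotv u v = bilform 1%:M u v.
Proof. by rewrite /bilform mulmx1. Qed.

Lemma dotvDl u v w : dotv (u + v) w = dotv u w + dotv v w.
Proof. by rewrite !dotv_bilform bilformDl. Qed.

Lemma dotvZl c u w : dotv (c *: u) w = c * dotv u w.
Proof. by rewrite !dotv_bilform bilformZl. Qed.

Lemma dotv_gt0 u : u != 0 -> 0 < dotv u u.
Proof.
move=> u0; rewrite lt0r; apply/andP; split; last first.
  by rewrite dotvE sumr_ge0 // => i _; rewrite -expr2 sqr_ge0.
apply: contra u0 => /eqP; rewrite dotvE => /eqP.
rewrite psumr_eq0; last by move=> i _; rewrite -expr2 sqr_ge0.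
move/allP => u0; apply/eqP/rowP => i; rewrite mxE; apply/eqP.
by have := u0 i (mem_index_enum i); rewrite mulf_eq0 orbb.
Qed.

End DotProduct.

(** A dimension count: q and d are independent, because v0 is orthogonal to q but not to d, so their
    common orthogonal complement in R^5 has dimension 3. It contains the row space of J, which has
    rank 3, and therefore equals it. *)
Lemma tangent_subspace (R : realType) (J : 'M[R]_(3, 5)) (q d v0 v : 'rV[R]_5) :
  J *m J^T \in unitmx -> dotv q q = 1 -> dotv v0 q = 0 -> dotv v0 d <> 0 ->
  (forall u : 'rV[R]_3, dotv (u *m J) q = 0 /\ dotv (u *m J) d = 0) ->
  dotv v q = 0 -> dotv v d = 0 -> exists u : 'rV[R]_3, v = u *m J.
Proof.
move=> Ju qq v0q v0d Jt vq vd.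
pose K := row_mx q^T d^T : 'M[R]_(5, 1 + 1).
have kerE (w : 'rV[R]_5) : dotv w q = 0 -> dotv w d = 0 -> w *m K = 0.
  move=> wq wd; rewrite mul_mx_row; apply/eqP; rewrite -row_mx0.
  have -> : w *m q^T = 0 by apply/matrixP => i j; rewrite !ord1 [RHS]mxE.
  by have -> : w *m d^T = 0 by apply/matrixP => i j; rewrite !ord1 [RHS]mxE.
have rK : \rank K = 2.
  rewrite -mxrank_tr; apply/eqP; rewrite -/(row_free K^T) -kermx_eq0.
  apply/rowV0P => a /sub_kermxP; rewrite tr_row_mx !trmxK => aK.
  have aK2 : a = row_mx (lsubmx a) (rsubmx a) by rewrite hsubmxK.
  rewrite aK2 mul_row_col in aK.
  have E w : (lsubmx a) 0 0 * dotv q w + (rsubmx a) 0 0 * dotv d w = 0.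
    rewrite -!dotvZl -dotvDl -!mul_scalar_mx -!mx11_scalar aK.
    by rewrite -(scale0r 0) dotvZl mul0r.
  have c0 : (rsubmx a) 0 0 = 0.
    have := E v0; rewrite (dotvC q) v0q mulr0 add0r => /eqP; rewrite mulf_eq0 dotvC.
    by case/orP => /eqP.
  have b0 : (lsubmx a) 0 0 = 0.
    by have := E q; rewrite c0 mul0r addr0 qq mulr1.
  rewrite aK2 -row_mx0; congr row_mx; apply/matrixP => i j; by rewrite !ord1 [RHS]mxE.
have rJ : row_free J.
  apply/row_freeP; exists (J^T *m invmx (J *m J^T)).
  by rewrite mulmxA mulmxV.
have JK : (J <= kermx K)%MS.
  apply/row_subP => r; apply/sub_kermxP; rewrite rowE.
  by have [Jq Jd] := Jt (delta_mx 0 r); exact: kerE.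
have KJ : (kermx K <= J)%MS.
  rewrite -(mxrank_leqif_sup JK).2 mxrank_ker rK.
  by move: rJ; rewrite /row_free => /eqP ->.
have : (v <= J)%MS.
  by apply: submx_trans KJ; apply/sub_kermxP; exact: kerE.
by case/submxP => u ->; exists u.
Qed.

Lemma dotv_expansion5 (R : realType) (a0 a1 a2 a3 a4 u v : 'rV[R]_5) :
  [/\ dotv a0 a0 = 1, dotv a1 a1 = 1, dotv a2 a2 = 1, dotv a3 a3 = 1 & dotv a4 a4 = 1] ->
  [/\ dotv a0 a1 = 0, dotv a0 a2 = 0 & dotv a1 a2 = 0] ->
  [/\ dotv a0 a3 = 0, dotv a1 a3 = 0 & dotv a2 a3 = 0] ->
  [/\ dotv a0 a4 = 0, dotv a1 a4 = 0, dotv a2 a4 = 0 & dotv a3 a4 = 0] ->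
  dotv u a0 = 0 -> dotv u a1 = 0 -> dotv u a2 = 0 ->
  dotv u v = dotv u a3 * dotv v a3 + dotv u a4 * dotv v a4.
Proof.
move=> [n0 n1 n2 n3 n4] [p01 p02 p12] [p03 p13 p23] [p04 p14 p24 p34] u0 u1 u2.
rewrite dotv_bilform (@orthonormal_expansion _ _ _ [:: a0; a1; a2; a3; a4]) ?trmx1 //.
  by rewrite !big_ord_recl big_ord0 /= -!dotv_bilform u0 u1 u2 !mul0r !add0r addr0.
case=> [[|[|[|[|[|i]]]]] Hi] [[|[|[|[|[|j]]]]] Hj] //=; rewrite -dotv_bilform //;
  by rewrite dotvC.
Qed.

(** * Curvature of the Cartan hypersurface from its principal curvatures *)

Section Cartan.
Variables (R : realType) (phi : 'rV[R]_3 -> 'rV[R]_5).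
Variables (h : 'rV[R]_3 -> 'M[R]_3) (U : set 'rV[R]_3) (Sigma : set 'rV[R]_5).
Local Notation V := 'rV[R]_3.
Hypothesis Uo : open U.
Hypothesis phis : smooth_map_on U phi.
Hypothesis hE : forall x, U x -> h x = jacobian phi x *m 1%:M *m (jacobian phi x)^T.
Hypothesis hs : forall i j, smooth_fun U (fun x => h x i j).
Hypothesis hsym : forall x, U x -> (h x)^T = h x.
Hypothesis hu : forall x, U x -> h x \in unitmx.
Hypothesis SigmaC : cartan_hypersurface Sigma.
Hypothesis phiS : forall x, U x -> Sigma (phi x).

Local Notation sd := (second_derive phi).

Lemma cartan_sphere q : Sigma q -> dotv q q = 1.
Proof.
case: SigmaC => _ _ _ loc Sq; have [U' [f [nu [[_ Uq] _ _ E _]]]] := loc q Sq.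
have : (Sigma `&` U') q by [].
by rewrite E => -[[]].
Qed.

Let hd_phi x u k : U x -> has_derivative (fun y => phi y 0 k) x u (('D_u phi x) 0 k).
Proof.
move=> Ux; split; first exact: (phis k [::]).
by rewrite (derive_map phis).
Qed.

Lemma sphere_tangent u x : U x -> dotv ('D_u phi x) (phi x) = 0.
Proof.
move=> Ux.
have [_ E] := has_derivative_sum (index_enum 'I_5) (fun k => has_derivativeM (hd_phi u k
  Ux) (hd_phi u k Ux)).
have : 'D_u (fun y => \sum_k phi y 0 k * phi y 0 k) x = 0.
  rewrite -[RHS](derive_cst (1 : R) x u); apply: near_eq_derive.
  apply: near_open Uo Ux _ => y Uy; transitivity (dotv (phi y) (phi y)); first by
    rewrite dotvE.
  by rewrite cartan_sphere //; exact: phiS.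
rewrite E big_split /= -!dotvE (dotvC (phi x)) => E2.
by apply/eqP; move/eqP: E2; rewrite -mulr2n mulrn_eq0.
Qed.

Lemma sphere_normal u v x : U x -> dotv (sd u v x) (phi x) = - bilform (h x) u v.
Proof.
move=> Ux; have [_ E] := has_derivative_dotv_map Uo phis v Ux (fun k => hd_phi u k Ux).
have : 'D_u (fun y => dotv (phi y) ('D_v phi y)) x = 0.
  rewrite -[RHS](derive_cst (0 : R) x u); apply: near_eq_derive.
  by apply: near_open Uo Ux _ => y Uy; rewrite dotvC sphere_tangent.
rewrite E => /eqP; rewrite addrC addr_eq0 => /eqP; rewrite dotvC => ->.
by rewrite (induced_metric phis hE).
Qed.

(* L u is the derivative of the unit normal field along u, i.e. minus the shape
   operator. *)
Lemma cartan_normal x : U x -> exists nu : 'rV[R]_5, exists L : V -> 'rV[R]_5,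
  [/\ dotv nu nu = 1 /\ dotv nu (phi x) = 0,
      forall u, dotv nu ('D_u phi x) = 0,
      forall u v, dotv (sd u v x) nu = - dotv (L u) ('D_v phi x),
      forall c u v, L (c *: u + v) = c *: L u + L v
    & forall k : R, k \in [:: Num.sqrt 3; 0; - Num.sqrt 3] ->
        exists u : V, 'D_u phi x != 0 /\ L u = - k *: 'D_u phi x].
Proof.
move=> Ux; have Sx := phiS Ux.
case: SigmaC => _ _ _ /(_ _ Sx) [U' [f [nu [[U'o U'x] fs nus SE loc]]]].
have U'near : \forall y \near x, U y /\ U' (phi y).
  have dphi := differentiable_continuous (differentiable_map phis Ux).
  have n1 : nbhs x U by exact: open_nbhs_nbhs.
  have n2 : \forall y \near x, U' (phi y).
    by apply: dphi; exact: open_nbhs_nbhs.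
  by apply: filterS (filterI n1 n2) => y [].
have dfq y : U' y -> differentiable f y by exact: (fs [::]).
have dnu y : U' y -> differentiable nu y.
  by move=> U'y; apply: differentiable_row => k; exact: (nus k [::]).
have tang y : (\forall z \near y, U z /\ U' (phi z)) ->
    forall v, dotv ('D_v phi y) (phi y) = 0 /\ 'D_('D_v phi y) f (phi y) = 0.
  move=> ny v; have [Uy U'y] := nbhs_singleton ny; split; first exact: sphere_tangent.
  rewrite -(chain_rule_map phis) //; last exact: dfq.
  rewrite -[RHS](derive_cst (0 : R) y v); apply: near_eq_derive.
  apply: filterS ny => z [Uz U'z] /=.
  have : (Sigma `&` U') (phi z) by split => //; exact: phiS.
  by rewrite SE => -[].
have normal y : (\forall z \near y, U z /\ U' (phi z)) ->
    forall v, dotv (nu (phi y)) ('D_v phi y) = 0.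
  move=> ny v; have [Uy U'y] := nbhs_singleton ny.
  have [_ _ nt _] := loc (phi y) (phiS Uy) U'y.
  by apply: nt; exact: tang.
have [ex1 [nn nq] _ eig] := loc _ Sx U'x.
exists (nu (phi x)), (fun u => 'D_u (nu \o phi) x).
have dcomp : differentiable (nu \o phi) x.
  by apply: differentiable_comp; [exact: (differentiable_map phis)|exact: dnu].
split => //.
- by move=> u; exact: normal.
- move=> u v.
  have hd k : has_derivative (fun y => (nu (phi y)) 0 k) x u (('D_u (nu \o phi) x) 0 k).
    have dk j : differentiable (fun y => (nu \o phi) y 0 j) x.
      apply: (@differentiable_comp _ _ _ _ phi (fun q => nu q 0 j)).
        exact: (differentiable_map phis).
      exact: (nus j [::]).
    by split; [exact: dk|rewrite derive_row].
  have [_ E] := has_derivative_dotv_map Uo phis v Ux hd.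
  (* Weingarten equation: the normal field stays orthogonal to the tangent vectors near [x], so the
     derivative of this product vanishes. *)
  have : 'D_u (fun y => dotv (nu (phi y)) ('D_v phi y)) x = 0.
    rewrite -[RHS](derive_cst (0 : R) x u); apply: near_eq_derive.
    by apply: filterS (nbhs_interior U'near) => y ny; exact: normal.
  by rewrite E => /eqP; rewrite addrC addr_eq0 => /eqP; rewrite dotvC.
- by move=> c u v; rewrite !deriveE // linearD linearZ.
- move=> k kin; have [v [v0 [vq vf] vk]] := eig k kin.
  have [v1 [v1q v1f]] := ex1.
  (* The principal direction [v] is given in R^5. With [d] the gradient of the defining function,
     the dimension count in [tangent_subspace] writes it as the derivative of [phi] along a vector
     of the chart. *)
  pose d : 'rV[R]_5 := \row_i partial i f (phi x).
  have dE w : 'D_w f (phi x) = dotv w d.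
    rewrite derive_sum_partial; last exact: dfq.
    by rewrite dotvE; apply: eq_bigr => i _; rewrite mxE.
  have [|||||||u uE] := @tangent_subspace R (jacobian phi x) (phi x) d v1 v.
  - by have := hu Ux; rewrite hE // mulmx1.
  - exact: cartan_sphere.
  - by [].
  - by rewrite -dE.
  - move=> u; rewrite -deriveEjacobian; last exact: (differentiable_map phis).
    by have := tang x U'near u; rewrite dE.
  - by [].
  - by rewrite -dE.
  have Du : 'D_u phi x = v.
    by rewrite deriveEjacobian //; exact: (differentiable_map phis).
  exists u; rewrite Du; split => //.
  rewrite (chain_rule_map phis) //; last exact: dnu.
  by rewrite Du scaleNr -vk opprK.
Qed.

(* In an orthonormal frame of principal directions the Gauss equation gives the
   sectional curvatures 1 + k_i k_j for the principal curvatures sqrt 3, 0,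
   - sqrt 3. *)
Lemma cartan_curvature x : U x -> diagonal_curvature h (-1) 2 (-1) x.
Proof.
move=> Ux; have [nu [L [[nn nq] nt LE Ll eig]]] := cartan_normal Ux.
pose s : R := Num.sqrt 3.
have ss : s * s = 3 by rewrite -expr2 sqr_sqrtr.
have s0 : s != 0 by rewrite gt_eqF // sqrtr_gt0.
have met := induced_metric phis hE.
have unit_eig k : k \in [:: s; 0; - s] -> exists E : V,
    bilform (h x) E E = 1 /\ L E = - k *: 'D_E phi x.
  move=> /eig [u [u0 Lu]].
  have d0 : 0 < bilform (h x) u u by rewrite met // dotv_gt0.
  pose c := (Num.sqrt (bilform (h x) u u))^-1.
  have dphi := differentiable_map phis Ux.
  exists (c *: u); split.
    rewrite !bilformE mulrA -expr2 /c exprVn sqr_sqrtr ?ltW //.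
    by rewrite mulVf // gt_eqF.
  have L0 : L 0 = 0 by have := Ll (-1) 0 0; rewrite scaler0 addr0 scaleN1r addNr.
  have := Ll c u 0; rewrite !addr0 L0 addr0 => ->.
  have -> : 'D_(c *: u) phi x = c *: 'D_u phi x by rewrite !deriveE // linearZ.
  by rewrite Lu !scalerA mulrC.
have [E0 [n0 l0]] : exists E, bilform (h x) E E = 1 /\ L E = - s *: 'D_E phi x.
  by apply: unit_eig; rewrite !inE eqxx.
have [E1 [n1 l1]] : exists E, bilform (h x) E E = 1 /\ L E = - 0 *: 'D_E phi x.
  by apply: unit_eig; rewrite !inE eqxx orbT.
have [E2 [n2 l2]] : exists E, bilform (h x) E E = 1 /\ L E = - (- s) *: 'D_E phi x.
  by apply: unit_eig; rewrite !inE eqxx !orbT.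
have eigE k E w : L E = - k *: 'D_E phi x -> dotv (sd E w x) nu = k * bilform (h x) E w.
  by move=> lE; rewrite LE lE dotvZl met // mulNr opprK.
(* Second derivatives are symmetric, so the shape operator is self-adjoint and distinct principal
   curvatures have orthogonal directions. *)
have orth k l E E' : k != l -> L E = - k *: 'D_E phi x -> L E' = - l *: 'D_E' phi x ->
    bilform (h x) E E' = 0.
  move=> kl lE lE'; have := eigE _ _ E' lE.
  rewrite (second_derive_sym Uo phis E E' Ux) (eigE _ _ E lE') => /eqP.
  rewrite (bilform_sym E' E) ?hsym // -subr_eq0 -mulrBl mulf_eq0 subr_eq0 eq_sym.
  by rewrite (negPf kl) => /eqP.
have o01 : bilform (h x) E0 E1 = 0 by exact: orth l0 l1.
have o02 : bilform (h x) E0 E2 = 0.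
  by apply: orth l0 l2; rewrite -subr_eq0 opprK -mulr2n mulrn_eq0.
have o12 : bilform (h x) E1 E2 = 0 by apply: orth l1 l2; rewrite eq_sym oppr_eq0.
have hS u v := @bilform_sym _ _ (h x) u v (hsym Ux).
pose t0 u := bilform (h x) u E0; pose t1 u := bilform (h x) u E1.
pose t2 u := bilform (h x) u E2.
have pars u v : bilform (h x) u v = t0 u * t0 v + t1 u * t1 v + t2 u * t2 v.
  rewrite (@orthonormal_expansion _ _ _ [:: E0; E1; E2]) ?hsym //.
    by rewrite !big_ord_recl big_ord0 /= addr0 addrA.
  by case=> [[|[|[|i]]] Hi] [[|[|[|j]]] Hj] //=; rewrite ?n0 ?n1 ?n2 ?o01 ?o02 ?o12 // hS
    ?o01 ?o02 ?o12.
have uE u : u = t0 u *: E0 + (t1 u *: E1 + (t2 u *: E2 + 0)).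
  apply: (bilform_inj (hu Ux)) => w; rewrite pars !bilformE bilform0l addr0 addrA.
  by rewrite (hS E0) (hS E1) (hS E2).
have L0 : L 0 = 0 by have := Ll (-1) 0 0; rewrite scaler0 addr0 scaleN1r addNr.
have II u v : dotv (sd u v x) nu = s * (t0 u * t0 v - t2 u * t2 v).
  have Lu : L u = t0 u *: (- s *: 'D_E0 phi x)
      + (t1 u *: (- 0 *: 'D_E1 phi x) + (t2 u *: (- - s *: 'D_E2 phi x) + 0)).
    by rewrite [in LHS](uE u) Ll Ll Ll L0 l0 l1 l2.
  have alg (a b c : R) (d0 d1 d2 y : 'rV[R]_5) :
      dotv (a *: (- s *: d0) + (b *: (- 0 *: d1) + (c *: (- - s *: d2) + 0))) y
      = - s * a * dotv d0 y + s * c * dotv d2 y.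
    rewrite !dotvDl !dotvZl (_ : dotv 0 y = 0) ?oppr0; first by ring.
    by rewrite -(scale0r 0) dotvZl mul0r.
  rewrite LE Lu alg -(met E0 v x Ux) -(met E2 v x Ux) (hS E0) (hS E2) -/(t0 v) -/(t2 v);
    ring.
(* The normal space in R^5 is spanned by the position vector and [nu]. The first contributes the
   curvature 1 of the unit sphere, the second the products of principal curvatures. *)
have normal_product v w u z : dotv (normal_part phi h v w x) (sd u z x)
    = bilform (h x) v w * bilform (h x) u z
      + s * (t0 v * t0 w - t2 v * t2 w) * (s * (t0 u * t0 z - t2 u * t2 z)).
  have nt' a b c : dotv (normal_part phi h a b x) ('D_c phi x) = 0.
    exact: (normal_part_tangent Uo phis hE hs hsym hu).
  have nq' a b : dotv (normal_part phi h a b x) (phi x) = - bilform (h x) a b.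
    by rewrite /normal_part dotvBl sphere_normal // sphere_tangent // subr0.
  have nn' a b : dotv (normal_part phi h a b x) nu = dotv (sd a b x) nu.
    by rewrite /normal_part dotvBl (dotvC ('D__ _ _)) nt subr0.
  have q1 := cartan_sphere (phiS Ux).
  have st a := sphere_tangent a Ux.
  have nt2 a : dotv ('D_a phi x) nu = 0 by rewrite dotvC.
  have mt a b : dotv ('D_a phi x) ('D_b phi x) = bilform (h x) a b by rewrite met.
  have nq2 : dotv (phi x) nu = 0 by rewrite dotvC.
  apply: etrans (dotv_expansion5 (a0 := 'D_E0 phi x) (a1 := 'D_E1 phi x)
    (a2 := 'D_E2 phi x) (a3 := phi x) (a4 := nu) _ _ _ _ _ _ _ _) _.
  - by split=> //; rewrite mt.
  - by split=> //; rewrite mt.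
  - by split; exact: st.
  - by split; [exact: nt2|exact: nt2|exact: nt2|].
  - exact: nt'.
  - exact: nt'.
  - exact: nt'.
  - apply: congr2 (congr2 *%R (etrans (nn' v w) (II v w)) (II u z)).
    exact: etrans (congr2 *%R (nq' v w) (sphere_normal u z Ux)) (mulrNN _ _).
exists E0, E1, E2; split => //.
move=> u v w z.
apply: etrans (etrans (gauss_equation Uo phis hE hs hsym hu u v w z Ux)
  (congr2 (fun a b => a - b) (normal_product v w u z) (normal_product u w v z))) _.
have sE a b : s * a * (s * b) = 3 * (a * b) by rewrite mulrACA ss.
rewrite (sE (t0 v * t0 w - t2 v * t2 w)) (sE (t0 u * t0 w - t2 u * t2 w)).
rewrite (pars v w) (pars u z) (pars u w) (pars v z) -!/(t0 _) -!/(t1 _) -!/(t2 _).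
by move: (t0 u) (t0 v) (t0 w) (t0 z) (t1 u) (t1 v) (t1 w) (t1 z) (t2 u) (t2 v) (t2 w)
  (t2 z)
  => *; ring.
Qed.

End Cartan.

(** * Proof of the theorem *)

Section Charts.
Variables (R : realType) (n : nat) (M : metric_atlas R n).
Hypothesis Msr : semi_riemannian M.

Lemma open_image_dom (c : chart M) : open (image_dom c).
Proof. by case: Msr => -[_ _ _ [/(_ c) [] ]]. Qed.

Lemma smooth_components (c : chart M) i j : smooth_on (image_dom c) (fun x => components
  c x i j).
Proof. by case: Msr. Qed.

Lemma components_sym (c : chart M) x : image_dom c x -> (components c x)^T = components
  c x.
Proof. by case: Msr => _ _ /(_ c x) H _ /H []. Qed.

Lemma components_unit (c : chart M) x : image_dom c x -> components c x \in unitmx.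
Proof. by case: Msr => _ _ /(_ c x) H _ /H []. Qed.

Lemma chart_coordK (c : chart M) p : chart_dom c p -> chart_param c (chart_coord c p) = p.
Proof. by case: Msr => -[_ _ _ [_ _ H _ _]] _ _ _; exact: H. Qed.

Lemma exists_chart (p : M) : exists c : chart M, chart_dom c p.
Proof. by case: Msr => -[_ _ _ [_ _ _ H _]] _ _ _; exact: H. Qed.

Lemma open_overlap (c d : chart M) : open (chart_coord c @` (chart_dom c `&` chart_dom
  d)).
Proof.
have oc : open (image_dom c) by exact: open_image_dom.
have [od cp] : open (chart_dom c `&` chart_dom d) /\
    {within image_dom c, continuous (@chart_param _ _ M c)}.
  case: Msr => -[_ _ _ [od cont _ _ _]] _ _ _.
  by split; [apply: openI; [case: (od c)|case: (od d)]|case: (cont c)].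
have -> : chart_coord c @` (chart_dom c `&` chart_dom d)
    = image_dom c `&` (@chart_param _ _ M c) @^-1` (chart_dom c `&` chart_dom d).
  apply/seteqP; split=> [x [p [cp' dp] <-]|x [[p cp' <-]]] /=.
    by split; [exists p|rewrite chart_coordK].
  by rewrite chart_coordK // => ?; exists p.
rewrite openE => x [ix ox]; apply: filterI; first exact: open_nbhs_nbhs.
move: cp; rewrite continuous_open_subspace // => /(_ x) cp.
by apply: cp; [exact: mem_set|exact: open_nbhs_nbhs].
Qed.

End Charts.

Section BaseManifold.
Variables (R : realType) (M : metric_atlas R 1) (F : M -> R) (eps : R).
Hypothesis Msr : semi_riemannian M.
Hypothesis eps1 : eps = 1 \/ eps = -1.
Hypothesis Meps : forall (c : chart M) x, image_dom c x -> components c x 0 0 = eps.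
Hypothesis Fs : smooth_function F.
Local Notation one := (delta_mx 0 0 : 'rV[R]_1).

(* The transition maps have derivative +1 or -1, because both charts give the
   metric the component eps; so their second derivative vanishes and the second
   derivative of F does not depend on the chart. *)
Lemma base_derivatives (c d : chart M) p : chart_dom c p -> chart_dom d p ->
  let fc := F \o chart_param c in let fd := F \o chart_param d in
  ('D_one fc (chart_coord c p)) ^+ 2 = ('D_one fd (chart_coord d p)) ^+ 2 /\
  'D_one ('D_one fc) (chart_coord c p) = 'D_one ('D_one fd) (chart_coord d p).
Proof.
move=> cp dp fc fd.
pose D := chart_coord c @` (chart_dom c `&` chart_dom d).
have Do : open D by exact: open_overlap.
pose phi := chart_coord d \o chart_param c.
have phis : smooth_map_on D phi.
  by case: Msr => -[_ _ _ [_ _ _ _ H]] _ _ _; exact: H.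
have phiD t : D t -> image_dom d (phi t).
  by case=> m [cm dm] <-; rewrite /phi /= (chart_coordK Msr) //; exists m.
have FE t : D t -> fc t = fd (phi t).
  by case=> m [cm dm] <-; rewrite /fc /fd /phi /= !(chart_coordK Msr).
pose j : 'rV[R]_1 -> R := 'D_one (fun y => phi y 0 0).
have sj : smooth_fun D j by apply: smooth_fun_deriv => //; exact/SmoothOn/phis.
have Dphi t : D t -> 'D_one phi t = j t *: one.
  by move=> Dt; apply/rowP => k; rewrite (derive_map phis) // !mxE !ord1 mulr1.
have j2 t : D t -> j t * j t = 1.
  move=> Dt; have dphi := differentiable_map phis Dt.
  have ic : image_dom c t by case: Dt => m [cm _] <-; exists m.
  case: Msr => _ _ _ /(_ c d t Dt) /= /(congr1 (fun A => bilform A one one)).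
  rewrite bilform_jacobian; last by move=> k; exact: (phis k [::]).
  rewrite !bilform11 Dphi // !mxE !mulr1 Meps // Meps; last exact: phiD.
  by case: eps1 => -> E; rewrite ?mul1r ?mulN1r in E; [|apply: oppr_inj]; rewrite -E.
have j0 t : D t -> j t != 0.
  by move=> /j2 E; apply/eqP => jt; move/eqP: E; rewrite jt mul0r eq_sym oner_eq0.
have dj t : D t -> 'D_one j t = 0.
  move=> Dt; have hj : has_derivative j t one ('D_one j t).
    by apply: has_derivative_self; exact: smooth_fun_differentiable sj _ Dt.
  have [_ E] := has_derivativeM hj hj.
  have : 'D_one (fun y => j y * j y) t = 0.
    rewrite -[RHS](derive_cst (1 : R) t one); apply: near_eq_derive.
    by apply: near_open Do Dt _ => y Dy; rewrite j2.
  rewrite E mulrC -mulr2n => /eqP; rewrite mulrn_eq0 /= mulf_eq0 (negPf (j0 t Dt)) /=.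
  by move/eqP.
have sd : smooth_fun (image_dom d) fd by apply: SmoothOn; exact: Fs.
have sd1 : smooth_fun (image_dom d) ('D_one fd).
  by apply: smooth_fun_deriv => //; exact: (open_image_dom Msr).
have chain (k : 'rV[R]_1 -> R) t : smooth_fun (image_dom d) k -> D t ->
    has_derivative (fun y => k (phi y)) t one ('D_one k (phi t) * j t).
  move=> sk Dt.
  have dk : differentiable k (phi t).
    by apply: smooth_fun_differentiable sk _ (phiD t Dt); exact: (open_image_dom Msr).
  have dphi := differentiable_map phis Dt.
  split; first exact: (@differentiable_comp _ _ _ _ phi k).
  rewrite -[fun y => _]/(k \o phi) (chain_rule_map phis) // Dphi //.
  by rewrite !deriveE // linearZ mulrC.
have d1 t : D t -> 'D_one fc t = 'D_one fd (phi t) * j t.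
  move=> Dt; have [_ <-] := chain _ t sd Dt; apply: near_eq_derive.
  by apply: near_open Do Dt _ => y Dy; rewrite FE.
have Dp : D (chart_coord c p) by exists p.
have phip : phi (chart_coord c p) = chart_coord d p by rewrite /phi /= (chart_coordK Msr).
split; first by rewrite d1 // exprMn [j _ ^+ 2]expr2 j2 // mulr1 phip.
have hj : has_derivative j (chart_coord c p) one ('D_one j (chart_coord c p)).
  by apply: has_derivative_self; exact: smooth_fun_differentiable sj _ Dp.
have [_ E] := has_derivativeM (chain _ _ sd1 Dp) hj.
have alg (A B k dk : R) : k * k = 1 -> dk = 0 -> A * k * k + B * dk = A.
  by move=> kk ->; rewrite mulr0 addr0 -mulrA kk mulr1.
rewrite -phip; apply: etrans (etrans E (alg _ _ _ _ (j2 _ Dp) (dj _ Dp))).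
by apply: near_eq_derive; apply: near_open Do Dp _ => y Dy; rewrite d1.
Qed.

End BaseManifold.

Section Fibre.
Variables (R : realType) (N : metric_atlas R 3).
Hypothesis Nr : riemannian N.
Let Nsr : semi_riemannian N := Nr.1.

Let hs (c : chart N) i j : smooth_fun (image_dom c) (fun x => components c x i j).
Proof. exact/SmoothOn/smooth_components. Qed.

(** [su2_P] is symmetric in its last two arguments, so mu = nu makes two entries equal. This clause
    serves the Berger spheres, which are rescaled in the first direction only. *)
Lemma sphere_fibre lambda mu nu : 0 < lambda -> 0 < mu -> 0 < nu ->
  kaluza_klein_sphere N lambda mu nu ->
  exists p0 p1 p2 : R, (mu = nu -> p1 = p2) /\
    forall (c : chart N) x, image_dom c x -> diagonal_curvature (components c) p0 p1 p2 x.
Proof.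
move=> l0 m0 n0 [f [fs finj fim fE]].
exists (su2_P (- 2 * Num.sqrt lambda / (Num.sqrt mu * Num.sqrt nu))
  (- 2 * Num.sqrt mu / (Num.sqrt nu * Num.sqrt lambda))
  (- 2 * Num.sqrt nu / (Num.sqrt lambda * Num.sqrt mu))).
exists (su2_P (- 2 * Num.sqrt mu / (Num.sqrt nu * Num.sqrt lambda))
  (- 2 * Num.sqrt nu / (Num.sqrt lambda * Num.sqrt mu))
  (- 2 * Num.sqrt lambda / (Num.sqrt mu * Num.sqrt nu))).
exists (su2_P (- 2 * Num.sqrt nu / (Num.sqrt lambda * Num.sqrt mu))
  (- 2 * Num.sqrt lambda / (Num.sqrt mu * Num.sqrt nu))
  (- 2 * Num.sqrt mu / (Num.sqrt nu * Num.sqrt lambda))).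
split.
  move=> ->; rewrite /su2_P [Num.sqrt nu * Num.sqrt lambda]mulrC; ring.
move=> c x cx.
apply: (su2_curvature (open_image_dom Nsr (c := c)) (hs c) (components_sym Nsr (c := c))
  (components_unit Nsr (c := c)) (fs c)) => //; last exact: fE.
by move=> y _; rewrite -fim; exists (chart_param c y).
Qed.

Lemma axial_fibre p0 p1 p2 : p0 = p1 \/ p1 = p2 \/ p2 = p0 ->
  (forall (c : chart N) x, image_dom c x -> diagonal_curvature (components c) p0 p1 p2
    x) ->
  exists alpha beta, forall (c : chart N) x, image_dom c x ->
    axial_curvature (components c) alpha beta x.
Proof.
move=> pp dc; have [alpha [beta ax]] := axial_of_diagonal pp.
exists alpha, beta => c x cx; apply: ax; first exact: (components_sym Nsr).
exact: dc.
Qed.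

Lemma listed_fibre_axial : listed_fibre N ->
  exists alpha beta, forall (c : chart N) x, image_dom c x ->
    axial_curvature (components c) alpha beta x.
Proof.
case=> [[t [t0 _ sph]]|[nil|[psl|[sol|[car|]]]]].
- have [p0 [p1 [p2 [pp dc]]]] := sphere_fibre t0 ltr01 ltr01 sph.
  by apply: axial_fibre dc; right; left; exact: pp.
- case: nil => f [fs _ _ fE]; apply: (@axial_fibre (- 4^-1) (- 4^-1) (3 / 4)); first by
  left.
  move=> c x cx; apply: (nil_curvature (open_image_dom Nsr (c := c)) (hs c)
    (components_sym Nsr (c := c)) (components_unit Nsr (c := c)) (fs c)) => //; exact: fE.
- case: psl => f [fs _ fim fE]; apply: (@axial_fibre (- 4^-1) (- 4^-1) (7 / 4)); first
  by left.
  move=> c x cx; apply: (psl2_curvature (open_image_dom Nsr (c := c)) (hs c)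
    (components_sym Nsr (c := c)) (components_unit Nsr (c := c)) (fs c)) => //.
    move=> y _; have : (f @` [set: N]) (f (chart_param c y)) by exists (chart_param c y).
    by rewrite fim.
  exact: fE.
- case: sol => f [fs _ _ fE]; apply: (@axial_fibre 1 1 (-1)); first by left.
  move=> c x cx; apply: (sol_curvature (open_image_dom Nsr (c := c)) (hs c)
    (components_sym Nsr (c := c)) (components_unit Nsr (c := c)) (fs c)) => //; exact: fE.
- case: car => Sigma [W [SC Wo [f [fs _ fim fE]]]].
  apply: (@axial_fibre (-1) 2 (-1)); first by right; right.
  move=> c x cx; apply: (cartan_curvature (open_image_dom Nsr (c := c)) (fs c) _ (hs c)
    (components_sym Nsr (c := c)) (components_unit Nsr (c := c)) SC) => //; first exact:
      fE.
  move=> y _; have : (f @` [set: N]) (f (chart_param c y)) by exists (chart_param c y).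
  by rewrite fim => -[].
- case=> lambda [mu [nu [l0 m0 n0 sph two]]].
  have [p0 [p1 [p2 [_ dc]]]] := sphere_fibre l0 m0 n0 sph.
  have [e01|n01] := eqVneq p0 p1; first by apply: axial_fibre dc; left.
  have [e12|n12] := eqVneq p1 p2; first by apply: axial_fibre dc; right; left.
  have [e20|n20] := eqVneq p2 p0; first by apply: axial_fibre dc; right; right.
  (* Three distinct entries would give three distinct Ricci eigenvalues at any point of a chart,
     against the assumption; the constants are arbitrary in this case. *)
  exists 0, 0 => c x cx; exfalso.
  have [a [b [_ ev]]] := two c x cx.
  have [/ev e0 /ev e1 /ev e2] := diagonal_ricci_eigenvalues (components_sym Nsr cx)
    (components_unit Nsr cx) (dc c x cx).
  have q01 : - (p1 + p2) <> - (p2 + p0).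
    by move=> /oppr_inj; rewrite addrC => /addrI /eqP; rewrite eq_sym (negPf n01).
  have q12 : - (p2 + p0) <> - (p0 + p1).
    by move=> /oppr_inj; rewrite addrC => /addrI /eqP; rewrite eq_sym (negPf n12).
  have q20 : - (p0 + p1) <> - (p1 + p2).
    by move=> /oppr_inj; rewrite addrC => /addrI /eqP; rewrite eq_sym (negPf n20).
  by case: e0 e1 e2 q01 q12 q20 => -> [] -> [] ->.
Qed.

End Fibre.

Lemma warped_identities (R : realType) (a : 'rV[R]_1 -> 'M[R]_1) (f : 'rV[R]_1 -> R)
    (h : 'rV[R]_3 -> 'M[R]_3) (U1 : set 'rV[R]_1) (U2 : set 'rV[R]_3)
    (eps alpha beta : R) (x : 'rV[R]_(1 + 3)) :
  open U1 -> open U2 -> eps = 1 \/ eps = -1 ->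
  (forall t, U1 t -> a t 0 0 = eps) -> smooth_on U1 f ->
  (forall t, U1 t -> 0 < f t) ->
  (forall i j, smooth_on U2 (fun y => h y i j)) ->
  (forall y, U2 y -> (h y)^T = h y) -> (forall y, U2 y -> h y \in unitmx) ->
  U1 (lsubmx x) -> U2 (rsubmx x) ->
  axial_curvature h alpha beta (rsubmx x) ->
  let g := warped_metric a f h in
  let one := delta_mx 0 0 : 'rV[R]_1 in
  let t := lsubmx x in
  let q := - ('D_one ('D_one f) t / 2 - 'D_one f t ^+ 2 / (4 * f t)) / f t in
  exists xi e p, [/\ (g x)^T = g x, g x \in unitmx &
   [/\ bilform (g x) xi xi = eps, bilform (g x) e e = 1, bilform (g x) xi e = 0 &
    riemann g x = tens4 (g x) xi e p (q - eps * p) (beta / f t) (- eps * (beta / f t))]].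
Proof.
move=> U1o U2o eps1 aE fs f0 hs hsym hu Ut Uy [e [ee cE]] g one t q.
have Ux : warped_dom U1 U2 x by split.
have bE u v := bilform_warped f h aE u v Ux.
pose s := Num.sqrt (f t).
have ft0 : 0 < f t by exact: f0.
have s0 : s != 0 by rewrite gt_eqF // sqrtr_gt0.
have fE : f t = s * s by rewrite -expr2 sqr_sqrtr // ltW.
(* [xi] is the coordinate vector of the base, and [E] is the axis rescaled from unit length for h to
   unit length for f h. *)
pose xi : 'rV[R]_(1 + 3) := row_mx 1%:M 0.
pose E : 'rV[R]_(1 + 3) := row_mx 0 (s^-1 *: e).
have e2 : eps * eps = 1 by case: eps1 => ->; rewrite ?mulrNN mulr1.
have xi0 : xi 0 0 = 1.
  by rewrite mxE; case: split_ordP => // j _; rewrite mxE (ord1 j).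
have E0 : E 0 0 = 0 by rewrite mxE; case: split_ordP => // j _; rewrite mxE.
have bxi u : bilform (g x) u xi = eps * u 0 0.
  by rewrite bE xi0 row_mxKr bilform0r mulr1 mulr0 addr0.
have bEE u : bilform (g x) u E = s * bilform (h (rsubmx x)) (rsubmx u) e.
  rewrite bE E0 row_mxKr bilformZr -/t fE !mulr0 add0r -mulrA (mulrA s s^-1) mulfV //.
  by rewrite mul1r.
(* The fibre curvature and the umbilicity of the slices together contribute (f alpha - eps f'^2 / 4)
   / 2 h ^ h, and h ^ h is H ^ H divided by f^2. *)
exists xi, E, ((f t * alpha - eps * 'D_one f t ^+ 2 / 4) / f t ^+ 2).
split; first exact: (warped_sym a f hsym Ux).
  exact: (warped_unit eps1 aE f0 hu Ux).
split.
- by rewrite bxi xi0 mulr1.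
- by rewrite bEE row_mxKr bilformZl ee mulr1 mulfV.
- by rewrite bEE row_mxKr bilform0l mulr0.
apply/funext => X1; apply/funext => X2; apply/funext => X3; apply/funext => X4.
rewrite (riemann_warped U1o U2o eps1 aE fs f0 hs hsym hu X1 X2 X3 X4 Ux) cE.
rewrite /tens4 /kulkarni_nomizu !bxi !bEE !bE -/t /q fE.
have -> : beta / (s * s) = beta * s^-1 * s^-1 by rewrite invfM mulrA.
move: ('D_one _ t) ('D_one ('D_one f) t) => f1 f2.
move: (h _) => H.
move: (bilform H (rsubmx X1) (rsubmx X3)) (bilform H (rsubmx X1) (rsubmx X4))
  (bilform H (rsubmx X2) (rsubmx X3)) (bilform H (rsubmx X2) (rsubmx X4)).
move: (bilform H (rsubmx X1) e) (bilform H (rsubmx X2) e)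
  (bilform H (rsubmx X3) e) (bilform H (rsubmx X4) e).
move: (X1 0 0) (X2 0 0) (X3 0 0) (X4 0 0); clearbody s => *.
by case: eps1 => ->; field.
Qed.

Theorem theorem4p2 (R : realType) (M : metric_atlas R 1) (N : metric_atlas R 3)
    (F : M -> R) (eps : R) :
  semi_riemannian M ->
  eps = 1 \/ eps = -1 ->
  (forall (c : chart M) x, image_dom c x -> components c x 0 0 = eps) ->
  riemannian N ->
  listed_fibre N ->
  smooth_function F ->
  (forall p, 0 < F p) ->
  let W := warped_product N F in
  exists L LC : W -> R,
    forall (c : chart W) (p : W), chart_dom c p ->
    let gc := @components R (1 + 3) W c in
    let x := chart_coord c p in
    let n : R := (1 + 3)%:R in
    let g := metric gc x in
    let Rm := riemann gc x in
    let S := ricci gc x in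
    let S2 := ricci2 gc x in
    let kappa := scalar_curv gc x in
    let C := weyl gc x in
    forall X1 X2 X3 X4 X Y : 'rV[R]_(1 + 3),
    [/\ dotT (gc x) Rm Rm X1 X2 X3 X4 X Y - tachibana S Rm X1 X2 X3 X4 X Y
          = L p * tachibana g C X1 X2 X3 X4 X Y,
        dotT (gc x) C C X1 X2 X3 X4 X Y
          = LC p * tachibana g C X1 X2 X3 X4 X Y
      & dotT (gc x) C Rm X1 X2 X3 X4 X Y + dotT (gc x) Rm C X1 X2 X3 X4 X Y
          = tachibana S C X1 X2 X3 X4 X Y
            + (L p + LC p) * tachibana g C X1 X2 X3 X4 X Y
            - ((n - 2) ^+ 2)^-1 *
              tachibana g (fun Y1 Y2 Y3 Y4 =>
                (n - 2) / 2 * kulkarni_nomizu S S Y1 Y2 Y3 Y4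
                - kappa * kulkarni_nomizu g S Y1 Y2 Y3 Y4
                + kulkarni_nomizu g S2 Y1 Y2 Y3 Y4) X1 X2 X3 X4 X Y].
Proof.
move=> Msr eps1 Meps Nr listed Fs F0 W.
have [alpha [beta axial]] := listed_fibre_axial Nr listed.
pose one := delta_mx 0 0 : 'rV[R]_1.
pose fc (c : chart M) := F \o chart_param c.
pose Q (c : chart M) (t : 'rV[R]_1) (y : R) := - ('D_one ('D_one (fc c)) t / 2 - 'D_one
  (fc c) t ^+ 2 / (4 * y)) / y.
(* L has to be a function on the manifold, while q is computed in a chart: a chart is chosen at
   every point of the base, and [base_derivatives] later exchanges it for the given one. *)
pose c0 (m : M) := sval (cid (exists_chart Msr m)).
exists (fun p => - 2 * eps * Q (c0 p.1) (chart_coord (c0 p.1) p.1) (F p.1)).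
exists (fun p => beta / F p.1 / 6).
move=> [c1 c2] [m y] [/= cm cy] X1 X2 X3 X4 X Y.
have Nsr : semi_riemannian N by case: Nr.
set x := row_mx (chart_coord c1 m) (chart_coord c2 y).
have im : image_dom c1 (lsubmx x) by rewrite row_mxKl; exists m.
have iy : image_dom c2 (rsubmx x) by rewrite row_mxKr; exists y.
have ax : axial_curvature (components c2) alpha beta (rsubmx x) by exact: axial.
have fE : fc c1 (lsubmx x) = F m by rewrite row_mxKl /fc /= (chart_coordK Msr).
have QE : Q (c0 m) (chart_coord (c0 m) m) (F m) = Q c1 (lsubmx x) (fc c1 (lsubmx x)).
  have c0m : chart_dom (c0 m) m by rewrite /c0; case: cid.
  have [E1 E2] := base_derivatives Msr eps1 Meps Fs c0m cm.
  by rewrite fE row_mxKl /Q /fc E1 E2.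
have [xi [e [p [gs gu [xixi ee xie cE]]]]] := @warped_identities R (@components R 1 M
  c1) (fc c1)
  (@components R 3 N c2) (image_dom c1) (image_dom c2) eps alpha beta x
  (open_image_dom Msr (c := c1)) (open_image_dom Nsr (c := c2)) eps1 (Meps c1) (Fs c1)
  (fun t _ => F0 _) (smooth_components Nsr (c := c2)) (components_sym Nsr (c := c2))
  (components_unit Nsr (c := c2)) im iy ax.
have := pseudosymmetric_identities gs gu eps1 xixi ee xie cE X1 X2 X3 X4 X Y.
rewrite QE -fE; exact.
Qed.
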